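(* Let $\mathcal{U}_q(\hat{\mathfrak{g}})$ be the quantum affinization attached to a symmetrizable generalized Cartan matrix $C$. Let $\mathcal{U}_q(\hat{\mathfrak{g}})^+$ (resp. $\mathcal{U}_q(\hat{\mathfrak{g}})^-$, $\mathcal{U}_q(\hat{\mathfrak{h}})$) be the subalgebra of $\mathcal{U}_q(\hat{\mathfrak{g}})$ generated by all $x_{i,r}^+$ (resp. all $x_{i,r}^-$, resp. all $k_h$ and $h_{i,m}$). Then $(\mathcal{U}_q(\hat{\mathfrak{g}})^-,\mathcal{U}_q(\hat{\mathfrak{h}}),\mathcal{U}_q(\hat{\mathfrak{g}})^+)$ is a triangular decomposition of $\mathcal{U}_q(\hat{\mathfrak{g}})$. Moreover $\mathcal{U}_q(\hat{\mathfrak{h}})$ is isomorphic to the algebra with generators $k_h$ ($h\in\mathfrak{h}$), $h_{i,m}$ ($i\in I$, $m\in\mathbb{Z}\setminus\{0\}$) and relations (R1); $\mathcal{U}_q(\hat{\mathfrak{g}})^+$ is isomorphic to the algebra with generators $x_{i,r}^+$ ($i\in I$, $r\in\mathbb{Z}$) and relations (R5), (R6) with sign $+$; and $\mathcal{U}_q(\hat{\mathfrak{g}})^-$ is isomorphic to the algebra with generators $x_{i,r}^-$ and relations (R5), (R6) with sign $-$. (Here (R1), (R5), (R6) are the relations listed in the context.)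
   Context: $q\in\mathbb{C}^*$ is not a root of unity; a logarithm of $q$ is fixed so that $q^a$ makes sense for $a\in\mathbb{Q}$. $C=(C_{i,j})_{i,j\in I}$, $I=\{1,\dots,n\}$, is a generalized Cartan matrix: $C_{i,j}\in\mathbb{Z}$, $C_{i,i}=2$, $C_{i,j}\le 0$ for $i\neq j$, $C_{i,j}=0\Leftrightarrow C_{j,i}=0$. It is symmetrizable: positive integers $r_1,\dots,r_n$ are fixed such that $B=(B_{i,j})$, $B_{i,j}=r_iC_{i,j}$, is symmetric. $q_i=q^{r_i}$, $[m]_z=\frac{z^m-z^{-m}}{z-z^{-1}}$, and $\begin{bmatrix}s\\k\end{bmatrix}_z$ is the corresponding symmetric Gaussian binomial coefficient. A realization of $C$ is fixed: $\mathfrak{h}$ is a $\mathbb{Q}$-vector space of dimension $2n-\mathrm{rank}(C)$, with linearly independent families $\alpha_1,\dots,\alpha_n\in\mathfrak{h}^*$ and $\alpha_1^\vee,\dots,\alpha_n^\vee\in\mathfrak{h}$ satisfying $\alpha_j(\alpha_i^\vee)=C_{i,j}$. The quantum affinization $\mathcal{U}_q(\hat{\mathfrak{g}})$ is the $\mathbb{C}$-algebra with generators $x_{i,r}^{\pm}$ ($i\in I,r\in\mathbb{Z}$), $k_h$ ($h\in\mathfrak{h}$), $h_{i,m}$ ($i\in I$, $m\in\mathbb{Z}\setminus\{0\}$) and relations (R1) $k_hk_{h'}=k_{h+h'}$, $k_0=1$, $[k_h,h_{j,m}]=0$, $[h_{i,m},h_{j,m'}]=0$; (R2) $k_hx_{j,r}^{\pm}k_{-h}=q^{\pm\alpha_j(h)}x_{j,r}^{\pm}$;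 (R3) $[h_{i,m},x_{j,r}^{\pm}]=\pm\frac1m[mB_{i,j}]_q\,x_{j,m+r}^{\pm}$; (R4) $[x_{i,r}^+,x_{j,r'}^-]=\delta_{i,j}\frac{\phi^+_{i,r+r'}-\phi^-_{i,r+r'}}{q_i-q_i^{-1}}$; (R5) $x_{i,r+1}^{\pm}x_{j,r'}^{\pm}-q^{\pm B_{i,j}}x_{j,r'}^{\pm}x_{i,r+1}^{\pm}=q^{\pm B_{i,j}}x_{i,r}^{\pm}x_{j,r'+1}^{\pm}-x_{j,r'+1}^{\pm}x_{i,r}^{\pm}$; (R6) $\sum_{\pi\in\Sigma_s}\sum_{k=0}^{s}(-1)^k\begin{bmatrix}s\\k\end{bmatrix}_{q_i}x_{i,r_{\pi(1)}}^{\pm}\cdots x_{i,r_{\pi(k)}}^{\pm}x_{j,r'}^{\pm}x_{i,r_{\pi(k+1)}}^{\pm}\cdots x_{i,r_{\pi(s)}}^{\pm}=0$ for all $i\neq j$, $s=1-C_{i,j}$, and all $r_1,\dots,r_s,r'\in\mathbb{Z}$ ($\Sigma_s$ the symmetric group). Here $\phi_{i,m}^{\pm}$ is defined by $\sum_{m\ge0}\phi_{i,\pm m}^{\pm}z^{\pm m}=k_{\pm r_i\alpha_i^\vee}\exp\big(\pm(q-q^{-1})\sum_{m'\ge1}h_{i,\pm m'}z^{\pm m'}\big)$, with $\phi^+_{i,m}=0$ for $m<0$ and $\phi^-_{i,m}=0$ for $m>0$. A triangular decomposition of an algebra $A$ is a triple of subalgebras $(A^-,H,A^+)$ such that multiplication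 $x^-\otimes h\otimes x^+\mapsto x^-hx^+$ is an isomorphism of vector spaces $A^-\otimes H\otimes A^+\simeq A$. *)

(* Defs.v *)
From HB Require Import structures.
From mathcomp Require Import all_boot all_order perm all_algebra.
From mathcomp Require Import boolp reals sequences exp trigo complex.
From mathcomp Require Import generic_quotient ring_quotient monalg.

Set Implicit Arguments.
Unset Strict Implicit.
Unset Printing Implicit Defensive.

Import GRing.Theory.

Local Open Scope ring_scope.
Local Open Scope quotient_scope.

Section Span.
Variables (K : comNzRingType) (V : lmodType K) (S : V -> Prop).

Inductive in_span : V -> Prop :=
| in_span0 : in_span 0
| in_spanP (c : K) (u v : V) : S u -> in_span v -> in_span (c *: u + v).

Definition span : {pred V} := fun v => `[< in_span v >].

Lemma spanP (v : V) : reflect (in_span v) (v \in span).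
Proof. exact: asboolP. Qed.

Lemma span_closed : subsemimod_closed span.
Proof.
split; first split; first by apply/spanP; left.
  move=> u v /spanP Su /spanP Sv; apply/spanP.
  by elim: Su => [|c w w' Sw _ IH]; rewrite ?add0r // -addrA; right.
move=> a u /spanP Su; apply/spanP.
elim: Su => [|c w w' Sw _ IH]; first by rewrite scaler0; left.
by rewrite scalerDr scalerA; right.
Qed.

HB.instance Definition _ := GRing.isSubmodClosed.Build K V span span_closed.

Definition lquot := {ideal_quot span}.

HB.instance Definition _ := Choice.on lquot.
HB.instance Definition _ := GRing.Zmodule.on lquot.

Definition lpi : V -> lquot := \pi_lquot.

Lemma lpi_eq (u v : V) : (lpi u = lpi v) <-> in_span (u - v).
Proof.
split=> [/eqP|H]; first by rewrite -Quotient.idealrBE => /spanP.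
by apply/eqP; rewrite -Quotient.idealrBE; apply/spanP.
Qed.

Lemma lpiK (x : lquot) : lpi (repr x) = x. Proof. exact: reprK. Qed.

Lemma lpiB : {morph lpi : u v / u - v}.
Proof. by move=> u v; rewrite /lpi !piE. Qed.

Lemma lpiD : {morph lpi : u v / u + v}.
Proof. by move=> u v; rewrite /lpi !piE. Qed.

Lemma repr_lpi (u : V) : in_span (repr (lpi u) - u).
Proof. by apply/lpi_eq; rewrite lpiK. Qed.

Definition lquot_scale (c : K) (x : lquot) : lquot := lpi (c *: repr x).

Lemma lpiZ (c : K) (u : V) : lquot_scale c (lpi u) = lpi (c *: u).
Proof.
apply/lpi_eq; rewrite -scalerBr; apply/spanP; rewrite rpredZ //.
by apply/spanP/repr_lpi.
Qed.

Lemma lquot_scaleA a b (x : lquot) :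
  lquot_scale a (lquot_scale b x) = lquot_scale (a * b) x.
Proof. by rewrite -[x]lpiK !lpiZ scalerA. Qed.

Lemma lquot_scale1 : left_id 1 lquot_scale.
Proof. by move=> x; rewrite -[x]lpiK lpiZ scale1r. Qed.

Lemma lquot_scaleDr : right_distributive lquot_scale +%R.
Proof.
by move=> c x y; rewrite -[x]lpiK -[y]lpiK -lpiD !lpiZ -lpiD scalerDr.
Qed.

Lemma lquot_scaleDl (x : lquot) :
  {morph lquot_scale^~ x : a b / a + b >-> a + b}.
Proof. by move=> a b /=; rewrite -[x]lpiK !lpiZ -lpiD scalerDl. Qed.

HB.instance Definition _ := GRing.Zmodule_isLmodule.Build K lquot
  lquot_scaleA lquot_scale1 lquot_scaleDr lquot_scaleDl.

Lemma lpi_is_linear : linear lpi.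
Proof. by move=> c u v; rewrite lpiD -lpiZ. Qed.

HB.instance Definition _ := GRing.isLinear.Build K V lquot *:%R lpi
  lpi_is_linear.

End Span.

Section Tensor.
Variables (K : comNzRingType) (U V : lmodType K).

Local Notation F := {malg K[(U * V)%type]}.

Definition free_tens (u : U) (v : V) : F := << (u, v) >>.

Inductive tens_rel : F -> Prop :=
| tens_linl c u u' v : tens_rel
    (free_tens (c *: u + u') v - (c *: free_tens u v + free_tens u' v))
| tens_linr c u v v' : tens_rel
    (free_tens u (c *: v + v') - (c *: free_tens u v + free_tens u v')).

Definition tensor := lquot tens_rel.
HB.instance Definition _ := GRing.Lmodule.on tensor.

Definition tens (u : U) (v : V) : tensor := lpi tens_rel (free_tens u v).

End Tensor.

Section FreeAlgebra.
Variables (K : comNzRingType) (X : choiceType).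

(* The library makes this an algebra only for commutative monoids. *)
Definition free_alg := {malg K[{fmonom X}]}.

HB.instance Definition _ := GRing.Lalgebra.on free_alg.

Lemma free_alg_scaleAr (c : K) (u v : free_alg) : c *: (u * v) = u * (c *: v).
Proof.
have scE (w : free_alg) : c *: w = c%:MP * w by rewrite mul_malgC.
suff comm_c (w : free_alg) : c%:MP * w = w * c%:MP.
  by rewrite !scE mulrA comm_c mulrA.
rewrite !malgM_def fgmulUg fgmulgU; apply: eq_bigr => k _.
by rewrite mul1m mulm1 mulrC.
Qed.

HB.instance Definition _ :=
  GRing.Lalgebra_isAlgebra.Build K free_alg free_alg_scaleAr.

Definition free_gen (x : X) : free_alg := << fmu x >>.

Section Counit.
Variable e : X -> K.

Definition word_eval (w : {fmonom X}) : K := \prod_(x <- fmonom_val w) e x.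

Lemma word_eval_mmorphism : mmorphism word_eval.
Proof.
split=> [v w|]; rewrite /word_eval; first by rewrite fmM big_cat.
by rewrite fm1 big_nil.
Qed.

HB.instance Definition _ :=
  monalg.isMultiplicative.Build {fmonom X} K word_eval word_eval_mmorphism.

Definition free_eval : free_alg -> K := mmap idfun word_eval.

HB.instance Definition _ := GRing.RMorphism.copy free_eval (mmap idfun word_eval).

Lemma free_evalZ (c : K) (u : free_alg) : free_eval (c *: u) = c * free_eval u.
Proof. exact: mmapZ. Qed.

Lemma free_eval_gen (x : X) : free_eval (free_gen x) = e x.
Proof.
by rewrite /free_eval /= mmapU /= mul1r /word_eval fmU big_seq1.
Qed.

End Counit.

End FreeAlgebra.

Section TwoSided.
Variables (K : comNzRingType) (A : algType K) (S : A -> Prop).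

(* The span of these elements is the two-sided ideal generated by S. *)
Inductive two_sided : A -> Prop :=
| TwoSided (a u b : A) : S u -> two_sided (a * u * b).

Local Notation ideal := (span two_sided).

Lemma ideal_mull (a u : A) : u \in ideal -> a * u \in ideal.
Proof.
move/spanP; elim=> [|c v w [b s d Ss] _ IH]; first by rewrite mulr0 rpred0.
rewrite mulrDr -scalerAr !mulrA; apply/spanP; right; last exact/spanP.
exact: TwoSided.
Qed.

Lemma ideal_mulr (a u : A) : u \in ideal -> u * a \in ideal.
Proof.
move/spanP; elim=> [|c v w [b s d Ss] _ IH]; first by rewrite mul0r rpred0.
rewrite mulrDl -scalerAl -!mulrA mulrA; apply/spanP; right; last exact/spanP.
exact: TwoSided.
Qed.

End TwoSided.

Lemma eval_proper (K : comNzRingType) (X : choiceType) (e : X -> K)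
    (S : free_alg K X -> Prop) :
  (forall u, S u -> free_eval e u = 0) -> 1 \notin span (two_sided S).
Proof.
move=> eS; apply/spanP => H.
suff /eqP: free_eval e 1 = 0 by rewrite rmorph1 oner_eq0.
elim: H => [|c u v [a w b Sw] _ IH]; first exact: rmorph0.
by rewrite rmorphD /= free_evalZ !rmorphM /= (eS _ Sw) IH mulr0 mul0r mulr0 addr0.
Qed.

(* The algebras of the library are nonzero, so a presentation comes with a proof
   that the ideal of its relations is proper. *)
Record presentation (K : comNzRingType) (X : choiceType) := Presentation {
  rels : free_alg K X -> Prop;
  rels_proper : 1 \notin span (two_sided rels)
}.

Section PresentedAlgebra.
Variables (K : comNzRingType) (X : choiceType) (P : presentation K X).

Local Notation F := (free_alg K X).
Local Notation ideal := (span (two_sided (@rels _ _ P))).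

Definition pres_alg := lquot (two_sided (@rels _ _ P)).
HB.instance Definition _ := GRing.Lmodule.on pres_alg.

Definition pres_pi : F -> pres_alg := lpi (two_sided (@rels _ _ P)).

Definition pres_mul (x y : pres_alg) : pres_alg := pres_pi (repr x * repr y).

Lemma pres_piK (x : pres_alg) : pres_pi (repr x) = x. Proof. exact: reprK. Qed.

Lemma pres_piM (u v : F) : pres_mul (pres_pi u) (pres_pi v) = pres_pi (u * v).
Proof.
apply/lpi_eq/spanP; set u' := repr _; set v' := repr _.
rewrite [_ - _](_ : _ = u' * (v' - v) + (u' - u) * v); last first.
  by rewrite mulrBr mulrBl addrA subrK.
by apply: rpredD; [apply: ideal_mull | apply: ideal_mulr];
  apply/spanP; exact: repr_lpi.
Qed.

Lemma pres_mulA : associative pres_mul.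
Proof.
by move=> x y z; rewrite -[x]pres_piK -[y]pres_piK -[z]pres_piK !pres_piM mulrA.
Qed.

Lemma pres_mul1l : left_id (pres_pi 1) pres_mul.
Proof. by move=> x; rewrite -[x]pres_piK pres_piM mul1r. Qed.

Lemma pres_mul1r : right_id (pres_pi 1) pres_mul.
Proof. by move=> x; rewrite -[x]pres_piK pres_piM mulr1. Qed.

Lemma pres_piD : {morph pres_pi : u v / u + v}. Proof. exact: lpiD. Qed.

Lemma pres_piZ (c : K) (u : F) : pres_pi (c *: u) = c *: pres_pi u.
Proof. exact: linearZ. Qed.

Lemma pres_mulDl : left_distributive pres_mul +%R.
Proof.
move=> x y z; rewrite -[x]pres_piK -[y]pres_piK -[z]pres_piK.
by rewrite -pres_piD !pres_piM mulrDl pres_piD.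
Qed.

Lemma pres_mulDr : right_distributive pres_mul +%R.
Proof.
move=> x y z; rewrite -[x]pres_piK -[y]pres_piK -[z]pres_piK.
by rewrite -pres_piD !pres_piM mulrDr pres_piD.
Qed.

Lemma pres_one_neq0 : pres_pi 1 != 0.
Proof.
apply: contra (@rels_proper _ _ P) => /eqP pi10; apply/spanP.
by rewrite -[1]subr0; apply/lpi_eq; rewrite -/(pres_pi 1) pi10 raddf0.
Qed.

HB.instance Definition _ := GRing.Zmodule_isNzRing.Build pres_alg
  pres_mulA pres_mul1l pres_mul1r pres_mulDl pres_mulDr pres_one_neq0.

Lemma pres_scaleAl (c : K) (x y : pres_alg) : c *: (x * y) = (c *: x) * y.
Proof.
rewrite -[x]pres_piK -[y]pres_piK -pres_piZ.
by rewrite -![_ * _]/(pres_mul _ _) !pres_piM -pres_piZ scalerAl.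
Qed.

Lemma pres_scaleAr (c : K) (x y : pres_alg) : c *: (x * y) = x * (c *: y).
Proof.
rewrite -[x]pres_piK -[y]pres_piK -pres_piZ.
by rewrite -![_ * _]/(pres_mul _ _) !pres_piM -pres_piZ scalerAr.
Qed.

HB.instance Definition _ :=
  GRing.Lmodule_isLalgebra.Build K pres_alg pres_scaleAl.
HB.instance Definition _ :=
  GRing.Lalgebra_isAlgebra.Build K pres_alg pres_scaleAr.

Definition pres_gen (x : X) : pres_alg := pres_pi (free_gen K x).

End PresentedAlgebra.

Section Subalgebra.
Variables (K : comNzRingType) (A : algType K).

Definition subalg (S : subalgClosed A) := {a : A | a \in S}.

Section Structure.
Variable S : subalgClosed A.
HB.instance Definition _ := SubType.on (subalg S).
HB.instance Definition _ := SubChoice.on (subalg S).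
HB.instance Definition _ := [SubChoice_isSubAlgebra of subalg S by <:].
End Structure.

Section Generated.
Variable S : A -> Prop.

Inductive in_alg_gen : A -> Prop :=
| in_alg_gen_base a : S a -> in_alg_gen a
| in_alg_gen1 : in_alg_gen 1
| in_alg_gen_lin (c : K) a b :
    in_alg_gen a -> in_alg_gen b -> in_alg_gen (c *: a + b)
| in_alg_genM a b : in_alg_gen a -> in_alg_gen b -> in_alg_gen (a * b).

Definition alg_gen : {pred A} := fun a => `[< in_alg_gen a >].

Lemma alg_genP (a : A) : reflect (in_alg_gen a) (a \in alg_gen).
Proof. exact: asboolP. Qed.

Lemma alg_gen_closed : GRing.subsemialg_closed alg_gen.
Proof.
apply: GRing.subalg_closed_semi; split=> [|c a b /alg_genP Sa /alg_genP Sb|].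
- exact/alg_genP/in_alg_gen1.
- exact/alg_genP/in_alg_gen_lin.
- by move=> a b /alg_genP Sa /alg_genP Sb; exact/alg_genP/in_alg_genM.
Qed.

HB.instance Definition _ := GRing.isSubalgClosed.Build K A alg_gen
  alg_gen_closed.

End Generated.

Definition triangular_decomposition (Am A0 Ap : subalgClosed A) : Prop :=
  exists mu : {linear tensor (tensor (subalg Am) (subalg A0)) (subalg Ap) -> A},
    (forall a h b, mu (tens (tens a h) b) = val a * val h * val b)
    /\ bijective mu.

End Subalgebra.

Section QuantumNumbers.
Variable F : fieldType.

Definition qint (z : F) (m : int) : F := (z ^ m - z ^ (- m)) / (z - z^-1).

Definition qfact (z : F) (m : nat) : F := \prod_(1 <= l < m.+1) qint z l%:Z.

Definition qbin (z : F) (s k : nat) : F :=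
  qfact z s / (qfact z k * qfact z (s - k)).

End QuantumNumbers.

Section ComplexExponential.
Variable R : realType.

Definition cexp (z : R[i]) : R[i] :=
  let: Complex a b := z in Complex (expR a * cos b) (expR a * sin b).

End ComplexExponential.

(* qlog is the fixed logarithm of q. *)
Record quantum_datum (R : realType) := QuantumDatum {
  rk : nat;
  cartan : 'M[int]_rk;
  cartan_diag : forall i, cartan i i = 2;
  cartan_offdiag : forall i j, i != j -> cartan i j <= 0;
  cartan_eq0 : forall i j, (cartan i j = 0) <-> (cartan j i = 0);
  symmetrizer : 'I_rk -> nat;
  symmetrizer_gt0 : forall i, (0 < symmetrizer i)%N;
  symm_cartan : forall i j,
    (symmetrizer i)%:Z * cartan i j = (symmetrizer j)%:Z * cartan j i;
  hh : vectType rat;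
  dim_hh : (\dim {:hh} + \rank (map_mx intr cartan : 'M[rat]_rk) = rk.*2)%N;
  simple_root : 'I_rk -> 'Hom(hh, rat^o);
  simple_root_free : free [tuple simple_root i | i < rk];
  simple_coroot : 'I_rk -> hh;
  simple_coroot_free : free [tuple simple_coroot i | i < rk];
  simple_root_coroot : forall i j,
    simple_root j (simple_coroot i) = (cartan i j)%:~R;
  qpar : R[i];
  qlog : R[i];
  qlogK : cexp qlog = qpar;
  qpar_not_root : forall m : nat, (0 < m)%N -> qpar ^+ m != 1
}.

Arguments cartan {R} D : rename.
Arguments symmetrizer {R} D _ : rename.
Arguments simple_root {R} D _ : rename.
Arguments simple_coroot {R} D _ : rename.

Section QuantumAffinization.
Variables (R : realType) (D : quantum_datum R).

Local Notation n := (rk D).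
Local Notation C := (cartan D).
Local Notation r := (symmetrizer D).
Local Notation q := (qpar D).

Definition symB (i j : 'I_n) : int := (r i)%:Z * C i j.

Definition q_ (i : 'I_n) : R[i] := q ^+ r i.

Definition qpow (a : rat) : R[i] := cexp (ratr a * qlog D).

(* The signs + and - are encoded by true and false. *)
Definition pm (s : bool) : int := if s then 1 else -1.

(* The relations, each written as an element of an algebra A that is required to
   vanish. Below, k c stands for k_c, x s i m for x_{i,m}^s and h i m for h_{i,m}
   if m != 0, while h i 0 is meant to be 0. *)
Section Relations.
Variable A : algType R[i].

Definition comm (a b : A) : A := a * b - b * a.

Section Cartan.
Variables (k : hh D -> A) (h : 'I_n -> int -> A).

Inductive cartan_rel : A -> Prop :=
| cartan_kk c c' : cartan_rel (k c * k c' - k (c + c'))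
| cartan_k0 : cartan_rel (k 0 - 1)
| cartan_kh c j m : m != 0 -> cartan_rel (comm (k c) (h j m))
| cartan_hh i j m m' : m != 0 -> m' != 0 ->
    cartan_rel (comm (h i m) (h j m')).

(* The coefficient of z^{m} (sign +) or z^{-m} (sign -) in
   exp(+-(q - q^-1) \sum_(l >= 1) h_{i,+-l} z^{+-l}). The terms with l > m of the
   inner series and its powers with exponent p > m do not contribute, since its
   constant term is 0. *)
Definition exp_coef (s : bool) (i : 'I_n) (m : nat) : A :=
  \sum_(p < m.+1) (p`!%:R^-1 : R[i]) *:
    ((\poly_(l < m.+1)
        (((pm s)%:~R * (q - q^-1)) *: h i (pm s * l%:Z))) ^+ p)`_m.

Definition phi (s : bool) (i : 'I_n) (m : int) : A :=
  if 0 <= pm s * m then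
    k ((simple_coroot D i *+ r i) *~ pm s) * exp_coef s i `|m|%N
  else 0.

Section Mixed.
Variable x : bool -> 'I_n -> int -> A.

Inductive weight_rel : A -> Prop :=
| WeightRel s c j m : weight_rel
    (k c * x s j m * k (- c) - qpow ((pm s)%:~R * simple_root D j c) *: x s j m).

Inductive hx_rel : A -> Prop :=
| HxRel s i j m m' : m != 0 -> hx_rel
    (comm (h i m) (x s j m')
     - ((pm s)%:~R * (m%:~R^-1 * qint q (m * symB i j))) *: x s j (m + m')).

Inductive xx_rel : A -> Prop :=
| XxRel i j m m' : xx_rel
    (comm (x true i m) (x false j m')
     - ((i == j)%:R / (q_ i - (q_ i)^-1)) *:
         (phi true i (m + m') - phi false i (m + m'))).

End Mixed.
End Cartan.

Section Loop.
Variables (s : bool) (x : 'I_n -> int -> A).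

Inductive exchange_rel : A -> Prop :=
| ExchangeRel i j m m' : exchange_rel
    ((x i (m + 1) * x j m'
      - q ^ (pm s * symB i j) *: (x j m' * x i (m + 1)))
     - (q ^ (pm s * symB i j) *: (x i m * x j (m' + 1))
        - x j (m' + 1) * x i m)).

Definition serre_deg (i j : 'I_n) : nat := `|1 - C i j|%N.

(* The ordinals t < l (resp. t >= l) are the indices 1, ..., l (resp. l+1, ..., s)
   shifted by one; \prod multiplies in increasing order. *)
Inductive serre_rel : A -> Prop :=
| SerreRel i j (m : 'I_(serre_deg i j) -> int) m' : i != j -> serre_rel
    (\sum_(w : 'S_(serre_deg i j)) \sum_(l < (serre_deg i j).+1)
       ((-1) ^+ l * qbin (q_ i) (serre_deg i j) l) *:
       ((\prod_(t < serre_deg i j | (t < l)%N) x i (m (w t))) * x j m' *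
        (\prod_(t < serre_deg i j | (l <= t)%N) x i (m (w t))))).

Definition loop_rel (a : A) : Prop := exchange_rel a \/ serre_rel a.

End Loop.

Definition aff_rel (k : hh D -> A) (h : 'I_n -> int -> A)
    (x : bool -> 'I_n -> int -> A) (a : A) : Prop :=
  cartan_rel k h a \/ weight_rel k x a \/ hx_rel h x a \/ xx_rel k h x a
  \/ exists s, loop_rel s (x s) a.

End Relations.

Definition cartan_gen : choiceType :=
  (hh D + 'I_n * {m : int | m != 0})%type.
Definition loop_gen : choiceType := ('I_n * int)%type.
Definition aff_gen : choiceType := (cartan_gen + bool * loop_gen)%type.

Definition cartan_k (A : Type) (g : cartan_gen -> A) (c : hh D) : A := g (inl c).

Definition cartan_h (A : zmodType) (g : cartan_gen -> A) (i : 'I_n) (m : int) :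
  A := if insub m is Some u then g (inr (i, u)) else 0.

Definition cartan_rels : free_alg R[i] cartan_gen -> Prop :=
  let g := @free_gen R[i] cartan_gen in cartan_rel (cartan_k g) (cartan_h g).

Definition loop_rels (s : bool) : free_alg R[i] loop_gen -> Prop :=
  loop_rel s (fun i m => free_gen R[i] ((i, m) : loop_gen)).

Definition aff_rels : free_alg R[i] aff_gen -> Prop :=
  let g (a : cartan_gen) := free_gen R[i] (inl a : aff_gen) in
  aff_rel (cartan_k g) (cartan_h g)
    (fun s i m => free_gen R[i] (inr (s, (i, m)) : aff_gen)).

(* The relations are killed by the character k_c |-> 1, h_{i,m} |-> 0,
   x_{i,m} |-> 0, hence generate proper ideals. *)

Section Proper.
Variables (A : algType R[i]) (e : {rmorphism A -> R[i]}).
Variables (k : hh D -> A) (h : 'I_n -> int -> A) (x : bool -> 'I_n -> int -> A).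
Hypothesis eZ : forall c u, e (c *: u) = c * e u.
Hypothesis ek : forall c, e (k c) = 1.
Hypothesis eh : forall i m, e (h i m) = 0.
Hypothesis ex : forall s i m, e (x s i m) = 0.

Lemma eval_comm (u v : A) : e (comm u v) = 0.
Proof. by rewrite rmorphB !rmorphM mulrC subrr. Qed.

Lemma eval_cartan u : cartan_rel k h u -> e u = 0.
Proof.
case=> [c c'||c j m _|i j m m' _ _]; rewrite ?eval_comm //.
  by rewrite rmorphB rmorphM !ek mulr1 subrr.
by rewrite rmorphB ek rmorph1 subrr.
Qed.

Lemma eval_exp_coef s i m : e (exp_coef h s i m) = (m == 0)%:R.
Proof.
have map0 (p : {poly A}) : (forall l, e p`_l = 0) -> map_poly e p = 0.
  by move=> p0; apply/polyP => l; rewrite coef0 coef_map /= p0.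
rewrite /exp_coef rmorph_sum big_ord_recl big1 => [|p _].
  by rewrite addr0 eZ expr0 coef1 fact0 invr1 mul1r rmorph_nat.
rewrite eZ -coef_map rmorphXn /= map0 ?expr0n ?coef0 ?mulr0 // => l.
by rewrite coef_poly; case: ifP => _; rewrite ?rmorph0 // eZ eh mulr0.
Qed.

Lemma eval_phi s i m : e (phi k h s i m) = (m == 0)%:R.
Proof.
rewrite /phi; case: ifP => [_|].
  by rewrite rmorphM ek mul1r eval_exp_coef absz_eq0.
by rewrite rmorph0; case: eqP => // ->; rewrite mulr0.
Qed.

Lemma eval_loop s u : loop_rel s (x s) u -> e u = 0.
Proof.
case=> -[].
  move=> i j m m'; rewrite !rmorphB !eZ !rmorphM !ex.
  by rewrite !(mulr0, subr0).
move=> i j m m' _; rewrite rmorph_sum big1 // => w _; rewrite rmorph_sum big1 //.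
by move=> l _; rewrite eZ !rmorphM ex mulr0 mul0r mulr0.
Qed.

Lemma eval_aff u : aff_rel k h x u -> e u = 0.
Proof.
case=> [|[[s c j m]|[[s i j m m' _]|[[i j m m']|[s]]]]].
- exact: eval_cartan.
- by rewrite rmorphB eZ !rmorphM ex mulr0 mul0r mulr0 subr0.
- by rewrite rmorphB eval_comm eZ ex mulr0 subr0.
- by rewrite rmorphB eval_comm eZ rmorphB !eval_phi subrr mulr0 subr0.
- exact: eval_loop.
Qed.

End Proper.

Definition cartan_counit (a : cartan_gen) : R[i] :=
  if a is inl _ then 1 else 0.
Definition aff_counit (a : aff_gen) : R[i] :=
  if a is inl b then cartan_counit b else 0.

Lemma cartan_proper : 1 \notin span (two_sided cartan_rels).
Proof.
apply: (@eval_proper _ _ cartan_counit) => u.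
by apply: eval_cartan => c; exact: free_eval_gen.
Qed.

Lemma loop_proper s : 1 \notin span (two_sided (loop_rels s)).
Proof.
apply: (@eval_proper _ _ (fun=> 0)) => u.
apply: (@eval_loop _ _ (fun _ i m => free_gen R[i] ((i, m) : loop_gen))) => *.
  exact: free_evalZ.
exact: free_eval_gen.
Qed.

Lemma aff_proper : 1 \notin span (two_sided aff_rels).
Proof.
apply: (@eval_proper _ _ aff_counit) => u.
apply: eval_aff => [c v|c|i m|s i m].
- exact: free_evalZ.
- exact: free_eval_gen.
- rewrite /cartan_h; case: insubP => [v _ _|_]; last exact: rmorph0.
  exact: free_eval_gen.
- exact: free_eval_gen.
Qed.

Definition cartan_alg := pres_alg (Presentation cartan_proper).
Definition loop_alg (s : bool) := pres_alg (Presentation (loop_proper s)).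
Definition Uq := pres_alg (Presentation aff_proper).

HB.instance Definition _ := GRing.Algebra.on cartan_alg.
HB.instance Definition _ s := GRing.Algebra.on (loop_alg s).
HB.instance Definition _ := GRing.Algebra.on Uq.

Definition cartan_alg_k : hh D -> cartan_alg :=
  cartan_k (fun a => pres_gen (Presentation cartan_proper) a).
Definition cartan_alg_h : 'I_n -> int -> cartan_alg :=
  cartan_h (fun a => pres_gen (Presentation cartan_proper) a).
Definition loop_alg_x (s : bool) (i : 'I_n) (m : int) : loop_alg s :=
  pres_gen (Presentation (loop_proper s)) (i, m).
Definition Uq_k : hh D -> Uq :=
  cartan_k (fun a => pres_gen (Presentation aff_proper) (inl a)).
Definition Uq_h : 'I_n -> int -> Uq :=
  cartan_h (fun a => pres_gen (Presentation aff_proper) (inl a)).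
Definition Uq_x (s : bool) (i : 'I_n) (m : int) : Uq :=
  pres_gen (Presentation aff_proper) (inr (s, (i, m))).

Definition Uq_cartan : {pred Uq} := alg_gen (fun u : Uq =>
  (exists c, u = Uq_k c) \/ (exists i m, m != 0 /\ u = Uq_h i m)).
Definition Uq_loop (s : bool) : {pred Uq} := alg_gen (fun u : Uq =>
  exists i m, u = Uq_x s i m).

HB.instance Definition _ := GRing.SubalgClosed.on Uq_cartan.
HB.instance Definition _ s := GRing.SubalgClosed.on (Uq_loop s).

End QuantumAffinization.

Arguments cartan_alg {R} D.
Arguments loop_alg {R} D s.
Arguments Uq {R} D.
Arguments Uq_cartan {R} D.
Arguments Uq_loop {R} D s.
Arguments cartan_alg_k {R} D c.
Arguments cartan_alg_h {R} D i m.
Arguments loop_alg_x {R} D s i m.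
Arguments Uq_k {R} D c.
Arguments Uq_h {R} D i m.
Arguments Uq_x {R} D s i m.

(* Main.v *)
(* Let H be the algebra presented by (R1) and A+, A- those presented by (R5), (R6).
   The decomposition is obtained in two steps, first for the Borel algebra B = H A+
   and then for U = A- B. In each step the mixed relations let the generators b of
   the right factor be moved past those of the left one, so U is spanned by the
   products y z. Independence amounts to extending every bilinear map beta on the
   two factors to a linear map f on U with f (y z) = beta y z. Such an f is built
   coinductively: on the space of functions from words in the right generators to
   linear maps, the right generators act by shifting the word and the left ones by
   the recursion that straightening dictates. The relations hold for this action as
   soon as straightening preserves both sets of relators.

   The only deep point is that the Serre relators are compatible with x^-_j. After
   polarization, their commutator with x^-_j is the Serre sum of a current in which
   one factor is replaced by a coefficient phi_m of the series phi. The exchange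
   relation between phi and x, a consequence of (R1)-(R3), makes these sums vanish:
   letting x act on power series twists it by a central nilpotent shift, which
   reduces the claim to q-binomial identities in a quantum plane. *)
Require Import Defs.
From HB Require Import structures.
From mathcomp Require Import all_boot all_order perm all_algebra.
From mathcomp Require Import boolp functions reals exp trigo complex.
From mathcomp Require Import finmap monalg.
From mathcomp Require Import ring zify.

Set Implicit Arguments.
Unset Strict Implicit.
Unset Printing Implicit Defensive.

Import Order.TTheory GRing.Theory Num.Theory.

Local Open Scope ring_scope.

(** * Linear maps and free algebras *)

(** The obstacle is a circularity: moving a generator past a relator of the other factor often
    leaves a residue that vanishes only modulo relations of other kinds. For a Serre relator against
    x^-, these are (R1)-(R3) and (R5). The order of the two steps removes it. The residue of an x^+
    relator against x^- lies in B, where all relations of B are available; the x^- relators are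
    treated when B already acts with its relations, and (R5) before (R6).

    The twist comes from the exchange relation itself. Let P be a generating series in Y of
    coefficients of phi, and S the shift x_r -> x_(r+1). The relation reads ((1 - a^-1 Y S) x) P =
    a^-1 P ((1 - a Y S) x), so conjugation by P acts on currents by a rational function of Y S.
    Passing to (1 - a^-1 Y S) x clears the denominator: P then moves to the left at the price of a
    scalar and a changed parameter. With a = q^2 for x_i against x_i and a = q^-N for x_i against
    x_j, N = -C_ij, this gives the parameters q^-2 and q^N of the twisted currents. The quantum
    plane is spanned by x_0 and Y x_1, where (R5) becomes a q^2-commutation. *)

Section LinearMaps.
Variables (K : comNzRingType) (U V : lmodType K).

Lemma linear_fun0 (f : U -> V) : linear f -> f 0 = 0.
Proof. by move/(_ (-1) 0 0); rewrite scaler0 addr0 scaleN1r addNr. Qed.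

Definition lin_pred : {pred U -> V} := fun f => `[< linear f >].

Lemma lin_predP (f : U -> V) : reflect (linear f) (f \in lin_pred).
Proof. exact: asboolP. Qed.

Lemma lin_pred_closed : subsemimod_closed lin_pred.
Proof.
apply: GRing.submod_closed_semi; split.
  by apply/lin_predP => c u v; rewrite /GRing.zero /= scaler0 addr0.
move=> a f g /lin_predP fL /lin_predP gL; apply/lin_predP => c u v.
change (a *: f (c *: u + v) + g (c *: u + v) =
  c *: (a *: f u + g u) + (a *: f v + g v)).
by rewrite fL gL !scalerDr !scalerA [a * c]mulrC addrACA.
Qed.

HB.instance Definition _ :=
  GRing.isSubmodClosed.Build K (U -> V) lin_pred lin_pred_closed.

(** A subtype of the function space, so that the module structure comes from closure alone. *)
Definition linmap := {f : U -> V | f \in lin_pred}.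

HB.instance Definition _ := SubType.on linmap.
HB.instance Definition _ := SubChoice.on linmap.
HB.instance Definition _ := [SubChoice_isSubLmodule of linmap by <:].

Definition lapp (f : linmap) : U -> V := val f.

Lemma lapp_linear (f : linmap) : linear (lapp f).
Proof. exact/lin_predP/valP. Qed.

HB.instance Definition _ (f : linmap) :=
  GRing.isLinear.Build K U V *:%R (lapp f) (lapp_linear f).

Definition mk_linmap (f : U -> V) (fL : linear f) : linmap :=
  Sub f (introT (lin_predP f) fL).

Lemma mk_linmapE (f : U -> V) (fL : linear f) u : lapp (mk_linmap fL) u = f u.
Proof. by rewrite /lapp SubK. Qed.

Lemma linmapP (f g : linmap) : lapp f =1 lapp g -> f = g.
Proof. by move=> fg; apply: val_inj; apply/funext. Qed.

Lemma lappD (f g : linmap) u : lapp (f + g) u = lapp f u + lapp g u.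
Proof. by []. Qed.

Lemma lappZ (c : K) (f : linmap) u : lapp (c *: f) u = c *: lapp f u.
Proof. by []. Qed.

Lemma lapp0 u : lapp 0 u = 0.
Proof. by []. Qed.

Lemma lappP (f : linmap) (c : K) u v : lapp f (c *: u + v) = c *: lapp f u + lapp f v.
Proof. exact: linearP. Qed.

Lemma lappr0 (f : linmap) : lapp f 0 = 0.
Proof. exact: linear0. Qed.

End LinearMaps.

Section Endomorphisms.
(* The nonzero vector is required because library algebras are nonzero. *)
Variables (K : comNzRingType) (V : lmodType K) (v0 : V) (nz : v0 != 0).

Definition endo of v0 != 0 : Type := linmap V V.

Local Notation E := (endo nz).

HB.instance Definition _ := GRing.Lmodule.copy E (linmap V V).

Definition eapp (f : E) : V -> V := @lapp K V V f.

HB.instance Definition _ (f : E) := GRing.Linear.copy (eapp f) (@lapp K V V f).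

Definition mk_endo (f : V -> V) (fL : linear f) : E := mk_linmap fL.

Lemma mk_endoE (f : V -> V) (fL : linear f) v : eapp (mk_endo fL) v = f v.
Proof. exact: mk_linmapE. Qed.

Lemma endoP (f g : E) : eapp f =1 eapp g -> f = g.
Proof. exact: linmapP. Qed.

Lemma comp_endo_linear (f g : E) : linear (eapp f \o eapp g).
Proof. by move=> c u v; rewrite /= !linearP. Qed.

Lemma id_endo_linear : linear (@id V).
Proof. by []. Qed.

Definition endo_mul (f g : E) : E := mk_endo (comp_endo_linear f g).
Definition endo_one : E := mk_endo id_endo_linear.

Lemma endo_mulE f g v : eapp (endo_mul f g) v = eapp f (eapp g v).
Proof. exact: mk_endoE. Qed.

Lemma endo_mulA : associative endo_mul.
Proof. by move=> f g h; apply: endoP => v; rewrite !endo_mulE. Qed.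

Lemma endo_mul1l : left_id endo_one endo_mul.
Proof. by move=> f; apply: endoP => v; rewrite endo_mulE mk_endoE. Qed.

Lemma endo_mul1r : right_id endo_one endo_mul.
Proof. by move=> f; apply: endoP => v; rewrite endo_mulE mk_endoE. Qed.

Lemma endo_mulDl : left_distributive endo_mul +%R.
Proof. by move=> f g h; apply: endoP => v; rewrite endo_mulE /eapp !lappD -!/(eapp _ _) !endo_mulE. Qed.

Lemma endo_mulDr : right_distributive endo_mul +%R.
Proof.
move=> f g h; apply: endoP => v.
by rewrite endo_mulE /eapp !lappD -!/(eapp _ _) !endo_mulE raddfD.
Qed.

Lemma endo_one_neq0 : endo_one != 0.
Proof.
apply: contra nz => /eqP /(congr1 (fun f : E => eapp f v0)).
by rewrite mk_endoE => ->; rewrite /eapp lapp0.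
Qed.

HB.instance Definition _ := GRing.Zmodule_isNzRing.Build E
  endo_mulA endo_mul1l endo_mul1r endo_mulDl endo_mulDr endo_one_neq0.

Lemma endo_scaleAl (c : K) (f g : E) : c *: (f * g) = (c *: f) * g.
Proof.
by apply: endoP => v; rewrite endo_mulE /eapp !lappZ -!/(eapp _ _) endo_mulE.
Qed.

Lemma endo_scaleAr (c : K) (f g : E) : c *: (f * g) = f * (c *: g).
Proof.
apply: endoP => v.
by rewrite endo_mulE /eapp !lappZ -!/(eapp _ _) endo_mulE linearZ.
Qed.

HB.instance Definition _ := GRing.Lmodule_isLalgebra.Build K E endo_scaleAl.
HB.instance Definition _ := GRing.Lalgebra_isAlgebra.Build K E endo_scaleAr.

Lemma eappM (f g : E) v : eapp (f * g) v = eapp f (eapp g v).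
Proof. exact: endo_mulE. Qed.

Lemma eapp1 v : eapp 1 v = v.
Proof. exact: mk_endoE. Qed.

Lemma eappD (f g : E) v : eapp (f + g) v = eapp f v + eapp g v.
Proof. by []. Qed.

Lemma eappZ (c : K) (f : E) v : eapp (c *: f) v = c *: eapp f v.
Proof. by []. Qed.

Lemma eapp0 v : eapp 0 v = 0.
Proof. by []. Qed.

Lemma eappP (f : E) (c : K) u v : eapp f (c *: u + v) = c *: eapp f u + eapp f v.
Proof. exact: linearP. Qed.

Lemma eappr0 (f : E) : eapp f 0 = 0.
Proof. exact: linear0. Qed.

End Endomorphisms.

Lemma malgUZ (K : comNzRingType) (M : choiceType) (c : K) (w : M) :
  << c *g w >> = c *: << w >> :> {malg K[M]}.
Proof. by apply/malgP => v; rewrite mcoeffZ !mcoeffU mulr_natr. Qed.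

Section LinearExtension.
Variables (K : comNzRingType) (X : choiceType) (W : lmodType K) (g : X -> W).

Definition malg_ext (u : {malg K[X]}) : W := \sum_(x <- msupp u) u@_x *: g x.

Lemma malg_extEw (d : {fset X}) u :
  fsubset (msupp u) d -> malg_ext u = \sum_(x <- d) u@_x *: g x.
Proof.
move=> ud; rewrite /malg_ext -[RHS]/(\sum_(x <- enum_fset d) _).
rewrite (big_fset_incl _ ud) // => x _ /mcoeff_outdom ->.
by rewrite scale0r.
Qed.

Lemma malg_ext_linear : linear malg_ext.
Proof.
move=> c u v; pose d := fsetU (msupp u) (fsetU (msupp v) (msupp (c *: u + v))).
rewrite (@malg_extEw d u) ?(@malg_extEw d v) ?(@malg_extEw d (c *: u + v)) /d;
  try by rewrite ?fsubsetUl // !fsubsetU ?fsubset_refl ?orbT.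
rewrite scaler_sumr -big_split; apply: eq_bigr => x _.
by rewrite mcoeffD mcoeffZ scalerDl scalerA.
Qed.

Lemma malg_extU x : malg_ext << x >> = g x.
Proof.
rewrite (@malg_extEw [fset x]%fset); last exact: msuppU_le.
by rewrite big_seq_fset1 mcoeffUU scale1r.
Qed.

End LinearExtension.

Lemma malgMU (K : comNzRingType) (M : monomType) (c : K) (v w : M) :
  << v >> * << c *g w >> = c *: << mmul v w >> :> {malg K[M]}.
Proof. by rewrite malgM_def fgmulUU mul1r malgUZ. Qed.

Lemma mulr_linr (K : comNzRingType) (A : algType K) (c : K) (u v w : A) :
  w * (c *: u + v) = c *: (w * u) + w * v.
Proof. by rewrite mulrDr scalerAr. Qed.

(* Proved for abstract algebras: on the concrete monoid algebras, unification
   of the ring operations is very slow. *)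
Section AbstractFree.
Variables (K : comNzRingType) (X : Type) (F A : algType K) (gen : X -> F).
Hypothesis gen_ind : forall Q : F -> Prop, Q 0 -> Q 1 ->
  (forall (c : K) u v, Q u -> Q v -> Q (c *: u + v)) ->
  (forall x u, Q u -> Q (gen x * u)) -> forall u, Q u.

Lemma abstract_free_mul (f : F -> A) (e : X -> A) : linear f -> f 1 = 1 ->
  (forall x u, f (gen x * u) = e x * f u) -> forall u v, f (u * v) = f u * f v.
Proof.
move=> fL f1 fM u v; elim/gen_ind: u => [||c u u' IHu IHu'|x u IH].
- by rewrite mul0r linear_fun0 // mul0r.
- by rewrite f1 !mul1r.
- by rewrite mulrDl -scalerAl !fL IHu IHu' mulrDl scalerAl.
- by rewrite -mulrA !fM IH mulrA.
Qed.

Lemma abstract_free_unique (f g : {lrmorphism F -> A}) :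
  (forall x, f (gen x) = g (gen x)) -> f =1 g.
Proof.
move=> fg; elim/gen_ind => [||c u v IHu IHv|x u IH].
- by rewrite !linear0.
- by rewrite !rmorph1.
- by rewrite !linearP /= IHu IHv.
- by rewrite !rmorphM /= fg IH.
Qed.

End AbstractFree.

(* Elaborating the ring operations through this bundled structure keeps
   unification from unfolding the monoid algebra. *)
Definition falg (K : comNzRingType) (X : choiceType) : algType K := free_alg K X.

Definition fgen (K : comNzRingType) (X : choiceType) (x : X) : falg K X :=
  free_gen K x.

Section FreeAlgebraTheory.
Variables (K : comNzRingType) (X : choiceType).

Local Notation F := (falg K X).

(** Every element is a combination of words, and a word is built by adding letters on the left. *)
Lemma free_alg_ind (P : F -> Prop) :
  P 0 -> P 1 -> (forall (c : K) u v, P u -> P v -> P (c *: u + v)) ->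
  (forall x u, P u -> P (fgen K x * u)) -> forall u, P u.
Proof.
move=> P0 P1 PD PM u; rewrite [u](monalgE (u : {malg K[{fmonom X}]})).
elim/big_ind: _ => // [v w Pv Pw|w _]; first by rewrite -[v]scale1r; apply: PD.
rewrite malgUZ.
suff Pw : P << w >> by rewrite -[_ *: _]addr0; apply: PD.
case: w => s; elim: s => [|x s IH].
  by have -> : FMonom [::] = mone :> {fmonom X} by rewrite -fmoneE.
have -> : << FMonom (x :: s) >> = fgen K x * << FMonom s >> :> F.
  rewrite /fgen /free_gen malgM_def fgmulUU mulr1; congr << _ >>.
  by apply/eqP; rewrite fmP fmM fmU.
exact: PM.
Qed.

Section Lift.
Variables (A : algType K) (e : X -> A).

Definition word_lift (w : {fmonom X}) : A := \prod_(x <- fmonom_val w) e x.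

Definition free_lift (u : F) : A := malg_ext word_lift u.

Lemma free_lift_linear : linear free_lift.
Proof. exact: malg_ext_linear. Qed.

HB.instance Definition _ := GRing.isLinear.Build K F A *:%R free_lift free_lift_linear.

Lemma free_liftU (w : {fmonom X}) : free_lift << w >> = word_lift w.
Proof. exact: malg_extU. Qed.

Lemma free_liftP (c : K) (u v : F) :
  free_lift (c *: u + v) = c *: free_lift u + free_lift v.
Proof. exact: linearP. Qed.

Lemma free_lift0 : free_lift 0 = 0.
Proof. exact: linear0. Qed.

Lemma free_lift1 : free_lift 1 = 1.
Proof. by rewrite -[1]/(<< mone >> : F) free_liftU /word_lift fm1 big_nil. Qed.

Lemma free_lift_gen x : free_lift (fgen K x) = e x.
Proof. by rewrite free_liftU /word_lift fmU big_seq1. Qed.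

Lemma free_lift_genM x (u : F) : free_lift (fgen K x * u) = e x * free_lift u.
Proof.
rewrite [u in LHS](monalgE (u : {malg K[{fmonom X}]})) mulr_sumr linear_sum.
rewrite /= [in RHS]/free_lift /malg_ext mulr_sumr; apply: eq_bigr => w _.
rewrite malgMU.
rewrite linearZ /= free_liftU -scalerAr; congr (_ *: _).
by rewrite /word_lift fmM fmU big_cons.
Qed.

Lemma free_liftM (u v : F) : free_lift (u * v) = free_lift u * free_lift v.
Proof.
exact: (abstract_free_mul free_alg_ind free_lift_linear free_lift1
  free_lift_genM).
Qed.

Lemma free_lift_monoid : monoid_morphism free_lift.
Proof. by split; [exact: free_lift1 | exact: free_liftM]. Qed.

HB.instance Definition _ :=
  GRing.isMonoidMorphism.Build F A free_lift free_lift_monoid.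

End Lift.

Lemma free_lift_unique (A : algType K) (f g : {lrmorphism F -> A}) :
  (forall x, f (fgen K x) = g (fgen K x)) -> f =1 g.
Proof.
exact: (abstract_free_unique free_alg_ind).
Qed.

Lemma free_lift_comp (A B : algType K) (f : {lrmorphism A -> B}) (e : X -> A) (u : F) :
  f (free_lift e u) = free_lift (f \o e) u.
Proof.
rewrite -[LHS]/((f \o free_lift e) u).
by apply: free_lift_unique => x /=; rewrite !free_lift_gen.
Qed.

Lemma eq_free_lift (A : algType K) (e e' : X -> A) : e =1 e' -> free_lift e =1 free_lift e'.
Proof.
by move=> ee'; apply: free_lift_unique => x; rewrite [LHS]free_lift_gen [RHS]free_lift_gen.
Qed.

End FreeAlgebraTheory.

Section InSpan.
Variables (K : comNzRingType) (V : lmodType K) (S : V -> Prop).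

Lemma in_span_gen u : S u -> in_span S u.
Proof. by move=> Su; rewrite -[u]addr0 -[u]scale1r; apply/in_spanP/in_span0. Qed.

Lemma in_span_lin (c : K) u v : in_span S u -> in_span S v -> in_span S (c *: u + v).
Proof. by move=> /spanP Su /spanP Sv; apply/spanP; rewrite rpredD // rpredZ. Qed.

End InSpan.

Section PresentedAlgebraTheory.
Variables (K : comNzRingType) (X : choiceType) (P : presentation K X).

Local Notation F := (falg K X).
Local Notation pi := (pres_pi P).

Lemma pres_pi_linear : linear pi. Proof. exact: lpi_is_linear. Qed.

HB.instance Definition _ :=
  GRing.isLinear.Build K F (pres_alg P) *:%R pi pres_pi_linear.

Lemma pres_pi_monoid : monoid_morphism pi.
Proof. by split=> [//|u v]; exact/esym/pres_piM. Qed.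

HB.instance Definition _ :=
  GRing.isMonoidMorphism.Build F (pres_alg P) pi pres_pi_monoid.

Lemma pres_pi_mul u v : pi (u * v) = pi u * pi v.
Proof. exact: rmorphM. Qed.

Lemma pres_pi_lin (c : K) u v : pi (c *: u + v) = c *: pi u + pi v.
Proof. exact: linearP. Qed.

Lemma pres_pi0 : pi 0 = 0.
Proof. exact: raddf0. Qed.

Lemma pres_pi_eq0 (u : F) : pi u = 0 <-> in_span (two_sided (@rels _ _ P)) u.
Proof. by rewrite -[pi u = 0]/(pi u = _) -(raddf0 pi) /pres_pi lpi_eq subr0. Qed.

Lemma pres_pi_rels (u : F) : rels P u -> pi u = 0.
Proof.
move=> Pu; apply/pres_pi_eq0/in_span_gen.
by rewrite -[u]mulr1 -[u]mul1r; apply: TwoSided.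
Qed.

Lemma pres_piE (u : F) : pi u = free_lift (pres_gen P) u.
Proof. by apply: free_lift_unique => x; rewrite [RHS]free_lift_gen. Qed.

Lemma pres_ind (Q : pres_alg P -> Prop) :
  Q 0 -> Q 1 -> (forall (c : K) u v, Q u -> Q v -> Q (c *: u + v)) ->
  (forall x u, Q u -> Q (pres_gen P x * u)) -> forall u, Q u.
Proof.
move=> Q0 Q1 QD QM u; rewrite -[u]pres_piK.
elim/free_alg_ind: (repr _ : F) => [||c v w Qv Qw|x v Qv].
- by rewrite pres_pi0.
- exact: Q1.
- by rewrite pres_pi_lin; apply: QD.
- by rewrite pres_pi_mul; apply: QM.
Qed.

Section Lift.
Variables (A : algType K) (e : X -> A).
Hypothesis eP : forall u, rels P u -> free_lift e u = 0.

Lemma free_lift_ideal (u : F) : pi u = 0 -> free_lift e u = 0.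
Proof.
move/pres_pi_eq0; elim=> [|c v w [a s b Ps] _ IH]; first exact: raddf0.
by rewrite free_liftP IH !free_liftM (eP Ps) mulr0 mul0r scaler0 addr0.
Qed.

(** The proof is an argument of the function so that the linear and multiplicative structures
    declared below, which depend on it, can be inferred from the term. *)
Definition pres_lift_of (_ : forall u, rels P u -> free_lift e u = 0)
  (x : pres_alg P) : A := free_lift e (repr x).

Local Notation pl := (pres_lift_of eP).

Lemma pres_lift_of_pi u : pl (pi u) = free_lift e u.
Proof.
apply/eqP; rewrite -subr_eq0 -raddfB; apply/eqP/free_lift_ideal.
by rewrite raddfB /= pres_piK subrr.
Qed.

Lemma pres_lift_linear : linear pl.
Proof.
move=> c u v; rewrite -[u]pres_piK -[v]pres_piK -linearP !pres_lift_of_pi.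
exact: linearP.
Qed.

HB.instance Definition _ :=
  GRing.isLinear.Build K (pres_alg P) A *:%R pl pres_lift_linear.

Lemma pres_lift_monoid : monoid_morphism pl.
Proof.
split=> [|u v]; first by rewrite -(rmorph1 pi) pres_lift_of_pi rmorph1.
by rewrite -[u]pres_piK -[v]pres_piK -rmorphM !pres_lift_of_pi rmorphM.
Qed.

HB.instance Definition _ :=
  GRing.isMonoidMorphism.Build (pres_alg P) A pl pres_lift_monoid.

End Lift.

Definition pres_lift (A : algType K) (e : X -> A)
    (eP : forall u, rels P u -> free_lift e u = 0) :
    {lrmorphism pres_alg P -> A} := pres_lift_of eP.

Lemma pres_lift_pi (A : algType K) (e : X -> A)
    (eP : forall u, rels P u -> free_lift e u = 0) u :
  pres_lift eP (pi u) = free_lift e u.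
Proof. exact: pres_lift_of_pi. Qed.

Lemma pres_lift_gen (A : algType K) (e : X -> A)
    (eP : forall u, rels P u -> free_lift e u = 0) x :
  pres_lift eP (pres_gen P x) = e x.
Proof. by rewrite pres_lift_pi free_lift_gen. Qed.

End PresentedAlgebraTheory.

(** * Straightening and coinduction *)

Section Spanning.
Variables (K : comNzRingType) (Xa Xb X : Type) (U B : algType K).
Variables (gen : X -> U) (ga : Xa -> U) (gb : Xb -> B).
Variable j : {lrmorphism B -> U}.
Hypothesis gen_ind : forall Q : U -> Prop, Q 0 -> Q 1 ->
  (forall (k : K) u v, Q u -> Q v -> Q (k *: u + v)) ->
  (forall x u, Q u -> Q (gen x * u)) -> forall u, Q u.
Hypothesis gb_ind : forall Q : B -> Prop, Q 0 -> Q 1 ->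
  (forall (k : K) u v, Q u -> Q v -> Q (k *: u + v)) ->
  (forall x u, Q u -> Q (gb x * u)) -> forall u, Q u.
Variables (c c' : Xb -> Xa -> K) (sh : Xb -> Xa -> Xa) (ex : Xb -> Xa -> B).
Hypothesis straighten : forall g a, j (gb g) * ga a =
  c g a *: (ga a * j (gb g)) + c' g a *: ga (sh g a) + j (ex g a).
Hypothesis gen_cases : forall x,
  (exists a, gen x = ga a) \/ (exists g, gen x = j (gb g)).

Let prod_of (n : nat) (u : U) : Prop :=
  exists l z, (size l <= n)%N /\ u = \prod_(a <- l) ga a * j z.

(** Induction on the number of left letters. The bound in [prod_of] is an inequality because the
    [ex] term of a straightening swallows a left letter. *)
Lemma straight_spanning (u : U) :
  in_span (fun v => exists l z, v = \prod_(a <- l) ga a * j z) u.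
Proof.
have monoS n m v : (n <= m)%N -> in_span (prod_of n) v -> in_span (prod_of m) v.
  move=> nm; elim=> [|k w v' [l [z [ln ->]]] _ IH]; first by constructor.
  apply: in_span_lin IH; apply: in_span_gen; exists l, z; split=> //.
  exact: leq_trans nm.
have spanA n a v : in_span (prod_of n) v -> in_span (prod_of n.+1) (ga a * v).
  elim=> [|k w v' [l [z [ln ->]]] _ IH]; first by rewrite mulr0; constructor.
  rewrite mulr_linr; apply: in_span_lin IH; apply: in_span_gen.
  by exists (a :: l), z; rewrite big_cons mulrA.
have spanB n g v : in_span (prod_of n) v -> in_span (prod_of n) (j (gb g) * v).
  elim: n => [|n IHn] in g v *.
    elim=> [|k w v' [l [z [ln ->]]] _ IH]; first by rewrite mulr0; constructor.
    rewrite mulr_linr; apply: in_span_lin IH; apply: in_span_gen.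
    exists [::], (gb g * z); split=> //.
    by move: ln; rewrite leqn0 => /nilP ->; rewrite !big_nil !mul1r rmorphM.
  (* The term [ex] is an arbitrary element of B, not a generator; it meets only n letters, so the
     induction hypothesis applies to each of its generators in turn. *)
  have liftB d w : in_span (prod_of n) w -> in_span (prod_of n) (j d * w).
    move=> Sw; elim/gb_ind: d => [||k d d' Sd Sd'|g' d Sd].
    - by rewrite rmorph0 mul0r; constructor.
    - by rewrite rmorph1 mul1r.
    - by rewrite linearP mulrDl -scalerAl; apply: in_span_lin.
    - by rewrite rmorphM -mulrA; apply: IHn.
  elim=> [|k w v' [l [z [ln ->]]] _ IH]; first by rewrite mulr0; constructor.
  rewrite mulr_linr; apply: in_span_lin IH.
  case: l ln => [|a l] ln; rewrite ?big_nil ?big_cons.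
    rewrite mul1r; apply: in_span_gen; exists [::], (gb g * z).
    by rewrite big_nil mul1r rmorphM.
  have Slz : in_span (prod_of n) (\prod_(a <- l) ga a * j z).
    by apply: in_span_gen; exists l, z.
  rewrite -mulrA mulrA straighten !mulrDl -!scalerAl -addrA -mulrA.
  apply: in_span_lin; first exact/spanA/IHn.
  apply: in_span_lin; first exact: spanA.
  by apply: (monoS n) => //; apply: liftB.
have Sprod n v : in_span (prod_of n) v ->
    in_span (fun v => exists l z, v = \prod_(a <- l) ga a * j z) v.
  elim=> [|k w v' [l [z [_ ->]]] _ IH]; first by constructor.
  by apply: in_span_lin IH; apply: in_span_gen; exists l, z.
suff [n] : exists n, in_span (prod_of n) u by exact: Sprod.
elim/gen_ind: u => [||k u v [n Su] [m Sv]|x u [n Su]].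
- by exists 0%N; constructor.
- exists 0%N; apply: in_span_gen; exists [::], 1.
  by rewrite big_nil mul1r rmorph1.
- exists (maxn n m); apply: in_span_lin.
    by apply: (monoS n) => //; exact: leq_maxl.
  by apply: (monoS m) => //; exact: leq_maxr.
- exists n.+1; case: (gen_cases x) => -[y ->]; first exact: spanA.
  by apply: (monoS n) => //; exact: spanB.
Qed.

End Spanning.

Section Coinduction.
Variables (K : comNzRingType) (Xa Xb X : choiceType).
Variables (Pa : presentation K Xa) (Pb : presentation K Xb).
Variables (P : presentation K X) (ia : Xa -> X) (ib : Xb -> X).
Variables (split : X -> Xa + Xb).
Hypothesis split_ia : forall a, split (ia a) = inl a.
Hypothesis split_ib : forall b, split (ib b) = inr b.
Hypothesis gen_cases : forall x, (exists a, x = ia a) \/ (exists b, x = ib b).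

Variables (c c' : Xb -> Xa -> K) (sh : Xb -> Xa -> Xa).
Variable (ex : Xb -> Xa -> falg K Xb).

(** One shape serves both steps. The terms [c'] and [sh] account for [h, x^-], which is again a left
    generator; [ex] collects what falls into the right factor: [x^+, h] in the first step, the
    right-hand side of (R4) in the second. *)
Definition straight (E : algType K) (ea : Xa -> E) (eb : Xb -> E) : Prop :=
  forall g a, eb g * ea a =
    c g a *: (ea a * eb g) + c' g a *: ea (sh g a) + free_lift eb (ex g a).

Definition lin_closed (E : lmodType K) (J : E -> Prop) : Prop :=
  J 0 /\ forall k u v, J u -> J v -> J (k *: u + v).

(** The right ideal generated by [Q]. *)
Definition right_gen (E : algType K) (Q : E -> Prop) : E -> Prop :=
  in_span (fun u => exists z v, Q z /\ u = z * v).

(* Induction on the length of the words in [Xb]: in the algebra of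
   operators, [L z] says that z f vanishes at the empty word for all f. *)
Definition word_induction (E : algType K) (eb : Xb -> E) (L : E -> Prop) :=
  forall Q : E -> Prop, (forall z, Q z -> L z) ->
  (forall z g, Q z -> right_gen Q (eb g * z)) -> forall z, Q z -> z = 0.

Definition holds (Y : choiceType) (S : presentation K Y) (E : algType K)
  (e : Y -> E) : Prop := forall u, rels S u -> free_lift e u = 0.

(** [J] will be the set of operators killing the vectors on which the right relations hold. It is
    only a left ideal: stability of those vectors under the left generators is what this hypothesis
    serves to prove. *)
Hypothesis left_stable : forall (E : algType K) (ea : Xa -> E) (eb : Xb -> E),
  straight ea eb -> forall J : E -> Prop, lin_closed J ->
  (forall u v, J v -> J (u * v)) ->
  (forall d, pres_pi Pb d = 0 -> J (free_lift eb d)) ->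
  forall u a, rels Pb u -> J (free_lift eb u * ea a).

(** Used after restriction to the submodule, where the right relations hold. [L] will be the right
    ideal of operators whose values vanish at the empty word; the left relators lie in it, and
    [word_induction] propagates this to all words. *)
Hypothesis right_stable : forall (E : algType K) (ea : Xa -> E) (eb : Xb -> E),
  straight ea eb -> holds Pb eb -> forall L : E -> Prop, lin_closed L ->
  (forall u v, L u -> L (u * v)) ->
  (forall u, rels Pa u -> L (free_lift ea u)) -> word_induction eb L ->
  holds Pa ea.

Hypothesis complete : forall (E : algType K) (e : X -> E),
  straight (e \o ia) (e \o ib) -> holds Pa (e \o ia) -> holds Pb (e \o ib) ->
  holds P e.

Hypothesis P_straight : straight (pres_gen P \o ia) (pres_gen P \o ib).
Hypothesis P_holds_a : holds Pa (pres_gen P \o ia).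
Hypothesis P_holds_b : holds Pb (pres_gen P \o ib).

Let ja : {lrmorphism pres_alg Pa -> pres_alg P} := pres_lift P_holds_a.
Let jb : {lrmorphism pres_alg Pb -> pres_alg P} := pres_lift P_holds_b.

Section Module.
Variables (W : lmodType K) (be : pres_alg Pa -> pres_alg Pb -> W).
Hypothesis be_linl : forall z, linear (be^~ z).
Hypothesis be_linr : forall y, linear (be y).
Variables (y0 : pres_alg Pa) (z0 : pres_alg Pb).
Hypothesis be_neq0 : be y0 z0 != 0.

Local Notation Wa := (linmap (pres_alg Pa) W).
(* A list stands for its letters read from right to left. *)
Local Notation N := (seq Xb -> Wa).

Let n0 : N := fun=> mk_linmap (be_linl z0).

Lemma coind_nz : n0 != 0.
Proof.
apply: contra be_neq0 => /eqP /(congr1 (fun f : N => lapp (f [::]) y0)).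
by rewrite mk_linmapE => ->.
Qed.

Local Notation E := (endo coind_nz).

Lemma coind_fctD (f h : N) l : (f + h) l = f l + h l.
Proof. by []. Qed.

Lemma coind_fctZ k (f : N) l : (k *: f) l = k *: f l.
Proof. by []. Qed.

Lemma coind_b_linear g : linear (fun (f : N) l => f (g :: l)).
Proof. by []. Qed.

Definition coind_b g : E := mk_endo _ (coind_b_linear g).

Lemma coind_act_linear a (f : Wa) :
  linear (fun y => lapp f (y * pres_gen Pa a)).
Proof. by move=> k u v; rewrite mulrDl -scalerAl linearP. Qed.

Definition coind_act a (f : Wa) : Wa := mk_linmap (coind_act_linear a f).

(** Since f(g :: l) = (b_g f)(l), the value of a f at g :: l has to be that of b_g a f at l, which
    [straight] expresses through shorter words. At the empty word the left generator multiplies the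
    argument on the right. *)
Fixpoint coind_a_op (l : seq Xb) (a : Xa) (f : N) : Wa :=
  if l is g :: l' then
    c g a *: coind_a_op l' a (eapp (coind_b g) f)
    + c' g a *: coind_a_op l' (sh g a) f
    + eapp (free_lift coind_b (ex g a)) f l'
  else coind_act a (f [::]).

Lemma coind_a_linear a : linear (fun f l => coind_a_op l a f).
Proof.
move=> k f h; apply/funext => l /=.
change (coind_a_op l a (k *: f + h) =
  k *: coind_a_op l a f + coind_a_op l a h).
elim: l => [|g l IH] /= in a f h *.
  by apply: linmapP => y; rewrite lappD lappZ !mk_linmapE.
have linE (z : E) : eapp z (k *: f + h) l = k *: eapp z f l + eapp z h l.
  by rewrite linearP.
rewrite linE [eapp (coind_b g) _]linearP !IH.
rewrite !scalerDr !scalerA [c g a * k]mulrC [c' g a * k]mulrC.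
by rewrite [RHS]addrACA; congr (_ + _); rewrite [RHS]addrACA.
Qed.

Definition coind_a a : E := mk_endo _ (coind_a_linear a).

Lemma coind_bE g f l : eapp (coind_b g) f l = f (g :: l).
Proof. by rewrite mk_endoE. Qed.

Lemma coind_aE a f l : eapp (coind_a a) f l = coind_a_op l a f.
Proof. by rewrite mk_endoE. Qed.

Lemma coind_straight : straight coind_a coind_b.
Proof.
move=> g a; apply: endoP => f; apply/funext => l.
rewrite eappM coind_bE coind_aE /=.
rewrite !eappD !eappZ eappM.
by congr (_ *: _ + _ *: _ + _); rewrite coind_aE.
Qed.

(** The shifts act freely on all functions; this is the largest submodule on which the right
    relations hold. *)
Definition coind_sub : {pred N} := fun f =>
  `[< forall u, pres_pi Pb u = 0 -> eapp (free_lift coind_b u) f = 0 >].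

Lemma coind_subP f : reflect
  (forall u, pres_pi Pb u = 0 -> eapp (free_lift coind_b u) f = 0)
  (f \in coind_sub).
Proof. exact: asboolP. Qed.

Lemma coind_sub_closed : subsemimod_closed coind_sub.
Proof.
apply: GRing.submod_closed_semi; split.
  by apply/coind_subP => u _; rewrite eappr0.
move=> k f h /coind_subP fN /coind_subP hN; apply/coind_subP => u u0.
by rewrite eappP fN // hN // scaler0 addr0.
Qed.

HB.instance Definition _ :=
  GRing.isSubmodClosed.Build K N coind_sub coind_sub_closed.

Definition coind_mod := {f : N | f \in coind_sub}.

HB.instance Definition _ := SubType.on coind_mod.
HB.instance Definition _ := SubChoice.on coind_mod.
HB.instance Definition _ := [SubChoice_isSubLmodule of coind_mod by <:].

Lemma coind_valD (f h : coind_mod) : val (f + h) = val f + val h.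
Proof. by []. Qed.

Lemma coind_valZ k (f : coind_mod) : val (k *: f) = k *: val f.
Proof. by []. Qed.

Lemma coind_sub_lift u f :
  f \in coind_sub -> eapp (free_lift coind_b u) f \in coind_sub.
Proof.
move/coind_subP => fN; apply/coind_subP => v v0.
by rewrite -eappM -rmorphM fN // rmorphM /= v0 mul0r.
Qed.

Lemma coind_b_stable g f : f \in coind_sub -> eapp (coind_b g) f \in coind_sub.
Proof. by move/(coind_sub_lift (fgen K g)); rewrite free_lift_gen. Qed.

(** By straightening, the span of [coind_sub] and its images under left generators is stable under
    the shifts, and [left_stable] says that the right relators kill it. *)
Lemma coind_a_stable a f : f \in coind_sub -> eapp (coind_a a) f \in coind_sub.
Proof.
pose S f := f \in coind_sub \/
  exists a h, h \in coind_sub /\ f = eapp (coind_a a) h.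
have Sb g h : in_span S h -> in_span S (eapp (coind_b g) h).
  elim=> [|k u v Su _ IH]; first by rewrite eappr0; constructor.
  rewrite eappP; apply: in_span_lin IH.
  case: Su => [/(coind_b_stable g) uN|[a' [f' [f'N ->]]]].
    by apply: in_span_gen; left.
  rewrite -eappM coind_straight 2!eappD 2!eappZ eappM -addrA.
  apply: in_span_lin.
    apply: in_span_gen; right; exists a', (eapp (coind_b g) f').
    by rewrite coind_b_stable.
  apply: in_span_lin.
    by apply: in_span_gen; right; exists (sh g a'), f'.
  by apply: in_span_gen; left; apply: coind_sub_lift.
have Slift u h : in_span S h -> in_span S (eapp (free_lift coind_b u) h).
  move=> Sh; elim/free_alg_ind: u => [||k u v Su Sv|g u Su].
  - by rewrite free_lift0 eapp0; constructor.
  - by rewrite free_lift1 eapp1.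
  - by rewrite free_liftP eappD eappZ; apply: in_span_lin.
  - by rewrite free_liftM free_lift_gen eappM; apply: Sb.
have Srels u h : rels Pb u -> in_span S h -> eapp (free_lift coind_b u) h = 0.
  move=> Pu; elim=> [|k' h' h'' Sh' _ IH]; first by rewrite eappr0.
  rewrite eappP IH addr0; case: Sh' => [/coind_subP -> //|].
  - by rewrite scaler0.
  - exact: pres_pi_rels.
  move=> [a' [f' [f'N ->]]]; rewrite -eappM.
  suff -> : eapp (free_lift coind_b u * coind_a a') f' = 0 by rewrite scaler0.
  pose J (z : E) := forall f, f \in coind_sub -> eapp z f = 0.
  apply: (left_stable coind_straight (J := J)) => //.
  - split=> [f'' _|k z z' Jz Jz' f'' f''N]; first by rewrite eapp0.
    by rewrite eappD eappZ Jz // Jz' // scaler0 addr0.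
  - by move=> z z' Jz' f'' f''N; rewrite eappM Jz' // eappr0.
  - by move=> d d0 f'' /coind_subP ->.
(* An element of the ideal is a combination of products v1 r v3 with r a relator: v3 keeps the
   vector in the span, and r kills it. *)
move=> fN; apply/coind_subP => u /pres_pi_eq0.
have Sf : in_span S (eapp (coind_a a) f).
  by apply: in_span_gen; right; exists a, f.
elim=> [|k v w [v1 v2 v3 Pv] _ IH]; first by rewrite free_lift0 eapp0.
rewrite free_liftP eappD eappZ IH !free_liftM !eappM (Srels _ _ Pv (Slift _ _ Sf)).
by rewrite eappr0 scaler0 addr0.
Qed.

Fixpoint coind_word (l : seq Xb) : pres_alg Pb :=
  if l is g :: l' then coind_word l' * pres_gen Pb g else 1.

(** The form [be] itself, read as a function on words; it is the cyclic vector from which [be] is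
    recovered. *)
Definition coind_vec_val : N := fun l => mk_linmap (be_linl (coind_word l)).

Lemma coind_vecE u l y :
  lapp (eapp (free_lift coind_b u) coind_vec_val l) y =
  be y (coind_word l * pres_pi Pb u).
Proof.
elim/free_alg_ind: u => [||k u v IHu IHv|g u IH] in l *.
- rewrite free_lift0 pres_pi0 mulr0 eapp0.
  by rewrite (linear_fun0 (be_linr y)).
- by rewrite free_lift1 rmorph1 mulr1 eapp1 mk_linmapE.
- rewrite free_liftP pres_pi_lin eappD eappZ lappD lappZ IHu IHv mulr_linr.
  exact/esym/be_linr.
- by rewrite free_liftM free_lift_gen eappM coind_bE IH /= pres_pi_mul mulrA.
Qed.

Lemma coind_vec_subproof : coind_vec_val \in coind_sub.
Proof.
apply/coind_subP => u u0; apply/funext => l; apply: linmapP => y.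
by rewrite coind_vecE u0 mulr0 (linear_fun0 (be_linr y)).
Qed.

Definition coind_vec : coind_mod := Sub coind_vec_val coind_vec_subproof.

Lemma coind_vec_neq0 : coind_vec != 0.
Proof.
apply: contra be_neq0 => /eqP v0; pose u := repr z0.
have : lapp (eapp (free_lift coind_b u) (val coind_vec) [::]) y0 = be y0 z0.
  by rewrite coind_vecE /= mul1r pres_piK.
by rewrite v0 eappr0 => <-.
Qed.

Local Notation E0 := (endo coind_vec_neq0).

Section Restrict.
Variables (z : E) (zN : forall f, f \in coind_sub -> eapp z f \in coind_sub).

Definition coind_restr_fun (f : coind_mod) : coind_mod :=
  Sub (eapp z (val f)) (zN (valP f)).

Lemma coind_restr_linear : linear coind_restr_fun.
Proof.
by move=> k f h; apply: val_inj; exact: (eappP z k (val f) (val h)).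
Qed.

Definition coind_restr : E0 := mk_endo _ coind_restr_linear.

Lemma coind_restrE f : val (eapp coind_restr f) = eapp z (val f).
Proof. by rewrite mk_endoE. Qed.

End Restrict.

Definition coind_b0 g : E0 := coind_restr (@coind_b_stable g).
Definition coind_a0 a : E0 := coind_restr (@coind_a_stable a).

Lemma coind_b0E u f :
  val (eapp (free_lift coind_b0 u) f) = eapp (free_lift coind_b u) (val f).
Proof.
elim/free_alg_ind: u => [||k u v IHu IHv|g u IH].
- by rewrite !free_lift0 !eapp0.
- by rewrite !free_lift1 !eapp1.
- by rewrite !free_liftP !eappD !eappZ -IHu -IHv coind_valD coind_valZ.
- by rewrite !free_liftM !free_lift_gen !eappM coind_restrE IH.
Qed.

Lemma coind_straight0 : straight coind_a0 coind_b0.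
Proof.
move=> g a; apply: endoP => f; apply: val_inj.
rewrite eappM !coind_restrE -eappM coind_straight 2!eappD 2!eappZ.
rewrite 2!eappD 2!eappZ 2!coind_valD 2!coind_valZ.
by rewrite coind_b0E !eappM !coind_restrE.
Qed.

Lemma coind_holds_b : holds Pb coind_b0.
Proof.
move=> u Pu; apply: endoP => f; apply: val_inj; rewrite coind_b0E eapp0.
by have /coind_subP -> := valP f; last exact: pres_pi_rels.
Qed.

(** At the empty word only right multiplication on the argument is seen, so the left relators vanish
    there at once. *)
Lemma coind_a0E u f y :
  lapp (val (eapp (free_lift coind_a0 u) f) [::]) y =
  lapp (val f [::]) (y * pres_pi Pa u).
Proof.
elim/free_alg_ind: u => [||k u v IHu IHv|a u IH] in y *.
- by rewrite free_lift0 pres_pi0 mulr0 eapp0 lappr0.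
- by rewrite free_lift1 rmorph1 mulr1 eapp1.
- rewrite free_liftP pres_pi_lin eappD eappZ mulr_linr.
  rewrite coind_valD coind_valZ coind_fctD coind_fctZ lappD lappZ IHu IHv.
  by rewrite lappP.
- rewrite free_liftM free_lift_gen eappM coind_restrE coind_aE /=.
  by rewrite mk_linmapE IH pres_pi_mul mulrA.
Qed.

Lemma coind_holds_a : holds Pa coind_a0.
Proof.
pose L (z : E0) := forall f, val (eapp z f) [::] = 0.
apply: (right_stable coind_straight0 coind_holds_b (L := L)).
- split=> [f|k u v Lu Lv f]; first by rewrite eapp0.
  rewrite eappD eappZ coind_valD coind_valZ.
  rewrite coind_fctD coind_fctZ Lu Lv.
  by rewrite scaler0 addr0.
- by move=> u v Lu f; rewrite eappM.
- move=> u Pu f; apply: linmapP => y.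
  by rewrite coind_a0E (pres_pi_rels Pu) mulr0 lappr0.
(* The value of z f at g :: l is that of b_g z f at l, and b_g z is a combination of products z' w
   with z' in [Q], covered at the shorter word l. *)
move=> Q QL Qb z Qz; apply: endoP => f; apply: val_inj; apply/funext => l.
elim: l => [|g l IH] in z Qz f *; first exact: QL.
rewrite -coind_bE -(coind_restrE (@coind_b_stable g)) -eappM eapp0.
elim: (Qb z g Qz) => [|k u v [z' [w [Qz' ->]]] _ IHv]; first by rewrite eapp0.
rewrite eappD eappZ eappM coind_valD coind_valZ coind_fctD coind_fctZ.
by rewrite IHv IH // eapp0 scaler0 addr0.
Qed.

Definition coind_gen (x : X) : E0 :=
  match split x with inl a => coind_a0 a | inr g => coind_b0 g end.

Lemma coind_gen_a : coind_gen \o ia = coind_a0.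
Proof. by apply/funext => a; rewrite /= /coind_gen split_ia. Qed.

Lemma coind_gen_b : coind_gen \o ib = coind_b0.
Proof. by apply/funext => b; rewrite /= /coind_gen split_ib. Qed.

Lemma coind_holds : holds P coind_gen.
Proof.
apply: complete; rewrite ?coind_gen_a ?coind_gen_b.
- exact: coind_straight0.
- exact: coind_holds_a.
- exact: coind_holds_b.
Qed.

Local Notation Theta := (pres_lift coind_holds).

Lemma coind_Theta_ja u : Theta (ja (pres_pi Pa u)) = free_lift coind_a0 u.
Proof.
rewrite pres_lift_pi free_lift_comp; apply: eq_free_lift => a /=.
by rewrite pres_lift_gen -coind_gen_a.
Qed.

Lemma coind_Theta_jb u : Theta (jb (pres_pi Pb u)) = free_lift coind_b0 u.
Proof.
rewrite pres_lift_pi free_lift_comp; apply: eq_free_lift => a /=.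
by rewrite pres_lift_gen -coind_gen_b.
Qed.

Lemma coind_Theta_a y y' f :
  lapp (val (eapp (Theta (ja y)) f) [::]) y' = lapp (val f [::]) (y' * y).
Proof. by rewrite -[y]pres_piK coind_Theta_ja coind_a0E. Qed.

Lemma coind_Theta_b z y :
  lapp (val (eapp (Theta (jb z)) coind_vec) [::]) y = be y z.
Proof.
by rewrite -[z in LHS]pres_piK coind_Theta_jb coind_b0E coind_vecE mul1r pres_piK.
Qed.

(** Acting on the cyclic vector and evaluating at the empty word and at 1: the left factor becomes
    the argument, the right factor the second variable of [be]. *)
Definition coind_fun (u : pres_alg P) : W :=
  lapp (val (eapp (Theta u) coind_vec) [::]) 1.

Lemma coind_fun_linear : linear coind_fun.
Proof.
move=> k u v; rewrite /coind_fun linearP eappD eappZ.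
by rewrite coind_valD coind_valZ coind_fctD coind_fctZ lappD lappZ.
Qed.

Lemma coind_funE y z : coind_fun (ja y * jb z) = be y z.
Proof.
by rewrite /coind_fun rmorphM eappM coind_Theta_a mul1r coind_Theta_b.
Qed.

End Module.

Lemma coinduction (W : lmodType K) (be : pres_alg Pa -> pres_alg Pb -> W) :
  (forall z, linear (be^~ z)) -> (forall y, linear (be y)) ->
  exists2 f : pres_alg P -> W, linear f &
    forall y z, f (ja y * jb z) = be y z.
Proof.
move=> bel ber.
have [[y [z /eqP yz]]|be0] := pselect (exists y z, be y z <> 0).
  exists (coind_fun bel ber yz); first exact: coind_fun_linear.
  exact: coind_funE.
(* The zero form is treated apart, since the operator algebra needs a nonzero vector. *)
exists (fun=> 0) => [c0 u v|y z]; first by rewrite scaler0 addr0.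
by apply/esym; apply: contrapT => yz; apply: be0; exists y, z.
Qed.

Lemma coind_spanning (u : pres_alg P) :
  in_span (fun v => exists y z, v = ja y * jb z) u.
Proof.
have Pst g a : jb (pres_gen Pb g) * pres_gen P (ia a) =
    c g a *: (pres_gen P (ia a) * jb (pres_gen Pb g))
    + c' g a *: pres_gen P (ia (sh g a)) + jb (pres_pi Pb (ex g a)).
  by rewrite pres_lift_gen pres_lift_pi; exact: P_straight.
have Pcases x : (exists a, pres_gen P x = pres_gen P (ia a)) \/
    (exists g, pres_gen P x = jb (pres_gen Pb g)).
  case: (gen_cases x) => -[y ->]; first by left; exists y.
  by right; exists y; rewrite pres_lift_gen.
have := straight_spanning (@pres_ind _ _ P) (@pres_ind _ _ Pb) Pst Pcases u.
elim=> [|k w v' [l [z ->]] _ IH]; first by constructor.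
apply: in_span_lin IH; apply: in_span_gen.
exists (\prod_(a <- l) pres_gen Pa a), z; rewrite rmorph_prod.
congr (_ * _); apply: eq_bigr => a _; exact/esym/pres_lift_gen.
Qed.

End Coinduction.

(** * Quantum binomial identities *)

(* Decides identities between linear combinations of given vectors by comparing
   the coefficients of each of them. *)
Section LinearCombinations.
Variables (K : comNzRingType) (V : lmodType K).

Inductive lexp :=
  LVar of nat | LZero | LAdd of lexp & lexp | LOpp of lexp | LScale of K & lexp.

Fixpoint lexp_eval (s : seq V) (e : lexp) : V :=
  match e with
  | LVar n => nth 0 s n
  | LZero => 0
  | LAdd a b => lexp_eval s a + lexp_eval s b
  | LOpp a => - lexp_eval s a
  | LScale k a => k *: lexp_eval s a
  end.

(** [Nat.eqb] here and the nested conjunction in [lexp_eqs] reduce under the short [cbv] of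
    [lin_comb], leaving one scalar identity per vector. *)
Fixpoint lexp_coef (i : nat) (e : lexp) : K :=
  match e with
  | LVar n => if Nat.eqb i n then 1 else 0
  | LZero => 0
  | LAdd a b => lexp_coef i a + lexp_coef i b
  | LOpp a => - lexp_coef i a
  | LScale k a => k * lexp_coef i a
  end.

Fixpoint lexp_eqs (n : nat) (a b : lexp) : Prop :=
  match n with
  | 0%N => True
  | m.+1 => lexp_coef m a = lexp_coef m b /\ lexp_eqs m a b
  end.

Lemma lexp_evalE s e :
  lexp_eval s e = \sum_(i < size s) lexp_coef i e *: nth 0 s i.
Proof.
elim: e => [n||a IHa b IHb|a IH|k a IH] /=.
- have eqbE (i : nat) : Nat.eqb i n = (i == n).
    by elim: i n => [|i IH] [|n].
  under eq_bigr => i _ do rewrite eqbE.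
  have [n_lt|n_ge] := ltnP n (size s); last first.
    rewrite nth_default // big1 // => i _; case: eqP => [ni|]; last first.
      by rewrite scale0r.
    by rewrite ni in n_ge *; move: (ltn_ord i); rewrite ni ltnNge n_ge.
  rewrite (bigD1 (Ordinal n_lt)) //= eqxx scale1r big1 ?addr0 // => i.
  by rewrite -val_eqE /= => /negPf ->; rewrite scale0r.
- by rewrite big1 // => i _; rewrite scale0r.
- by rewrite IHa IHb -big_split; apply: eq_bigr => i _; rewrite scalerDl.
- by rewrite IH -sumrN; apply: eq_bigr => i _; rewrite scaleNr.
- by rewrite IH scaler_sumr; apply: eq_bigr => i _; rewrite scalerA.
Qed.

Lemma lexp_eq s a b : lexp_eqs (size s) a b -> lexp_eval s a = lexp_eval s b.
Proof.
move=> ab; rewrite !lexp_evalE; apply: eq_bigr => i _; congr (_ *: _).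
elim: (size s) ab (nat_of_ord i) (ltn_ord i) => [|m IH] //= [eqm eqs] j.
by rewrite ltnS leq_eqVlt => /predU1P[-> //|]; exact: IH.
Qed.

End LinearCombinations.

(* Up to conversion: equal products may be elaborated along different paths of
   the hierarchy. *)
Ltac lindex x s :=
  match s with
  | ?y :: _ =>
    let _ := match constr:(Set) with _ => unify x y end in constr:(0%N)
  | _ :: ?s' => let n := lindex x s' in constr:(S n)
  end.

Ltac lvars t s :=
  lazymatch t with
  | @Algebra.add _ ?a ?b => let s1 := lvars a s in lvars b s1
  | @Algebra.opp _ ?a => lvars a s
  | @GRing.scale _ _ _ ?a => lvars a s
  | @Algebra.zero _ => s
  | _ => match constr:(Set) with
         | _ => let n := lindex t s in s
         | _ => constr:(t :: s)
         end
  end.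

Ltac lreify K t s :=
  lazymatch t with
  | @Algebra.add _ ?a ?b =>
    let x := lreify K a s in let y := lreify K b s in constr:(@LAdd K x y)
  | @Algebra.opp _ ?a => let x := lreify K a s in constr:(@LOpp K x)
  | @GRing.scale _ _ ?k ?a => let x := lreify K a s in constr:(@LScale K k x)
  | @Algebra.zero _ => constr:(@LZero K)
  | _ => let n := lindex t s in constr:(@LVar K n)
  end.

Ltac lin_comb K V :=
  lazymatch goal with |- @eq _ ?a ?b =>
    let s0 := lvars a (@nil (GRing.Lmodule.sort V)) in
    let s := lvars b s0 in
    let x := lreify K a s in let y := lreify K b s in
    refine (@lexp_eq K V s x y _);
    cbv [lexp_coef lexp_eqs size Nat.eqb]; do ?split
  end.

Section ScaleMul.
Variables (K : comNzRingType) (A : algType K).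

Lemma mul_scalel (k : K) (u v : A) : (k *: u) * v = k *: (u * v).
Proof. by rewrite scalerAl. Qed.

Lemma mul_scaler (k : K) (u v : A) : u * (k *: v) = k *: (u * v).
Proof. by rewrite scalerAr. Qed.

End ScaleMul.

Ltac expand := rewrite ?(mulrDl, mulrDr, mulNr, mulrN, mulr0, mul0r, mul_scalel,
  mul_scaler).

Section QuantumBinomial.
Variables (K : fieldType) (q : K).
Hypothesis q_gen : forall m : nat, (0 < m)%N -> q ^+ m != 1.
Hypothesis q0 : q != 0.

Definition qn (n : nat) : K := qint q n%:Z.

Lemma q_sqr_neq0 : q * q - 1 != 0.
Proof. by rewrite -expr2 subr_eq0 q_gen. Qed.

Lemma q_subV_neq0 : q - q^-1 != 0.
Proof.
have: q ^+ 2 - 1 != 0 by rewrite subr_eq0 q_gen.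
by apply: contra => /eqP q1; apply/eqP; rewrite -[RHS](mulr0 q) -q1; field.
Qed.

Lemma qnE n : qn n = (q ^+ n - q ^- n) / (q - q^-1).
Proof. by rewrite /qn /qint -exprnN exprnP. Qed.

Lemma qn_neq0 n : (0 < n)%N -> qn n != 0.
Proof.
move=> n_gt0; rewrite qnE mulf_neq0 ?invr_eq0 ?q_subV_neq0 //.
have qn0 : q ^+ n != 0 by rewrite expf_neq0.
have : q ^+ (2 * n) - 1 != 0 by rewrite subr_eq0 q_gen // muln_gt0.
apply: contra => /eqP h; apply/eqP.
by rewrite mulnC exprM -[RHS](mulr0 (q ^+ n)) -h; field.
Qed.

Lemma qn0 : qn 0 = 0.
Proof. by rewrite qnE expr0 invr1 subrr mul0r. Qed.

Lemma qn1 : qn 1 = 1.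
Proof. by rewrite qnE expr1 divff // q_subV_neq0. Qed.

Lemma qnS n : qn n.+1 = q ^+ n + q^-1 * qn n.
Proof.
have qn0 : q ^+ n != 0 by rewrite expf_neq0.
have := q_subV_neq0; rewrite !qnE exprS => d0.
have d0' : q * q - 1 != 0.
  by apply: contra d0 => /eqP h; apply/eqP; rewrite -[RHS](mulr0 q^-1) -h; field.
by field; rewrite ?q0 ?qn0 ?d0'.
Qed.

Lemma qn_subV n : (q - q^-1) * qn n = q ^+ n - q ^- n.
Proof. by rewrite qnE mulrC divfK // q_subV_neq0. Qed.

(** The symmetric Gaussian binomial through its Pascal rule, suited to induction; [qbinE] identifies
    it with the quotient of q-factorials. *)
Fixpoint gbin (n k : nat) : K :=
  match n, k with
  | _, 0%N => 1
  | 0%N, _.+1 => 0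
  | n'.+1, k'.+1 => q ^- k * gbin n' k + q ^+ (n' - k') * gbin n' k'
  end.

Lemma gbin0 n : gbin n 0 = 1. Proof. by case: n. Qed.

Lemma gbinS n k :
  gbin n.+1 k.+1 = q ^- k.+1 * gbin n k.+1 + q ^+ (n - k) * gbin n k.
Proof. by []. Qed.

Lemma gbin_gt n k : (n < k)%N -> gbin n k = 0.
Proof.
elim: n k => [|n IH] [|k] //; rewrite ltnS => nk; rewrite gbinS !IH //.
  by rewrite !mulr0 addr0.
exact: ltnW.
Qed.

Lemma qfact0 : qfact q 0 = 1.
Proof. by rewrite /qfact big_geq. Qed.

Lemma qfactS n : qfact q n.+1 = qfact q n * qn n.+1.
Proof. by rewrite /qfact big_nat_recr. Qed.

Lemma qfact_neq0 n : qfact q n != 0.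
Proof.
elim: n => [|n IH]; first by rewrite qfact0 oner_neq0.
by rewrite qfactS mulf_neq0 // qn_neq0.
Qed.

Lemma qnD n m : qn (n + m) = q ^- m * qn n + q ^+ n * qn m.
Proof.
elim: n => [|n IH]; first by rewrite qn0 mulr0 add0r mul1r.
rewrite addSn !qnS IH exprD exprS.
have qn0 : q ^+ n != 0 by rewrite expf_neq0.
have qm0 : q ^+ m != 0 by rewrite expf_neq0.
have := qn_subV m; set x := qn m => xE.
have -> : q * q ^+ n * x = q ^+ n * ((q - q^-1) * x + q^-1 * x).
  by field.
by rewrite xE; field; rewrite q0 qm0.
Qed.

Lemma gbin_qfact n k : (k <= n)%N ->
  gbin n k * (qfact q k * qfact q (n - k)) = qfact q n.
Proof.
elim: n k => [|n IH] [|k] //; rewrite ?gbin0 ?subn0 ?qfact0 ?mul1r //.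
rewrite ltnS => kn; rewrite subSS gbinS mulrDl.
have -> : q ^+ (n - k) * gbin n k * (qfact q k.+1 * qfact q (n - k)) =
    q ^+ (n - k) * qn k.+1 * qfact q n.
  by rewrite -(IH k kn) qfactS; ring.
have -> : q ^- k.+1 * gbin n k.+1 * (qfact q k.+1 * qfact q (n - k)) =
    q ^- k.+1 * qn (n - k) * qfact q n.
  have [nk|nk|<-] := ltngtP n k.
  - by rewrite ltnNge kn in nk.
  - by rewrite -(IH k.+1 nk) -(subnSK nk) (qfactS (n - k.+1)); ring.
  - by rewrite gbin_gt // subnn qn0 !(mulr0, mul0r).
(* The Pascal rule for factorials is the addition formula for [(n - k) + (k + 1)]. *)
by rewrite -mulrDl -qnD addnS subnK // qfactS mulrC.
Qed.

Lemma qbinE n k : (k <= n)%N -> qbin q n k = gbin n k.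
Proof.
move=> kn; rewrite /qbin -(gbin_qfact kn) mulfK //.
by rewrite mulf_neq0 // qfact_neq0.
Qed.

Lemma gbin_mulk n k : gbin n.+1 k.+1 * qn k.+1 = qn n.+1 * gbin n k.
Proof.
have [kn|nk] := leqP k n; last by rewrite !gbin_gt // mul0r mulr0.
rewrite -!qbinE // /qbin subSS !qfactS.
by field; rewrite !(qfact_neq0, qn_neq0).
Qed.

Lemma gbin_mulnk n k : (k <= n)%N ->
  gbin n.+1 k * qn (n.+1 - k) = qn n.+1 * gbin n k.
Proof.
move=> kn; rewrite -!qbinE ?leqW // /qbin subSn // !qfactS.
by field; rewrite !(qfact_neq0, qn_neq0).
Qed.

End QuantumBinomial.

Arguments gbin : simpl never.

Section QuantumPlane.
Variables (K : fieldType) (A : algType K) (q : K).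
Hypothesis q_gen : forall m : nat, (0 < m)%N -> q ^+ m != 1.
Hypothesis q0 : q != 0.

Local Notation gb := (gbin q).
Local Notation qn := (qn q).

Lemma gbin_sumS n (f : nat -> A) :
  \sum_(k < n.+2) gb n.+1 k *: f k =
  \sum_(k < n.+1) gb n k *: (q ^- k *: f k + q ^+ (n - k) *: f k.+1).
Proof.
under [RHS]eq_bigr => k _ do rewrite scalerDr !scalerA.
rewrite big_split /= big_ord_recl [X in _ = X + _]big_ord_recl /=.
rewrite expr0 invr1 mulr1 !gbin0 -addrA; congr (_ + _).
rewrite [X in _ = X + _](_ : _ =
    \sum_(k < n.+1) (q ^- k.+1 * gb n k.+1) *: f k.+1); last first.
  rewrite big_ord_recr /= gbin_gt // mulr0 scale0r addr0.
  by apply: eq_bigr => k _; rewrite mulrC.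
rewrite -big_split; apply: eq_bigr => k _.
by rewrite /bump /= !add1n gbinS scalerDl [q ^+ _ * gb _ _]mulrC.
Qed.

(** The sum telescopes: both coefficients of w_(k+1) equal [n] times the binomial of n-1 and k, up
    to opposite signs. *)
Lemma qn_sum n (w : nat -> A) :
  \sum_(k < n.+1) ((-1) ^+ k * gb n k) *:
    (qn k *: w k + qn (n - k) *: w k.+1) = 0.
Proof.
under eq_bigr => k _ do rewrite scalerDr !scalerA -!mulrA.
rewrite big_split /= big_ord_recl qn0 // !mulr0 scale0r add0r.
rewrite [X in _ + X]big_ord_recr /= subnn qn0 // !mulr0 scale0r addr0.
rewrite -big_split big1 // => k _ /=; rewrite /bump /= add1n.
case: n k => [[]|n] // [k /= kn].
rewrite gbin_mulk // gbin_mulnk // exprS -scalerDl.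
by rewrite -mulrA mulN1r addNr scale0r.
Qed.

Variables (e0 e1 : A).
Hypothesis e10 : e1 * e0 = q ^+ 2 *: (e0 * e1).

(** For a = x_0 and b = Y x_1 this is the twisted current with parameter t. *)
Definition qlin (a b : A) (t : K) : A := a - t *: b.
Local Notation c := (qlin e0 e1).

Lemma qlin_comm t u : c t * c u = c (q ^- 2 * u) * c (q ^+ 2 * t).
Proof.
rewrite /qlin; expand; rewrite e10.
by lin_comb K A; field.
Qed.

Lemma qlin_e0 t : e0 * c t = c (q ^- 2 * t) * e0.
Proof.
rewrite /qlin; expand; rewrite e10.
by lin_comb K A; field.
Qed.

Lemma qlin_e0X t m : e0 * c t ^+ m = c (q ^- 2 * t) ^+ m * e0.
Proof.
elim: m => [|m IH]; first by rewrite !expr0 mulr1 mul1r.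
by rewrite (exprS (c t)) (exprS (c _)) mulrA qlin_e0 -!mulrA IH.
Qed.

(** A factor c(q^(2k)) moved right past c(q^2) turns it into c(1), and its own parameter gains
    q^2. *)
Lemma qlin_Xk k : c (q ^+ 2) ^+ k.+1 = c 1 ^+ k * c (q ^+ (2 * k.+1)).
Proof.
elim: k => [|k IH]; first by rewrite expr0 mul1r muln1 expr1.
rewrite (exprSr (c _)) IH -mulrA qlin_comm (exprSr (c 1)) mulrA.
congr (_ * c _ * c _); first by rewrite mulVf // expf_neq0.
by rewrite -exprD; congr (_ ^+ _); lia.
Qed.

Lemma qlin_Vk k : c (q ^- 2) ^+ k.+1 = c (q ^- (2 * k.+1)) * c 1 ^+ k.
Proof.
elim: k => [|k IH]; first by rewrite expr0 mulr1 muln1 expr1.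
rewrite (exprS (c _)) IH mulrA qlin_comm (exprS (c 1)) mulrA; congr (c _ * c _ * _).
  by rewrite -invfM -exprD; congr (_ ^- _); lia.
by rewrite mulfV // expf_neq0.
Qed.

(* The induction strips the last factor [e0]. *)
Lemma qlin_gbin_sum m a :
  \sum_(k < m.+2) gb m.+1 k *:
    ((-1) ^+ k *: ((q ^+ m) ^+ k *:
      (c a ^+ k * c (q ^+ (2 * m) * a) ^+ (m.+1 - k)))) = 0.
Proof.
pose f m k := (-1) ^+ k *: ((q ^+ m) ^+ k *:
  (c a ^+ k * c (q ^+ (2 * m) * a) ^+ (m.+1 - k))).
elim: m => [|m IH]; rewrite (gbin_sumS _ (f _)) /f.
  rewrite big_ord1 /= gbin0 subnn !expr0 invr1 !expr1 !mul1r mulr1.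
  by rewrite !scale1r scaleN1r subrr.
pose b := q ^+ (2 * m.+1) * a.
have bE : q ^- 2 * b = q ^+ (2 * m) * a.
  by rewrite /b mulnS exprD mulrA mulKf // expf_neq0.
rewrite (_ : \sum_(k < m.+2) _ = (1 - q ^+ (2 * m.+1)) *:
  ((\sum_(k < m.+2) gb m.+1 k *: ((-1) ^+ k *: ((q ^+ m) ^+ k *:
      (c a ^+ k * c (q ^+ (2 * m) * a) ^+ (m.+1 - k))))) * e0)).
  by rewrite IH mul0r scaler0.
rewrite mulr_suml scaler_sumr; apply: eq_bigr => -[k /= km] _.
rewrite -!scalerAl -mulrA -bE -qlin_e0X -/b.
rewrite subSS [(m.+2 - k)%N]subSn // (exprS (c b)) (exprSr (c a)).
rewrite -!mulrA; set z := c b ^+ (m.+1 - k).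
rewrite (_ : c b = (1 - q ^+ (2 * m.+1)) *: e0 + q ^+ (2 * m.+1) *: c a);
  last first.
  by rewrite /b /qlin; lin_comb K A; ring.
rewrite mulrDl mulrDr -!scalerAl -!scalerAr.
have -> : q ^+ (m.+1 - k) = q ^+ m.+1 / q ^+ k.
  by rewrite -[X in q ^+ X / _](subnK (km : (k <= m.+1)%N)) exprD mulfK // expf_neq0.
have -> : (q ^+ m.+1) ^+ k.+1 = q ^+ m.+1 * (q ^+ m.+1) ^+ k by exact: exprS.
have -> : q ^+ (2 * m.+1) = (q * q ^+ m) ^+ 2.
  by rewrite mulnC exprM (exprS q m).
have -> : (q ^+ m.+1) ^+ k = q ^+ k * (q ^+ m) ^+ k.
  by rewrite -exprMn -exprS.
rewrite (exprS (-1)) (exprS q m).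
have qk0 : q ^+ k != 0 by rewrite expf_neq0.
have qm0 : q ^+ m != 0 by rewrite expf_neq0.
by lin_comb K A; field; rewrite qk0.
Qed.

Lemma qlin_insert_sum m :
  \sum_(k < m.+2) ((-1) ^+ k * gb m.+1 k) *:
    ((q ^+ m *: c (q ^- m)) ^+ k * c (q ^+ m) ^+ (m.+1 - k)) = 0.
Proof.
rewrite -[RHS](qlin_gbin_sum m (q ^- m)); apply: eq_bigr => k _.
rewrite exprZn -scalerAl !scalerA [(-1) ^+ k * _]mulrC.
congr (_ *: (_ * c _ ^+ _)).
by rewrite mul2n -addnn exprD mulfK // expf_neq0.
Qed.

(** An ordered form of (x^n - y^n)/(x - y); it appears when an inserted series is pulled out of a
    power of x. *)
Definition hsum (x y : A) (n : nat) : A := \sum_(i < n) x ^+ i * y ^+ (n.-1 - i).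

Lemma hsum0 x y : hsum x y 0 = 0.
Proof. by rewrite /hsum big_ord0. Qed.

Lemma hsumS x y n : hsum x y n.+1 = y ^+ n + x * hsum x y n.
Proof.
rewrite /hsum big_ord_recl expr0 mul1r subn0 /=; congr (_ + _).
rewrite mulr_sumr; apply: eq_bigr => i _.
rewrite /bump /= add1n exprS -mulrA; congr (_ * (_ * y ^+ _)).
by case: n i => [[]|n i] //=; rewrite subSS.
Qed.

Local Notation a_ := (q ^- 2 *: c (q ^+ 2)).
Local Notation b_ := (c (q ^- 2)).
Local Notation c_ := (c 1).

(** Here [b_] is the twisted current and [a_] what it becomes on the far side of the series. By
    [qlin_Vk] each term contains a power of c(1), and the remaining linear factors add up to a
    multiple of c(1). *)
Lemma hsum_qlin n : hsum a_ b_ n.+1 = (q ^- n * qn n.+1) *: c_ ^+ n.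
Proof.
elim: n => [|n IH].
  by rewrite hsumS hsum0 mulr0 addr0 !expr0 invr1 mul1r qn1 // scale1r.
rewrite hsumS IH qlin_Vk (exprS c_) (@qnS _ _ q_gen q0 n.+1).
set z := c_ ^+ n; set w := qn n.+1; rewrite mulnC exprM /qlin; expand.
rewrite !(exprS q n).
have qn0 : q ^+ n != 0 by rewrite expf_neq0.
by lin_comb K A; rewrite /w qnE (exprS q n); field;
  rewrite q0 qn0 q_sqr_neq0.
Qed.

Variables (N : nat) (f0 f1 : A).
Local Notation v := (q ^- N).
Hypothesis e1f0 : e1 * f0 - v *: (e0 * f1) = v *: (f0 * e1) - f1 * e0.

Local Notation g := (qlin f0 f1).
Let r : A := e1 * f0 - v *: (e0 * f1).

Let v0 : q ^+ N != 0. Proof. by rewrite expf_neq0. Qed.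

Lemma qlin_swapl t u : c t * g u = c (u / v) * g (v * t) - (t - u / v) *: r.
Proof.
by rewrite /r /qlin; expand; lin_comb K A; field; rewrite v0 oner_neq0.
Qed.

Lemma qlin_swapr t u : g u * c t = g (t / v) * c (v * u) + (u - t / v) *: r.
Proof.
by rewrite /r e1f0 /qlin; expand; lin_comb K A; field; rewrite v0 oner_neq0.
Qed.

Local Notation aj := (v^-1 *: g v).
Local Notation bj := (g v^-1).

Let w k := if k is k'.+1 then c_ ^+ k' * r * c_ ^+ (N - k) else 0.

(** This and [insert_right] carry the x_j current to the same position, with the same main term
    c(1)^k g c(1)^(N-k). The corrections are multiples of w_k and w_(k+1), with the coefficients
    that [qn_sum] needs. *)
Lemma insert_left k : (k <= N)%N ->
  q ^- (N - k) *: (a_ ^+ k * aj * c_ ^+ (N - k)) =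
  q ^- k *: (c_ ^+ k * g (q ^+ (2 * k) * v) * c_ ^+ (N - k))
  - ((q - q^-1) * qn k) *: w k.
Proof.
case: k => [|k] kN /=.
  rewrite muln0 !expr0 invr1 !mul1r subn0 scaler0 subr0 scale1r.
  by rewrite -scalerAl scalerA invrK mulVf // scale1r.
have NE : q ^+ N = q ^+ (N - k.+1) * (q * q ^+ k).
  by rewrite -exprS -exprD subnK.
have j0 : q ^+ (N - k.+1) != 0 by rewrite expf_neq0.
have k0 : q ^+ k != 0 by rewrite expf_neq0.
have tE : q ^+ (2 * k.+1) = (q * q ^+ k) ^+ 2.
  by rewrite mulnC exprM (exprS q k).
have aE : (q ^- 2) ^+ k.+1 = (q * q ^+ k) ^- 2.
  by rewrite exprVn -exprM tE.
rewrite exprZn qlin_Xk qn_subV // (exprSr c_) [_ * v]mulrC.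
rewrite -!(scalerAl, scalerAr) -!mulrA [c (q ^+ _) * _]mulrA qlin_swapl.
rewrite divff ?invr_neq0 //; set G := g _; set y := r; set C := c_.
clearbody G y C; rewrite aE tE NE (exprS q k); expand; rewrite !mulrA.
by lin_comb K A; field; rewrite ?v0 ?q0 ?j0 ?k0 ?oner_neq0.
Qed.

Lemma insert_right k : (k <= N)%N ->
  q ^- k *: (c_ ^+ k * bj * b_ ^+ (N - k)) =
  q ^- k *: (c_ ^+ k * g (q ^+ (2 * k) * v) * c_ ^+ (N - k))
  + ((q - q^-1) * qn (N - k)) *: w k.+1.
Proof.
move=> kN; have k0 : q ^+ k != 0 by rewrite expf_neq0.
case jE : (N - k)%N => [|j].
  have -> : k = N by apply/eqP; rewrite eqn_leq kN -subn_eq0 jE.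
  rewrite qn0 // mulr0 scale0r addr0 !expr0 mul2n -addnn exprD mulfK // invrK.
  by [].
have j0 : q ^+ j != 0 by rewrite expf_neq0.
have NE : q ^+ N = q ^+ k * (q * q ^+ j) by rewrite -exprS -jE -exprD subnKC.
have jE' : (N - k.+1)%N = j by rewrite subnS jE.
rewrite qlin_Vk qn_subV // /w jE' (exprS c_) -!mulrA [g _ * _]mulrA qlin_swapr.
rewrite mulfV ?invr_neq0 //.
have -> : q ^- (2 * j.+1) / v = q ^+ (2 * k) * v.
  rewrite NE ![(2 * _)%N]mulnC !exprM (exprS q j); field.
  by rewrite ?v0 ?q0 ?j0 ?k0 ?oner_neq0.
set G := g _; set y := r; set C := c_; clearbody G y C.
rewrite NE [(2 * k)%N]mulnC exprM (exprS q j); expand.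
rewrite !mulrA; by lin_comb K A; field; rewrite ?v0 ?q0 ?j0 ?k0 ?oner_neq0.
Qed.

(** After [hsum_qlin], the absorption identities for binomials turn the sum of degree N+1 into [N+1]
    times one of degree N. There the main terms of [insert_left] and [insert_right] cancel and the
    corrections telescope. *)
Lemma qlin_hsum_sum :
  \sum_(k < N.+2) ((-1) ^+ k * gb N.+1 k) *:
    (hsum a_ b_ k * bj * b_ ^+ (N.+1 - k) + a_ ^+ k * aj * hsum a_ b_ (N.+1 - k))
  = 0.
Proof.
pose L k := q ^- (N - k) *: (a_ ^+ k * aj * c_ ^+ (N - k)).
pose T k := q ^- k *: (c_ ^+ k * bj * b_ ^+ (N - k)).
transitivity (qn N.+1 *:
    \sum_(k < N.+1) ((-1) ^+ k * gb N k) *: (L k - T k)).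
  under eq_bigr => k _ do rewrite scalerDr.
  rewrite big_split /= big_ord_recl hsum0 !mul0r scaler0 add0r.
  rewrite [X in _ + X]big_ord_recr /= subnn hsum0 mulr0 scaler0 addr0.
  rewrite -big_split scaler_sumr; apply: eq_bigr => -[k /= kN] _.
  rewrite /bump /= add1n subSS subSn // !hsum_qlin exprS.
  rewrite [RHS]scalerA [RHS]scalerBr /L /T addrC.
  rewrite -!(scalerAl, scalerAr) !scalerA.
  congr (_ *: _ + _).
    transitivity ((-1) ^+ k * q ^- (N - k) * v^-1 * (gb N.+1 k * qn (N - k).+1)).
      by ring.
    by rewrite -subSn // gbin_mulnk //; ring.
  rewrite -scaleNr; congr (_ *: _).
  transitivity (- ((-1) ^+ k * q ^- k * (gb N.+1 k.+1 * qn k.+1))); first by ring.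
  by rewrite gbin_mulk //; ring.
rewrite (_ : \sum_(k < _) _ = - (q - q^-1) *: \sum_(k < N.+1)
    ((-1) ^+ k * gb N k) *: (qn k *: w k + qn (N - k) *: w k.+1)).
  by rewrite qn_sum scaler0 scaler0.
rewrite scaler_sumr; apply: eq_bigr => k _.
have kN : (k <= N)%N by rewrite -ltnS.
rewrite /L /T insert_left // insert_right //.
by lin_comb K A; ring.
Qed.

End QuantumPlane.

(** * Currents *)

Section Currents.
Variable K : fieldType.

(** The shape of (R5) with a = q^(+-B_ij); the coefficients of phi satisfy the same relation with
    x. *)
Definition exch (A : algType K) (a : K) (p x : int -> A) : Prop :=
  forall m r, p (m + 1) * x r - a *: (x r * p (m + 1)) =
    a *: (p m * x (r + 1)) - x (r + 1) * p m.

(** As Y is central over the image of A, the twisted relation is (1 - t Y S)(1 - u Y S') applied to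
    the original one, S and S' shifting the two indices. *)
Lemma exch_twist_abstract (A E : algType K) (s : {lrmorphism A -> E}) (Y : E)
    (sY : forall a, s a * Y = Y * s a) a t u (p x : int -> A) :
  exch a p x -> exch a (fun m => s (p m) - t *: (Y * s (p (m + 1))))
    (fun m => s (x m) - u *: (Y * s (x (m + 1)))).
Proof.
move=> px m r.
pose d i j := s (p (m + i + 1)) * s (x (r + j))
  - a *: (s (x (r + j)) * s (p (m + i + 1)))
  - (a *: (s (p (m + i)) * s (x (r + j + 1))) - s (x (r + j + 1)) * s (p (m + i))).
have d0 i j : d i j = 0.
  rewrite /d -!rmorphM -!linearZ -!raddfB /=.
  by rewrite px subrr raddf0.
apply/eqP; rewrite -subr_eq0; apply/eqP.
transitivity (d 0 0 - u *: (Y * d 0 1) - t *: (Y * d 1 0) + (t * u) *: (Y * Y * d 1 1)).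
  rewrite /d !addr0.
  have comm0 := sY.
  have comm1 z b : z * s b * Y = z * Y * s b by rewrite -!mulrA comm0.
  expand; rewrite !mulrA !(comm0, comm1).
  by lin_comb K E; ring.
by rewrite !d0 !mulr0 !scaler0 !subr0 addr0.
Qed.

Section Series.
Variable A : algType K.

Local Notation V := (nat -> A).

Lemma series_nz : (fun=> 1 : A) != 0 :> V.
Proof.
by apply/eqP => /(congr1 (fun f : V => f 0%N)) /eqP; rewrite /= oner_eq0.
Qed.

(* An algebra containing the power series over A, acting on themselves. *)
Local Notation E := (endo series_nz).

Lemma series_const_linear (a : A) : linear (fun (f : V) n => a * f n).
Proof. by move=> k f g; apply/funext => n /=; rewrite mulr_linr. Qed.

Definition series_const (a : A) : E := mk_endo _ (series_const_linear a).

Lemma series_constE a f n : eapp (series_const a) f n = a * f n.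
Proof. by rewrite mk_endoE. Qed.

Lemma series_const_is_linear : linear series_const.
Proof.
move=> k a b; apply: endoP => f; apply/funext => n.
rewrite eappD eappZ series_constE.
rewrite -[RHS]/(k *: eapp (series_const a) f n + eapp (series_const b) f n).
by rewrite !series_constE mulrDl scalerAl.
Qed.

HB.instance Definition _ :=
  GRing.isLinear.Build K A E *:%R series_const series_const_is_linear.

Lemma series_const_monoid : monoid_morphism series_const.
Proof.
split=> [|a b]; apply: endoP => f; apply/funext => n.
  by rewrite series_constE eapp1 mul1r.
by rewrite eappM !series_constE mulrA.
Qed.

HB.instance Definition _ :=
  GRing.isMonoidMorphism.Build A E series_const series_const_monoid.

Lemma series_shift_linear :
  linear (fun (f : V) n => if n is n'.+1 then f n' else 0).
Proof.
move=> k f g; apply/funext => -[|n] //=.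
by rewrite -[RHS]/(k *: (0 : A) + 0) scaler0 addr0.
Qed.

Definition series_shift : E := mk_endo _ series_shift_linear.

Lemma series_shift0 f : eapp series_shift f 0%N = 0.
Proof. by rewrite mk_endoE. Qed.

Lemma series_shiftS f n : eapp series_shift f n.+1 = f n.
Proof. by rewrite mk_endoE. Qed.

Lemma series_of_linear (p : nat -> A) :
  linear (fun (f : V) n => \sum_(i < n.+1) p i * f (n - i)%N).
Proof.
move=> k f g; apply/funext => n /=.
rewrite -[RHS]/(k *: (\sum_(i < n.+1) p i * f (n - i)%N)
  + \sum_(i < n.+1) p i * g (n - i)%N).
rewrite scaler_sumr -big_split; apply: eq_bigr => i _.
exact: mulr_linr.
Qed.

(** Left multiplication by the series of the p_i Y^i, with [series_shift] in the role of Y. *)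
Definition series_of (p : nat -> A) : E := mk_endo _ (series_of_linear p).

Lemma series_ofE p f n :
  eapp (series_of p) f n = \sum_(i < n.+1) p i * f (n - i)%N.
Proof. by rewrite mk_endoE. Qed.

Local Notation s := series_const.
Local Notation Y := series_shift.

Lemma series_const_shift a : s a * Y = Y * s a.
Proof.
apply: endoP => f; apply/funext => -[|n]; rewrite !eappM series_constE.
  by rewrite !series_shift0 mulr0.
by rewrite !series_shiftS series_constE.
Qed.

Lemma series_shift_inj z : Y * z = 0 -> z = 0.
Proof.
move=> Yz; apply: endoP => f; apply/funext => n.
by rewrite -series_shiftS -eappM Yz eapp0.
Qed.

Lemma series_of_recl p : series_of p = s (p 0%N) + Y * series_of (p \o succn).
Proof.
apply: endoP => f; apply/funext => n; rewrite eappD eappM series_ofE.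
rewrite -[RHS]/(eapp (s (p 0%N)) f n + eapp Y (eapp (series_of (p \o succn)) f) n).
rewrite series_constE big_ord_recl subn0; congr (_ + _).
case: n => [|n]; first by rewrite big_ord0 series_shift0.
by rewrite series_shiftS series_ofE; apply: eq_bigr => i _.
Qed.

(** Having constant coefficient a. A relation rather than a function, because E also contains
    operators that are not multiplications by series. *)
Definition leads (z : E) (a : A) : Prop := forall f, eapp z f 0%N = a * f 0%N.

Lemma leads_inj z a b : leads z a -> leads z b -> a = b.
Proof.
by move=> /(_ (fun=> 1)) za /(_ (fun=> 1)); rewrite za !mulr1.
Qed.

Lemma leads0 : leads 0 0.
Proof. by move=> f; rewrite eapp0 mul0r. Qed.

Lemma leads1 : leads 1 1.
Proof. by move=> f; rewrite eapp1 mul1r. Qed.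

Lemma leadsD z z' a a' : leads z a -> leads z' a' -> leads (z + z') (a + a').
Proof.
move=> za za' f; rewrite eappD.
by rewrite -[LHS]/(eapp z f 0%N + eapp z' f 0%N) za za' mulrDl.
Qed.

Lemma leadsZ (k : K) z a : leads z a -> leads (k *: z) (k *: a).
Proof.
by move=> za f; rewrite eappZ -[LHS]/(k *: eapp z f 0%N) za scalerAl.
Qed.

Lemma leadsM z z' a a' : leads z a -> leads z' a' -> leads (z * z') (a * a').
Proof. by move=> za za' f; rewrite eappM za za' mulrA. Qed.

Lemma leadsX z a n : leads z a -> leads (z ^+ n) (a ^+ n).
Proof.
move=> za; elim: n => [|n IH]; first exact: leads1.
by rewrite !exprS; apply: leadsM.
Qed.

Lemma leads_sum (I : Type) (l : seq I) (P : pred I) (z : I -> E) (a : I -> A) :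
  (forall i, leads (z i) (a i)) ->
  leads (\sum_(i <- l | P i) z i) (\sum_(i <- l | P i) a i).
Proof.
by move=> za; apply: (big_rec2 leads) => [|i x y _ yx]; [exact: leads0|exact: leadsD].
Qed.

Lemma leads_const a : leads (s a) a.
Proof. by move=> f; rewrite series_constE. Qed.

Lemma leads_shift z : leads (Y * z) 0.
Proof. by move=> f; rewrite eappM series_shift0 mul0r. Qed.

Lemma leads_series p : leads (series_of p) (p 0%N).
Proof. by move=> f; rewrite series_ofE big_ord1. Qed.

Definition twist (t : K) (x : int -> A) (m : int) : E :=
  s (x m) - t *: (Y * s (x (m + 1))).

Lemma leads_twist t x m : leads (twist t x m) (x m).
Proof.
have := leadsD (leads_const (x m))
  (leadsZ (-1) (leadsZ t (leads_shift (s (x (m + 1)))))).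
by rewrite !scaler0 addr0 scaleN1r.
Qed.

Lemma twist_shift t x m : twist t x m * Y = Y * twist t x m.
Proof.
rewrite /twist mulrBl mulrBr -scalerAl -scalerAr -!mulrA.
by rewrite !series_const_shift.
Qed.

Lemma exch_twist a t u (p x : int -> A) :
  exch a p x -> exch a (twist t p) (twist u x).
Proof.
exact: (exch_twist_abstract (s := series_const) series_const_shift).
Qed.

(** The coefficient of each positive power of Y is an instance of the exchange relation with r = 0;
    the vanishing of p_(m-1) settles the constant term. *)
Lemma twist_series a (p x : int -> A) m : a != 0 -> exch a p x -> p (m - 1) = 0 ->
  let P := series_of (fun i => p (m + i%:Z)) in
  twist a^-1 x 0 * P = P * (a^-1 *: twist a x 0).
Proof.
move=> a0 px pm P.
have twE t f n : eapp (twist t x 0) f n =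
    x 0 * f n - t *: (if n is n'.+1 then x 1 * f n' else 0).
  rewrite /twist -scaleN1r -scaleN1r eappD 2!eappZ eappM.
  rewrite -[LHS]/(eapp (s (x 0)) f n
    + -1 *: (t *: eapp Y (eapp (s (x 1)) f) n)).
  rewrite series_constE; case: n => [|n]; first by rewrite series_shift0.
  by rewrite series_shiftS series_constE.
have px0 i : x 0 * p (i + 1) =
    a^-1 *: (p (i + 1) * x 0) + a^-1 *: (x 1 * p i) - p i * x 1.
  have := px i 0; rewrite add0r => /eqP; rewrite -subr_eq0 => /eqP pxi.
  rewrite -[LHS]addr0 -(scaler0 A a^-1) -pxi.
  by lin_comb K A; field.
have pm0 : x 0 * p m = a^-1 *: (p m * x 0).
  by have := px0 (m - 1); rewrite subrK pm mulr0 mul0r scaler0 addr0 subr0.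
apply: endoP => f; apply/funext => n; rewrite !eappM twE !series_ofE eappZ.
under [RHS]eq_bigr => i _ do
  rewrite -[(_ *: eapp _ _) _]/(a^-1 *: eapp (twist a x 0) f (n - i)%N) twE.
case: n => [|n].
  rewrite !big_ord1 addr0 subnn scaler0 subr0 scaler0 subr0.
  by rewrite mulrA pm0 -scalerAl -mulrA -scalerAr.
under [RHS]eq_bigr => i _ do
  rewrite scalerBr scalerA mulVf // scale1r mulrBr -scalerAr.
rewrite big_split [X in _ = _ + X]big_ord_recr /= subnn mulr0 oppr0 addr0.
rewrite series_ofE (big_ord_recl n.+1) [X in _ = X + _](big_ord_recl n.+1).
rewrite subn0 mulrDr addr0 mulrA pm0 -scalerAl -mulrA -!addrA.
congr (_ + _); rewrite !mulr_sumr scaler_sumr -sumrB -big_split.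
apply: eq_bigr => i _; rewrite lift0 subSS [(n.+1 - i)%N]subSn -1?ltnS //.
have -> : m + i.+1%:Z = m + i%:Z + 1 by rewrite -addn1 PoszD addrA.
rewrite mulrA px0 !mulrA; expand; rewrite ?mulrA.
by rewrite /=; lin_comb K A; field.
Qed.

End Series.
End Currents.

(** * Serre sums with one factor replaced by a coefficient of a series *)

Section CurrentInsertion.
Variable K : fieldType.

Section Insertion.
Variables (q : K) (A : algType K).

(** The derivative of x^n in the direction p. *)
Definition ins (x p : A) (n : nat) : A := \sum_(i < n) x ^+ i * p * x ^+ (n.-1 - i).

(* The q-Serre sum in which one of the factors [x], resp. the factor [f], is
   replaced by [p]. *)
Definition serre_ins_x (s : nat) (x f p : A) : A :=
  \sum_(k < s.+1) ((-1) ^+ k * gbin q s k) *: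
    (ins x p k * f * x ^+ (s - k) + x ^+ k * f * ins x p (s - k)).

Definition serre_ins_f (s : nat) (x p : A) : A :=
  \sum_(k < s.+1) ((-1) ^+ k * gbin q s k) *: (x ^+ k * p * x ^+ (s - k)).

Lemma insP x (k : K) p p' n : ins x (k *: p + p') n = k *: ins x p n + ins x p' n.
Proof.
rewrite /ins scaler_sumr -big_split; apply: eq_bigr => i _.
by rewrite mulr_linr mulrDl -scalerAl.
Qed.

Lemma serre_ins_xP s x f (k : K) p p' :
  serre_ins_x s x f (k *: p + p') = k *: serre_ins_x s x f p + serre_ins_x s x f p'.
Proof.
rewrite /serre_ins_x scaler_sumr -big_split; apply: eq_bigr => i _.
by rewrite !insP /=; expand; lin_comb K A; ring.
Qed.

Lemma serre_ins_fP s x (k : K) p p' :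
  serre_ins_f s x (k *: p + p') = k *: serre_ins_f s x p + serre_ins_f s x p'.
Proof.
rewrite /serre_ins_f scaler_sumr -big_split; apply: eq_bigr => i _ /=.
by rewrite mulr_linr mulrDl -scalerAl scalerDr !scalerA [k * _]mulrC.
Qed.

Lemma ins_central x y p n : x * y = y * x -> ins x (y * p) n = y * ins x p n.
Proof.
move=> xy; rewrite /ins mulr_sumr; apply: eq_bigr => i _.
by rewrite !mulrA (commrX i (esym xy : GRing.comm y x)).
Qed.

Lemma serre_ins_x_central s x f y p : x * y = y * x -> f * y = y * f ->
  serre_ins_x s x f (y * p) = y * serre_ins_x s x f p.
Proof.
move=> xy fy; rewrite /serre_ins_x mulr_sumr; apply: eq_bigr => k _.
rewrite !ins_central // -scalerAr mulrDr !mulrA; congr (_ *: (_ + _ * _)).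
by rewrite -!mulrA fy !mulrA (commrX k (esym xy : GRing.comm y x)).
Qed.

Lemma serre_ins_f_central s x y p : x * y = y * x ->
  serre_ins_f s x (y * p) = y * serre_ins_f s x p.
Proof.
move=> xy; rewrite /serre_ins_f mulr_sumr; apply: eq_bigr => k _.
by rewrite -scalerAr !mulrA (commrX k (esym xy : GRing.comm y x)).
Qed.

Lemma intertwineX (x x' p : A) n : x * p = p * x' -> x ^+ n * p = p * x' ^+ n.
Proof.
move=> xp; elim: n => [|n IH]; first by rewrite !expr0 mul1r mulr1.
by rewrite exprSr -mulrA xp mulrA IH exprSr mulrA.
Qed.

Lemma ins_intertwine (x x' p : A) n : x * p = p * x' ->
  ins x p n = p * hsum x' x n.
Proof.
move=> xp; rewrite /ins /hsum mulr_sumr; apply: eq_bigr => i _.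
by rewrite (intertwineX _ xp) mulrA.
Qed.

End Insertion.

Lemma leads_ins (A : algType K) (x p : endo (series_nz A)) x' p' n :
  leads x x' -> leads p p' -> leads (ins x p n) (ins x' p' n).
Proof.
move=> xx pp; apply: leads_sum => i.
by apply: leadsM; [apply: leadsM => //|]; apply: leadsX.
Qed.

Lemma leads_serre_ins_x (A : algType K) q s (x f p : endo (series_nz A)) x' f' p' :
  leads x x' -> leads f f' -> leads p p' ->
  leads (serre_ins_x q s x f p) (serre_ins_x q s x' f' p').
Proof.
move=> xx ff pp; apply: leads_sum => k; apply: leadsZ; apply: leadsD.
  apply: leadsM; last exact: leadsX.
  by apply: leadsM => //; apply: leads_ins.
by apply: leadsM; [apply: leadsM => //; apply: leadsX|apply: leads_ins].
Qed.

Lemma leads_serre_ins_f (A : algType K) q s (x p : endo (series_nz A)) x' p' :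
  leads x x' -> leads p p' ->
  leads (serre_ins_f q s x p) (serre_ins_f q s x' p').
Proof.
move=> xx pp; apply: leads_sum => k; apply: leadsZ.
by apply: leadsM; [apply: leadsM => //|]; apply: leadsX.
Qed.

Lemma abstract_e10 (A E : algType K) (s : {lrmorphism A -> E}) (Y : E)
    (sY : forall a, s a * Y = Y * s a) (k : K) (x y : A) :
  y * x = k *: (x * y) -> Y * s y * s x = k *: (s x * (Y * s y)).
Proof.
by move=> yx; rewrite [s x * _]mulrA sY -!mulrA -!rmorphM yx /= linearZ /= scalerAr.
Qed.

Lemma abstract_e1f0 (A E : algType K) (s : {lrmorphism A -> E}) (Y : E)
    (sY : forall a, s a * Y = Y * s a) (k : K) (x f : int -> A) : exch k x f ->
  Y * s (x (0 + 1)) * s (f 0) - k *: (s (x 0) * (Y * s (f (0 + 1)))) =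
  k *: (s (f 0) * (Y * s (x (0 + 1)))) - Y * s (f (0 + 1)) * s (x 0).
Proof.
move=> /(_ 0 0) xf.
have sB u v : s (u - k *: v) = s u - k *: s v by rewrite raddfB /= linearZ.
have sB' u v : s (k *: u - v) = k *: s u - s v by rewrite raddfB /= linearZ.
transitivity (Y * s (x (0 + 1) * f 0 - k *: (x 0 * f (0 + 1)))).
  by rewrite sB !rmorphM mulrBr -scalerAr !mulrA sY.
transitivity (Y * s (k *: (f 0 * x (0 + 1)) - f (0 + 1) * x 0)).
  congr (Y * s _); apply/eqP; rewrite -subr_eq0; apply/eqP.
  move/eqP: xf; rewrite -subr_eq0 => /eqP xf; rewrite -[RHS]xf.
  by lin_comb K A; ring.
by rewrite sB' !rmorphM mulrBr -scalerAr !mulrA sY.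
Qed.

Section SerreCurrents.
Variable q : K.
Hypothesis q_gen : forall m : nat, (0 < m)%N -> q ^+ m != 1.
Hypothesis q0 : q != 0.
Hypothesis two0 : 2%:R != 0 :> K.
Variable N : nat.

(** At indices (0, 0) the two sides of the exchange relation are opposite, so the relation is twice
    the claim. *)
Lemma exch_self (A : algType K) (x : int -> A) :
  exch (q ^+ 2) x x -> x (0 + 1) * x 0 = q ^+ 2 *: (x 0 * x (0 + 1)).
Proof.
move=> /(_ 0 0) => xx; apply: (scalerI two0).
rewrite [LHS]scaler_nat [RHS]scaler_nat !mulr2n.
by apply/eqP; rewrite -subr_eq0 opprD addrACA xx -{2}[q ^+ 2 *: _ - _]opprB xx subrr.
Qed.

Section Step.
Variables (A : algType K) (x f p : int -> A).
Hypothesis xx : exch (q ^+ 2) x x.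
Hypothesis xf : exch (q ^- N) x f.
Hypothesis px : exch (q ^+ 2) p x.
Hypothesis pf : exch (q ^- N) p f.

Local Notation Y := (@series_shift K A).
Local Notation s := (@series_const K A).
Local Notation P m := (series_of (fun i : nat => p (m + i%:Z))).
Local Notation b := (twist (q ^- 2) x 0).
Local Notation bj := (twist (q ^- N)^-1 f 0).

(** By [twist_series] the series can be pulled out to the left of every term; what remains is the
    sum of [qlin_hsum_sum]. *)
Lemma serre_ins_x_series m : p (m - 1) = 0 -> serre_ins_x q N.+1 b bj (P m) = 0.
Proof.
move=> pm.
have bP : b * P m = P m * (q ^- 2 *: twist (q ^+ 2) x 0).
  by apply: twist_series => //; rewrite expf_neq0.
have bjP : bj * P m = P m * ((q ^- N)^-1 *: twist (q ^- N) f 0).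
  by apply: twist_series => //; rewrite invr_eq0 expf_neq0.
have e10 : Y * s (x (0 + 1)) * s (x 0) = q ^+ 2 *: (s (x 0) * (Y * s (x (0 + 1)))).
  exact: (abstract_e10 (s := @series_const K A) (@series_const_shift K A) (exch_self xx)).
have e1f0 := abstract_e1f0 (s := @series_const K A) (@series_const_shift K A) xf.
rewrite /serre_ins_x; rewrite -[RHS](mulr0 (P m)).
rewrite -[in RHS](qlin_hsum_sum q_gen q0 e10 e1f0) mulr_sumr.
apply: eq_bigr => k _; rewrite -scalerAr; congr (_ *: _).
rewrite !(ins_intertwine _ bP) [RHS]mulrDr; congr (_ + _).
  by rewrite !mulrA.
rewrite mulrA -[_ * bj * P m]mulrA bjP mulrA (intertwineX k bP) !mulrA.
by [].
Qed.

Lemma serre_ins_f_series m : p (m - 1) = 0 -> exch (q ^- N) p x ->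
  serre_ins_f q N.+1 (twist (q ^- N)^-1 x 0) (P m) = 0.
Proof.
move=> pm px'.
have bP : twist (q ^- N)^-1 x 0 * P m =
    P m * ((q ^- N)^-1 *: twist (q ^- N) x 0).
  by apply: twist_series => //; rewrite invr_eq0 expf_neq0.
have e10 : Y * s (x (0 + 1)) * s (x 0) = q ^+ 2 *: (s (x 0) * (Y * s (x (0 + 1)))).
  exact: (abstract_e10 (s := @series_const K A) (@series_const_shift K A) (exch_self xx)).
rewrite /serre_ins_f -[RHS](mulr0 (P m)).
rewrite -[in RHS](qlin_insert_sum q0 e10 N) mulr_sumr.
apply: eq_bigr => k _; rewrite -scalerAr; congr (_ *: _).
by rewrite (intertwineX k bP) -mulrA invrK.
Qed.

End Step.

(* Replacing [x] and [f] by the currents x_n - t Y x_(n+1), for a central nilpotent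
   Y, and [p] by the truncated generating series of the p_j gives currents to which
   the quantum plane identities apply; the coefficient of p_m is the claim. *)
Lemma serre_ins_x_eq0 (m : nat) (A : algType K) (x f p : int -> A) :
  exch (q ^+ 2) x x -> exch (q ^- N) x f -> exch (q ^+ 2) p x ->
  exch (q ^- N) p f -> (forall j, j < 0 -> p j = 0) ->
  serre_ins_x q N.+1 (x 0) (f 0) (p m%:Z) = 0.
Proof.
(* The algebra is generalized: the induction hypothesis is used over the algebra of operators on
   series, for twisted currents. *)
elim/ltn_ind: m A x f p => m IH A x f p xx xf px pf p0.
pose Y := @series_shift K A; pose s := @series_const K A.
pose P (j : nat) := series_of (fun i : nat => p (j%:Z + i%:Z)).
pose b := twist (q ^- 2) x 0; pose bj := twist (q ^- N)^-1 f 0.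
suff Pj j : (j <= m)%N -> serre_ins_x q N.+1 b bj (P j) = 0.
  have lP : leads (P m) (p m%:Z).
    by have := leads_series (fun i : nat => p (m%:Z + i%:Z)); rewrite addr0.
  have := leads_serre_ins_x q N.+1 (leads_twist (q ^- 2) x 0)
    (leads_twist (q ^- N)^-1 f 0) lP.
  by rewrite Pj // => /leads_inj; apply; exact: leads0.
elim: j => [_|j IHj jm].
  by apply: serre_ins_x_series => //; apply: p0.
(* Only P_0 satisfies p_(m-1) = 0 by assumption. The others follow from Y P_(j+1) = P_j - p_j: the
   constant p_j contributes nothing by the outer induction, and Y can be cancelled. *)
apply: series_shift_inj.
rewrite -serre_ins_x_central; [|exact: twist_shift|exact: twist_shift].
have -> : Y * P j.+1 = -1 *: s (p j%:Z) + P j.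
  rewrite [P j]series_of_recl addr0 scaleN1r addKr; congr (Y * series_of _).
  by apply/funext => i /=; rewrite -addn1 -[(i.+1)]addn1 !PoszD -!addrA [1 + _]addrC.
rewrite serre_ins_xP IHj ?(ltnW jm) // addr0.
(* Constants are written as a twist with parameter 0, so that [exch_twist] applies to them too. *)
pose tw (u : int -> A) k := s (u k) - 0 *: (Y * s (u (k + 1))).
have twE u k : tw u k = s (u k) by rewrite /tw scale0r subr0.
have := IH j jm _ (twist (q ^- 2) x) (twist (q ^- N)^-1 f) (tw p).
rewrite twE => -> //; first by rewrite scaler0.
- exact: exch_twist.
- exact: exch_twist.
- exact: exch_twist.
- exact: exch_twist.
- by move=> k k0; rewrite twE p0 // /s linear0.
Qed.

(** The same double induction as for [serre_ins_x_eq0]; the identity behind it is [qlin_insert_sum],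
    which needs the twist parameter q^N for x itself. *)
Lemma serre_ins_f_eq0 (m : nat) (A : algType K) (x p : int -> A) :
  exch (q ^+ 2) x x -> exch (q ^- N) p x -> (forall j, j < 0 -> p j = 0) ->
  serre_ins_f q N.+1 (x 0) (p m%:Z) = 0.
Proof.
elim/ltn_ind: m A x p => m IH A x p xx px p0.
pose Y := @series_shift K A; pose s := @series_const K A.
pose P (j : nat) := series_of (fun i : nat => p (j%:Z + i%:Z)).
pose b := twist (q ^- N)^-1 x 0.
suff Pj j : (j <= m)%N -> serre_ins_f q N.+1 b (P j) = 0.
  have lP : leads (P m) (p m%:Z).
    by have := leads_series (fun i : nat => p (m%:Z + i%:Z)); rewrite addr0.
  have := leads_serre_ins_f q N.+1 (leads_twist (q ^- N)^-1 x 0) lP.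
  by rewrite Pj // => /leads_inj; apply; exact: leads0.
elim: j => [_|j IHj jm].
  by apply: serre_ins_f_series => //; apply: p0.
apply: series_shift_inj.
rewrite -serre_ins_f_central; last exact: twist_shift.
have -> : Y * P j.+1 = -1 *: s (p j%:Z) + P j.
  rewrite [P j]series_of_recl addr0 scaleN1r addKr; congr (Y * series_of _).
  by apply/funext => i /=; rewrite -addn1 -[(i.+1)]addn1 !PoszD -!addrA [1 + _]addrC.
rewrite serre_ins_fP IHj ?(ltnW jm) // addr0.
pose tw (u : int -> A) k := s (u k) - 0 *: (Y * s (u (k + 1))).
have twE u k : tw u k = s (u k) by rewrite /tw scale0r subr0.
have := IH j jm _ (twist (q ^- N)^-1 x) (tw p).
rewrite twE => -> //; first by rewrite scaler0.
- exact: exch_twist.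
- exact: exch_twist.
- by move=> k k0; rewrite twE p0 // /s linear0.
Qed.

End SerreCurrents.

End CurrentInsertion.

(** * The symmetry m -> -m, q -> q^-1, for series supported in nonpositive degrees *)

Section Reflection.
Variable K : fieldType.

Lemma qint_inv (q : K) m : qint q^-1 m = qint q m.
Proof.
rewrite /qint !exprz_inv opprK invrK -[X in X / _]opprB -[X in _ / X]opprB.
by rewrite invrN mulrNN.
Qed.

Lemma gbin_inv (q : K) n k : (forall m : nat, (0 < m)%N -> q ^+ m != 1) ->
  q != 0 -> (k <= n)%N -> gbin q^-1 n k = gbin q n k.
Proof.
move=> q_gen q0 kn.
have qV_gen m : (0 < m)%N -> q^-1 ^+ m != 1.
  by move=> /q_gen; apply: contra; rewrite exprVn invr_eq1.
rewrite -!qbinE ?invr_eq0 // /qbin /qfact.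
have fE l : \prod_(1 <= i < l.+1) qint q^-1 i%:Z = \prod_(1 <= i < l.+1) qint q i%:Z.
  by apply: eq_bigr => i _; rewrite qint_inv.
by rewrite !fE.
Qed.

Variables (q : K) (N : nat).
Hypothesis q_gen : forall m : nat, (0 < m)%N -> q ^+ m != 1.
Hypothesis q0 : q != 0.
Hypothesis two0 : 2%:R != 0 :> K.

Lemma exch_opp (A : algType K) (a : K) (p x : int -> A) : a != 0 ->
  exch a p x -> exch a^-1 (p \o -%R) (x \o -%R).
Proof.
move=> a0 px m r /=.
have := px (- m - 1) (- r - 1); rewrite !subrK -!opprD => pxr.
have -> : p (- (m + 1)) * x (- r) = a^-1 *: (a *: (p (- (m + 1)) * x (- r))).
  by rewrite scalerA mulVf // scale1r.
have -> : x (- (r + 1)) * p (- m) = a^-1 *: (a *: (x (- (r + 1)) * p (- m))).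
  by rewrite scalerA mulVf // scale1r.
rewrite -!scalerBr; congr (_ *: _).
by rewrite -[LHS]pxr.
Qed.

Lemma serre_ins_x_inv (A : algType K) s (x f p : A) :
  serre_ins_x q^-1 s x f p = serre_ins_x q s x f p.
Proof.
apply: eq_bigr => k _; rewrite gbin_inv //.
by rewrite -ltnS.
Qed.

Lemma serre_ins_f_inv (A : algType K) s (x p : A) :
  serre_ins_f q^-1 s x p = serre_ins_f q s x p.
Proof.
apply: eq_bigr => k _; rewrite gbin_inv //.
by rewrite -ltnS.
Qed.

Definition one_sided (V : zmodType) (p : int -> V) : Prop :=
  (forall j, j < 0 -> p j = 0) \/ (forall j, 0 < j -> p j = 0).

Let qV_gen (m : nat) : (0 < m)%N -> q^-1 ^+ m != 1.
Proof. by move=> /q_gen; apply: contra; rewrite exprVn invr_eq1. Qed.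

Lemma serre_ins_x_vanish (A : algType K) (x f p : int -> A) j : one_sided p ->
  exch (q ^+ 2) x x -> exch (q ^- N) x f -> exch (q ^+ 2) p x ->
  exch (q ^- N) p f -> serre_ins_x q N.+1 (x 0) (f 0) (p j) = 0.
Proof.
have ins0 : serre_ins_x q N.+1 (x 0) (f 0) 0 = 0.
  exact: linear_fun0 (serre_ins_xP _ _ _ _).
move=> [p0|p0] xx xf px pf.
  case: j => j; first exact: serre_ins_x_eq0.
  by rewrite p0.
have [/p0 ->//|] := ltP 0 j; rewrite -oppr_ge0; case jE : (- j) => [k|//] _.
rewrite -[j]opprK jE -serre_ins_x_inv -oppr0.
have q20 : q ^+ 2 != 0 by rewrite expf_neq0.
have qN0 : q ^- N != 0 by rewrite invr_eq0 expf_neq0.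
apply: (@serre_ins_x_eq0 K q^-1 qV_gen _ two0 N k A (x \o -%R) (f \o -%R) (p \o -%R));
  rewrite ?invr_eq0 ?exprVn //; try exact: exch_opp.
by move=> i i0; apply: p0; rewrite oppr_gt0.
Qed.

Lemma serre_ins_f_vanish (A : algType K) (x p : int -> A) j : one_sided p ->
  exch (q ^+ 2) x x -> exch (q ^- N) p x -> serre_ins_f q N.+1 (x 0) (p j) = 0.
Proof.
have ins0 : serre_ins_f q N.+1 (x 0) 0 = 0.
  exact: linear_fun0 (serre_ins_fP _ _ _).
move=> [p0|p0] xx px.
  case: j => j; first exact: serre_ins_f_eq0.
  by rewrite p0.
have [/p0 ->//|] := ltP 0 j; rewrite -oppr_ge0; case jE : (- j) => [k|//] _.
rewrite -[j]opprK jE -serre_ins_f_inv -oppr0.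
have q20 : q ^+ 2 != 0 by rewrite expf_neq0.
have qN0 : q ^- N != 0 by rewrite invr_eq0 expf_neq0.
apply: (@serre_ins_f_eq0 K q^-1 _ two0 N k A (x \o -%R) (p \o -%R));
  rewrite ?invr_eq0 ?exprVn //; try exact: exch_opp.
by move=> i i0; apply: p0; rewrite oppr_gt0.
Qed.

End Reflection.

(** * Polarization of the Serre relations *)

Section Polarization.
Variables (K : fieldType) (A : algType K).

Definition serre_word (s l : nat) (X : 'I_s -> A) (g : A) : A :=
  (\prod_(t < s | (t < l)%N) X t) * g * (\prod_(t < s | (l <= t)%N) X t).

(** The inserted g is absorbed into the factor at position l, or stands at the end if l = s, so that
    [polarization] sees a single product. *)
Lemma serre_wordE s l (X : 'I_s -> A) g : (l <= s)%N ->
  serre_word l X g =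
  (\prod_(t < s) ((if t == l :> nat then g else 1) * X t)) *
  (if l == s :> nat then g else 1).
Proof.
elim: s X => [|s IH] X ls.
  by move: ls; rewrite leqn0 => /eqP ->; rewrite /serre_word !big_ord0 !mul1r mulr1.
move: ls; rewrite leq_eqVlt ltnS => /predU1P[lE|ls].
  rewrite /serre_word lE eqxx [X in _ * _ * X]big1 ?mulr1; last first.
    by move=> t; rewrite leqNgt ltn_ord.
  congr (_ * _); apply: eq_big => [t|t _]; first by rewrite ltn_ord.
  by rewrite (ltn_eqF (ltn_ord t)) mul1r.
rewrite (ltn_eqF (ls : (l < s.+1)%N)) mulr1 big_ord_recr /=.
rewrite [s == l]eq_sym mulrA -IH // /serre_word.
rewrite big_mkcond big_ord_recr /= ltnNge ls mulr1.
rewrite [X in _ * X = _]big_mkcond big_ord_recr /= ls mulrA.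
by rewrite -!big_mkcond.
Qed.

Lemma serre_word_const s l (x g : A) : (l <= s)%N ->
  serre_word l (fun _ : 'I_s => x) g = x ^+ l * g * x ^+ (s - l).
Proof.
move=> ls; rewrite serre_wordE //.
elim: s ls => [|s IH]; first by rewrite leqn0 => /eqP ->; rewrite big_ord0 mul1r mulr1.
rewrite leq_eqVlt ltnS => /predU1P[->|ls].
  rewrite eqxx subnn mulr1; congr (_ * _).
  under eq_bigr => t _ do rewrite (ltn_eqF (ltn_ord t)) mul1r.
  by rewrite prodr_const card_ord.
rewrite (ltn_eqF (ls : (l < s.+1)%N)) mulr1 big_ord_recr /=.
by rewrite [s == l]eq_sym mulrA IH // subSn // exprSr mulrA.
Qed.

(** If some a is missing from I, then J and J with a added cancel in pairs. *)
Lemma sum_sign_supset s (I : {set 'I_s}) :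
  \sum_(J : {set 'I_s} | I \subset J) (-1) ^+ #|~: J| = (I == setT)%:R :> K.
Proof.
have [->|] := eqVneq I setT.
  rewrite (big_pred1 setT) => [|J]; last by rewrite subTset.
  by rewrite setCT cards0 expr0.
rewrite -subTset => /subsetPn [a _ aI].
rewrite (bigID (fun J : {set 'I_s} => a \in J)) /= addrC.
rewrite [X in _ + X](reindex_onto (fun J => a |: J) (fun J => J :\ a)) /=; last first.
  by move=> J /andP[_ aJ]; rewrite setD1K.
rewrite [X in _ + X](eq_bigl (fun J : {set 'I_s} => (I \subset J) && (a \notin J))).
  rewrite -big_split big1 // => J /andP[_ aJ].
  rewrite [in RHS]/=.
  have -> : ~: J = a |: ~: (a |: J).
    by apply/setP => b; rewrite !inE; case: eqVneq => // ->.
  by rewrite cardsU1 !inE eqxx /= exprS mulN1r addNr.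
move=> J; rewrite setU11 andbT; have [aJ|aJ] := boolP (a \in J).
  rewrite andbF; apply/negbTE; rewrite negb_and; apply/orP; right.
  by apply/eqP => /setP/(_ a); rewrite !inE eqxx aJ.
rewrite andbT setU1K // eqxx andbT; apply/idP/idP => [/subsetP IJ|IJ].
  apply/subsetP => b bI; have := IJ b bI; rewrite !inE => /predU1P[ba|//].
  by rewrite ba (negbTE aI) in bI.
exact: subset_trans (subsetUr _ _).
Qed.

(** Expanding the products on the right gives words indexed by maps f; inclusion-exclusion over the
    sets J containing the image of f keeps the surjective ones, that is, the permutations. *)
Lemma polarization s (u : 'I_s -> A) (z : A) (X : 'I_s -> A) :
  (\sum_(w : 'S_s) \prod_t (u t * X (w t))) * z =
  \sum_(J : {set 'I_s}) (-1) ^+ #|~: J| *: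
    ((\prod_t (u t * \sum_(a in J) X a)) * z).
Proof.
pose T (f : {ffun 'I_s -> 'I_s}) := (\prod_t (u t * X (f t))) * z.
rewrite mulr_suml.
transitivity (\sum_(f : {ffun 'I_s -> 'I_s}) (f @: setT == setT)%:R *: T f).
  rewrite (bigID (fun f : {ffun 'I_s -> 'I_s} => injectiveb f)) /=.
  rewrite [RHS]addrC [X in _ = X + _]big1.
    rewrite add0r (reindex (fun w : 'S_s => pval w)) /=; last first.
      exists (fun f => insubd (1%g : 'S_s) f) => [w _|f /= fi].
        by apply: val_inj; rewrite insubdK //; exact: (valP w).
      by rewrite insubdK.
    apply: eq_big => [w|w _]; first by rewrite (valP w).
    rewrite (_ : _ == _) ?scale1r; last first.
      rewrite eqEcard subsetT /= card_imset ?cardsT //.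
      by apply/injectiveP; exact: (valP w).
    by rewrite /T; congr (_ * _); apply: eq_bigr => t _; rewrite pvalE.
  move=> f fi; rewrite (_ : _ == _ = false) ?scale0r //.
  apply/negbTE; apply: contra fi => /eqP fT; apply/injectiveP.
  have /imset_injP fi : #|f @: setT| == #|[set: 'I_s]| by rewrite fT.
  by move=> x y; apply: fi; rewrite inE.
under [RHS]eq_bigr => J _.
  under eq_bigr => t _ do rewrite mulr_sumr.
  rewrite bigA_distr_big mulr_suml scaler_sumr.
  over.
rewrite (exchange_big_dep xpredT) //=; apply: eq_bigr => f _.
rewrite -scaler_suml; congr (_ *: _); rewrite -sum_sign_supset.
apply: eq_bigl => J; apply/subsetP/ffun_onP => [fJ x|fJ y /imsetP[x _ ->]].
  by apply: fJ; rewrite imset_f.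
exact: fJ.
Qed.

Variable q : K.

Definition serre_sym (s : nat) (X : 'I_s -> A) (g : A) : A :=
  \sum_(w : 'S_s) \sum_(l < s.+1) ((-1) ^+ l * qbin q s l) *:
    serre_word l (fun t => X (w t)) g.

Definition serre_pow (s : nat) (x g : A) : A :=
  \sum_(l < s.+1) ((-1) ^+ l * qbin q s l) *: (x ^+ l * g * x ^+ (s - l)).

(** Reduces the symmetrized Serre sum to powers of one element, a sum of some of the X_a, which is
    again a value of a current. *)
Lemma serre_symE s (X : 'I_s -> A) g :
  serre_sym X g =
  \sum_(J : {set 'I_s}) (-1) ^+ #|~: J| *: serre_pow s (\sum_(a in J) X a) g.
Proof.
rewrite /serre_sym exchange_big /=.
under [RHS]eq_bigr => J _ do rewrite scaler_sumr.
rewrite [RHS]exchange_big; apply: eq_bigr => l _ /=.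
have ls : (l <= s)%N by rewrite -ltnS.
rewrite -scaler_sumr.
rewrite (eq_bigr _ (fun (w : 'S_s) _ => serre_wordE (fun t => X (w t)) g ls)).
rewrite -mulr_suml polarization scaler_sumr; apply: eq_bigr => J _.
rewrite !scalerA mulrC; congr (_ *: _).
by rewrite -serre_word_const // serre_wordE.
Qed.

End Polarization.

(** * The exchange relation between phi and x *)

Section ExponentialExchange.
Variables (K : fieldType) (A : algType K).
Hypothesis char0 : forall n : nat, n.+1%:R != 0 :> K.

Section ExpCoef.
Variable H : nat -> A.
Hypothesis H0 : H 0 = 0.
Hypothesis HC : forall l m, H l * H m = H m * H l.

Definition exp_series (m : nat) : A :=
  \sum_(p < m.+1) (p`!%:R^-1 : K) *: ((\poly_(l < m.+1) H l) ^+ p)`_m.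

Let G n : {poly A} := \poly_(l < n.+1) H l.

(** Truncating higher does not change low coefficients; with [G_gt] this lets truncated exponentials
    of different orders be compared. *)
Let G_coef n p j : (j <= n)%N -> (G n ^+ p)`_j = (G j ^+ p)`_j.
Proof.
have GE n' n'' : forall j, (j <= n')%N -> (j <= n'')%N ->
    (G n' ^+ p)`_j = (G n'' ^+ p)`_j.
  elim: p => [|p IH] i i' i''; first by rewrite !expr0.
  rewrite !exprS !coefM; apply: eq_bigr => l _.
  have li : (l <= i)%N by rewrite -ltnS.
  rewrite !coef_poly !ltnS (leq_trans li i') (leq_trans li i'').
  by rewrite IH // (leq_trans (leq_subr _ _)).
by move=> jn; apply: GE.
Qed.

Let G_gt n p j : (j < p)%N -> (G n ^+ p)`_j = 0.
Proof.
elim: p j => [|p IH] j // jp; rewrite exprS coefM big1 // => -[[|l] /= lj] _.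
  by rewrite coef_poly /= H0 mul0r.
by rewrite IH ?mulr0 // ltn_subLR -1?ltnS //; lia.
Qed.

Let G_comm n : GRing.comm (G n) (G n)^`().
Proof.
apply/polyP => i; rewrite coefMr coefM; apply: eq_bigr => j _.
by rewrite coef_deriv !coef_poly; do 2!case: ifP => _;
  rewrite ?(mul0r, mulr0, mul0rn) // mulrnAl mulrnAr HC.
Qed.

Let G_deriv n p : (G n ^+ p.+1)^`() = ((G n)^`() * G n ^+ p) *+ p.+1.
Proof.
elim: p => [|p IH]; first by rewrite expr1 expr0 mulr1.
rewrite exprS derivM IH mulrnAr mulrA G_comm -mulrA -exprS.
by rewrite -mulrS.
Qed.

Let G_coef_deriv n p m :
  (G n ^+ p.+1)`_m.+1 *+ m.+1 =
  (\sum_(l < m.+1) (G n)`_l.+1 *+ l.+1 * (G n ^+ p)`_(m - l)) *+ p.+1.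
Proof.
rewrite -coef_deriv G_deriv coefMn coefM; congr (_ *+ _).
by apply: eq_bigr => l _; rewrite coef_deriv.
Qed.

Lemma exp_series0 : exp_series 0 = 1.
Proof. by rewrite /exp_series big_ord1 expr0 coef1 fact0 invr1 scale1r. Qed.

(** The coefficientwise form of (exp H)' = H' exp H, valid because the H_l commute. *)
Lemma exp_seriesS m : m.+1%:R *: exp_series m.+1 =
  \sum_(l < m.+1) l.+1%:R *: (H l.+1 * exp_series (m - l)).
Proof.
rewrite /exp_series big_ord_recl expr0 coef1 scaler0 add0r scaler_sumr.
transitivity (\sum_(p < m.+1) \sum_(l < m.+1)
  (p`!%:R^-1 : K) *: (l.+1%:R *: (H l.+1 * (G (m - l) ^+ p)`_(m - l)))).
  apply: eq_bigr => p _; rewrite lift0 -scaler_sumr.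
  rewrite scalerA mulrC -scalerA scaler_nat G_coef_deriv.
  rewrite -scaler_nat scalerA factS natrM invfM mulrAC mulVf // mul1r.
  congr (_ *: _); apply: eq_bigr => l _; rewrite coef_poly ltnS ltn_ord.
  rewrite scaler_nat mulrnAl; congr (_ * _ *+ _); apply: G_coef.
  exact: leq_trans (leq_subr _ _) (leqnSn _).
rewrite exchange_big; apply: eq_bigr => l _ /=.
rewrite mulr_sumr scaler_sumr.
under eq_bigr => p _ do rewrite scalerA mulrC -scalerA scalerAr.
rewrite -(big_mkord xpredT (fun p => l.+1%:R *: (H l.+1 *
  ((p`!%:R^-1 : K) *: (G (m - l) ^+ p)`_(m - l))))).
rewrite (big_cat_nat _ (n := (m - l).+1)) //=; last by rewrite ltnS leq_subr.
rewrite big_mkord [X in _ + X]big_nat_cond [X in _ + X]big1 ?addr0 //.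
by move=> p /andP[/andP[mp _] _]; rewrite G_gt // scaler0 mulr0 scaler0.
Qed.

End ExpCoef.

Section Exchange.
Variables (a : K) (H e : nat -> A) (x : int -> A).
Hypothesis a0 : a != 0.
Hypothesis e0 : e 0 = 1.
Hypothesis eS : forall m, m.+1%:R *: e m.+1 =
  \sum_(l < m.+1) l.+1%:R *: (H l.+1 * e (m - l)%N).
Hypothesis Hx : forall l r, l.+1%:R *: (H l.+1 * x r) =
  l.+1%:R *: (x r * H l.+1) + (a ^+ l.+1 - a ^- l.+1) *: x (r + l.+1%:Z).

Let sh m r l := x (r + l.+1%:Z) * e (m - l)%N.

Let L m r := e m.+1 * x r - a *: (e m * x (r + 1))
  - (x r * e m.+1 - a^-1 *: (x (r + 1) * e m)).

(** The relation L = 0, solved for its first term and applied repeatedly, moves x to the left of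
    e_m. *)
Let iter m r : (forall m' r', (m' < m)%N -> L m' r' = 0) ->
  e m * x (r + 1) = \sum_(l < m.+1) a ^+ l *: sh m r l
    - \sum_(l < m) (a^-1 * a ^+ l) *: sh m r l.+1.
Proof.
elim: m r => [|m IH] r L0.
  by rewrite big_ord0 subr0 big_ord1 expr0 scale1r /sh subn0 e0 mulr1 mul1r.
have := L0 m (r + 1) (ltnSn _); rewrite /L => /eqP.
rewrite subr_eq0 subr_eq => /eqP ->.
rewrite IH => [|m' r' m'm]; last by apply: L0; exact: ltnW.
rewrite [in RHS]big_ord_recl [X in _ = _ - X]big_ord_recl.
have shS l : sh m (r + 1) l = sh m.+1 r l.+1.
  by rewrite /sh subSS -addrA -intS.
under eq_bigr => l _ do rewrite shS.
under [X in _ + _ *: (_ - X)]eq_bigr => l _ do rewrite shS.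
rewrite scalerBr !scaler_sumr expr0 mulr1 scale1r.
under [X in _ = _ + X - _]eq_bigr => l _ do rewrite lift0 exprS -scalerA.
under [X in _ = _ - (_ + X)]eq_bigr => l _ do rewrite lift0 exprS mulrCA -scalerA.
have -> : x (r + 1) * e m.+1 = sh m.+1 r 0 by [].
have -> : x (r + 1 + 1) * e m = sh m.+1 r 1.
  by rewrite /sh subSS subn0 -addrA.
by rewrite opprD addrACA.
Qed.

(** Induction on m after multiplication by m+1, so that the recursion for e introduces H. Commuting
    H past x leaves shifted currents, which cancel against the expansion given by [iter]. *)
Lemma exp_exchange m r : e m.+1 * x r - a *: (e m * x (r + 1)) =
  x r * e m.+1 - a^-1 *: (x (r + 1) * e m).
Proof.
apply/eqP; rewrite -subr_eq0 -/(L m r); apply/eqP.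
elim/ltn_ind: m r => m IH r; apply: (scalerI (char0 m)); rewrite scaler0.
have eS' : m%:R *: e m = \sum_(l < m) l.+1%:R *: (H l.+1 * e (m - l.+1)%N).
  by case: m {IH} => [|m]; rewrite ?big_ord0 ?scale0r // eS.
have xHe (n l : nat) r' : l.+1%:R *: (x r' * (H l.+1 * e n)) =
    l.+1%:R *: (H l.+1 * (x r' * e n))
    - (a ^+ l.+1 - a ^- l.+1) *: (x (r' + l.+1%:Z) * e n).
  have /(congr1 ( *%R^~ (e n))) := Hx l r'.
  rewrite mulrDl -!scalerAl -!mulrA => ->.
  by rewrite addrK.
pose S1 := \sum_(l < m.+1) l.+1%:R *: (H l.+1 * (e (m - l)%N * x r)).
pose S2 := \sum_(l < m.+1) l.+1%:R *: (H l.+1 * (x r * e (m - l)%N)).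
pose S3 := \sum_(l < m) l.+1%:R *: (H l.+1 * (e (m - l.+1)%N * x (r + 1))).
pose S4 := \sum_(l < m) l.+1%:R *: (H l.+1 * (x (r + 1) * e (m - l.+1)%N)).
pose U0 := \sum_(l < m.+1) a ^+ l *: sh m r l.
pose U1 := \sum_(l < m) a ^+ l *: sh m r l.+1.
pose Q := \sum_(l < m) a ^- l.+1 *: sh m r l.+1.
have E1 : m.+1%:R *: (e m.+1 * x r) = S1.
  rewrite scalerAl eS mulr_suml; apply: eq_bigr => l _.
  by rewrite -scalerAl mulrA.
have E2 : m.+1%:R *: (x r * e m.+1) =
    S2 - (a *: U0 - a^-1 *: sh m r 0 - a^-1 *: Q).
  rewrite scalerAr eS mulr_sumr.
  under eq_bigr => l _ do rewrite -scalerAr xHe scalerBl opprB.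
  have P : \sum_(l < m.+1) a ^- l.+1 *: sh m r l = a^-1 *: sh m r 0 + a^-1 *: Q.
    rewrite big_ord_recl expr1; congr (_ + _); rewrite scaler_sumr.
    by apply: eq_bigr => l _; rewrite lift0 exprS invfM scalerA.
  have P' : \sum_(l < m.+1) a ^+ l.+1 *: sh m r l = a *: U0.
    by rewrite scaler_sumr; apply: eq_bigr => l _; rewrite exprS -scalerA.
  rewrite big_split /=; congr (_ + _); rewrite sumrB P P'.
  by move: (sh m r 0) (Q) (U0) => u v w; lin_comb K A; ring.
have E3 : m%:R *: (e m * x (r + 1)) = S3.
  rewrite scalerAl eS' mulr_suml; apply: eq_bigr => l _.
  by rewrite -scalerAl mulrA.
have E4 : m%:R *: (x (r + 1) * e m) = S4 - (a *: U1 - Q).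
  rewrite scalerAr eS' mulr_sumr.
  under eq_bigr => l _ do rewrite -scalerAr xHe scalerBl opprB.
  rewrite big_split /=; congr (_ + _); rewrite sumrB opprB; congr (_ - _).
    by apply: eq_bigr => l _; rewrite /sh -addrA -intS.
  rewrite scaler_sumr; apply: eq_bigr => l _.
  by rewrite /sh -addrA -intS exprS -scalerA.
(* A combination of the H_(l+1) L(m-l-1, r), zero by induction; the two top terms cancel since e_0 =
   1. *)
have E5 : S1 - S2 - a *: S3 + a^-1 *: S4 = 0.
  rewrite /S1 /S2 !big_ord_recr /= subnn e0 mulr1 mul1r opprD addrACA subrr addr0.
  rewrite !scaler_sumr -!sumrB -big_split big1 // => l _ /=.
  have lm := ltn_ord l; have jE : (m - l.+1).+1 = (m - l)%N by rewrite subnSK.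
  have jm : (m - l.+1 < m)%N by lia.
  rewrite -[RHS](scaler0 _ l.+1%:R) -(mulr0 (H l.+1)) -(IH _ jm r) /L jE.
  by expand; lin_comb K A; ring.
have E6 := iter r (fun m' r' mm' => IH m' mm' r').
(* The recursion weights e_m by m, not m+1; the extra copy of e_m x_(r+1) is the one that [iter]
   expands. *)
have mE (u : A) : m.+1%:R *: u = u + m%:R *: u by rewrite -natr1 scalerDl scale1r addrC.
rewrite /L scalerBr scalerBr [m.+1%:R *: (_ - a^-1 *: _)]scalerBr E1 E2.
rewrite !scalerA ![m.+1%:R * _]mulrC -!scalerA !mE E3 E4 E6.
have -> : x (r + 1) * e m = sh m r 0 by rewrite /sh subn0.
rewrite (_ : \sum_(l < m) _ = a^-1 *: U1); last first.
  by rewrite scaler_sumr; apply: eq_bigr => l _; rewrite scalerA.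
rewrite -/U0 -[RHS]E5; clear E1 E2 E3 E4 E5 E6.
move: (S1) (S2) (S3) (S4) (U0) (U1) (Q) (sh m r 0) => s1 s2 s3 s4 u0 u1 u2 u3.
by lin_comb K A; field.
Qed.

End Exchange.
End ExponentialExchange.

Lemma exp_series_exch (K : fieldType) (A : algType K) (a : K) (H : nat -> A)
    (x : int -> A) (k : A) : (forall n, n.+1%:R != 0 :> K) -> a != 0 ->
  H 0 = 0 -> (forall l m, H l * H m = H m * H l) ->
  (forall l r, l.+1%:R *: (H l.+1 * x r) =
    l.+1%:R *: (x r * H l.+1) + (a ^+ l.+1 - a ^- l.+1) *: x (r + l.+1%:Z)) ->
  (forall r, k * x r = a *: (x r * k)) ->
  exch a (fun m => if 0 <= m then k * exp_series H `|m|%N else 0) x.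
Proof.
move=> char0 a0 H0 HC Hx kx m r.
have ex := exp_exchange char0 a0 (exp_series0 H) (exp_seriesS char0 H0 HC) Hx.
case: m => [m|[|m]].
- have -> : Posz m + 1 = Posz m.+1 by rewrite -addn1.
  rewrite (_ : (0 <= Posz m.+1) = true) // (_ : (0 <= Posz m) = true) //.
  rewrite !absz_nat.
  have -> : a *: (x r * (k * exp_series H m.+1)) = k * (x r * exp_series H m.+1).
    by rewrite mulrA scalerAl -kx mulrA.
  rewrite -!mulrA -mulrBr.
  have -> : x (r + 1) * (k * exp_series H m) =
      k * (a^-1 *: (x (r + 1) * exp_series H m)).
    by rewrite -scalerAr mulrA [in RHS]mulrA kx -scalerAl scalerA mulVf // scale1r.
  rewrite scalerAr -mulrBr; congr (k * _).
  apply/eqP; rewrite -subr_eq0; apply/eqP.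
  have /eqP := ex m r; rewrite -subr_eq0 => /eqP <-.
  by lin_comb K A; ring.
(* At m = -1 only the coefficient of index 0 survives, and the relation reduces to that of k with
   x. *)
- rewrite (_ : Negz 0 + 1 = 0) // (_ : (0 <= Negz 0) = false) //.
  rewrite (_ : (0 <= 0 :> int) = true) // exp_series0 mulr1 kx subrr mul0r.
  by rewrite mulr0 scaler0 subr0.
- have -> : Negz m.+1 + 1 = Negz m by rewrite !NegzE -addn1 PoszD opprD addrNK.
  rewrite (_ : (0 <= Negz m.+1) = false) // (_ : (0 <= Negz m) = false) //.
  by rewrite !mul0r !mulr0 scaler0.
Qed.

Section ComplexExp.
Variable R : realType.

Lemma cexpD (z w : R[i]) : cexp (z + w) = cexp z * cexp w.
Proof.
case: z => a b; case: w => c d; rewrite /cexp /=.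
apply/eqP; rewrite eq_complex /=; apply/andP; split; apply/eqP.
  by rewrite expRD cosD; ring.
by rewrite expRD sinD; ring.
Qed.

Lemma cexp0 : cexp (0 : R[i]) = 1.
Proof. by rewrite /cexp /= expR0 cos0 sin0 mulr1 mulr0. Qed.

Lemma cexp_neq0 (z : R[i]) : cexp z != 0.
Proof.
apply/eqP => z0; have := cexpD z (- z); rewrite subrr cexp0 z0 mul0r.
by move/eqP; rewrite oner_eq0.
Qed.

Lemma char0_complex n : n.+1%:R != 0 :> R[i].
Proof. by rewrite pnatr_eq0. Qed.

Variable D : quantum_datum R.

Lemma qpar_neq0 : qpar D != 0.
Proof. by rewrite -(qlogK D) cexp_neq0. Qed.

Lemma qpowD u v : qpow D (u + v) = qpow D u * qpow D v.
Proof. by rewrite /qpow rmorphD mulrDl cexpD. Qed.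

Lemma qpow0 : qpow D 0 = 1.
Proof. by rewrite /qpow rmorph0 mul0r cexp0. Qed.

Lemma qpow_neq0 u : qpow D u != 0.
Proof. exact: cexp_neq0. Qed.

Lemma qpow_nat (n : nat) : qpow D n%:R = qpar D ^+ n.
Proof.
elim: n => [|n IH]; first exact: qpow0.
by rewrite -natr1 qpowD IH exprSr /qpow rmorph1 mul1r qlogK.
Qed.

Lemma qpowN u : qpow D (- u) = (qpow D u)^-1.
Proof.
apply: (mulfI (qpow_neq0 u)); rewrite -qpowD subrr qpow0 mulfV //.
exact: qpow_neq0.
Qed.

Lemma qpow_int (n : int) : qpow D n%:~R = qpar D ^ n.
Proof.
case: n => n; first exact: qpow_nat.
by rewrite NegzE mulrNz qpowN -exprnN -[(n.+1)%:~R]/(n.+1%:R) qpow_nat.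
Qed.

End ComplexExp.

Lemma exch_pm (K : fieldType) (A : algType K) (v : K) (z : int) (e : bool)
    (p x : int -> A) : v != 0 ->
  exch (v ^ (pm e * z)) p (fun m => x (pm e * m)) ->
  exch (v ^ z) (fun m => p (pm e * m)) x.
Proof.
move=> v0; have vz : v ^ (pm false * z) != 0 by rewrite expfz_neq0.
case: e => px m r; first by have := px m r; rewrite /= !mul1r.
have := exch_opp vz px m r; rewrite /= !mulN1r !opprK.
by rewrite -invr_expz invrK.
Qed.

Section PhiExchange.
Variables (R : realType) (D : quantum_datum R) (A : algType R[i]).
Local Notation n := (rk D).
Local Notation q := (qpar D).
Variables (k : hh D -> A) (h : 'I_n -> int -> A).

(** The convention h_{i,0} = 0 is included so that commutation holds for all indices. *)
Definition cartan_ok : Prop :=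
  (forall a, cartan_rel k h a -> a = 0) /\ (forall i, h i 0 = 0).

Hypothesis kh : cartan_ok.

Lemma cartan_okD c c' : k c * k c' = k (c + c').
Proof. by apply/eqP; rewrite -subr_eq0; apply/eqP/(proj1 kh)/cartan_kk. Qed.

Lemma cartan_ok0 : k 0 = 1.
Proof. by apply/eqP; rewrite -subr_eq0; apply/eqP/(proj1 kh)/cartan_k0. Qed.

Lemma cartan_okNr c : k c * k (- c) = 1.
Proof. by rewrite cartan_okD subrr cartan_ok0. Qed.

Lemma cartan_okNl c : k (- c) * k c = 1.
Proof. by rewrite cartan_okD addNr cartan_ok0. Qed.

Lemma cartan_ok_kh c i m : k c * h i m = h i m * k c.
Proof.
have [->|m0] := eqVneq m 0; first by rewrite (proj2 kh) mulr0 mul0r.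
by apply/eqP; rewrite -subr_eq0; apply/eqP/(proj1 kh)/cartan_kh.
Qed.

Lemma cartan_ok_hh i j l m : h i l * h j m = h j m * h i l.
Proof.
have [->|m0] := eqVneq m 0; first by rewrite (proj2 kh) mulr0 mul0r.
have [->|l0] := eqVneq l 0; first by rewrite (proj2 kh) mulr0 mul0r.
by apply/eqP; rewrite -subr_eq0; apply/eqP/(proj1 kh)/cartan_hh.
Qed.

Variables (s : bool) (x : 'I_n -> int -> A).

Definition weight_ok : Prop := forall c j m,
  k c * x j m * k (- c) = qpow D ((pm s)%:~R * simple_root D j c) *: x j m.

Definition hx_ok : Prop := forall i j m m', m != 0 ->
  h i m * x j m' - x j m' * h i m =
  ((pm s)%:~R * (m%:~R^-1 * qint q (m * symB i j))) *: x j (m + m').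

Hypothesis kx : weight_ok.
Hypothesis hx : hx_ok.

Lemma weight_okE c j m :
  k c * x j m = qpow D ((pm s)%:~R * simple_root D j c) *: (x j m * k c).
Proof.
by rewrite scalerAl -kx -(mulrA _ (k (- c))) cartan_okNl mulr1.
Qed.

Lemma phi_one_sided e i : one_sided (fun m => phi k h e i m).
Proof.
case: e; [left|right] => m m0; rewrite /phi /pm.
  by rewrite mul1r leNgt m0.
by rewrite mulN1r oppr_ge0 leNgt m0.
Qed.

(** The factor q - q^-1 in phi cancels the denominator of the q-integer in (R3), leaving a^l - a^-l
    as [exp_series_exch] requires. The series phi^- runs through negative indices, so it is
    reflected first and restored by [exch_pm]. *)
Lemma phi_exch e i j :
  exch (q ^ (pm s * symB i j)) (fun m => phi k h e i m) (x j).
Proof.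
have q0 := qpar_neq0 D.
pose a := q ^ (pm s * (pm e * symB i j)).
have a0 : a != 0 by rewrite expfz_neq0.
pose H l : A := ((pm e)%:~R * (q - q^-1)) *: h i (pm e * l%:Z).
pose c := (simple_coroot D i *+ symmetrizer D i) *~ pm e.
pose y m := x j (pm e * m).
have H0 : H 0%N = 0 by rewrite /H mulr0 (proj2 kh) scaler0.
have HC l m : H l * H m = H m * H l.
  by rewrite /H -!scalerAl -!scalerAr cartan_ok_hh !scalerA mulrC.
have kc r : k c * y r = a *: (y r * k c).
  rewrite /y weight_okE; congr (_ *: _).
  rewrite /c raddfMz /= raddfMn /= simple_root_coroot.
  rewrite -[X in _ * X]mulrzl -[_ *+ _]mulr_natl /a /symB -qpow_int !intrM.
  by congr qpow.
have Hy l r : l.+1%:R *: (H l.+1 * y r) =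
    l.+1%:R *: (y r * H l.+1) + (a ^+ l.+1 - a ^- l.+1) *: y (r + l.+1%:Z).
  have l0 : pm e * l.+1%:Z != 0 by case: (e).
  have := hx i j (pm e * r) l0; rewrite -mulrDr [l.+1%:Z + r]addrC -/(y _).
  move/eqP; rewrite subr_eq => /eqP hxy.
  rewrite /H -scalerAl hxy -scalerAr 2!scalerDr [LHS]addrC; congr (_ + _).
  rewrite !scalerA; congr (_ *: _); pose b := q ^ (l.+1%:Z * symB i j).
  have b0 : b != 0 by rewrite expfz_neq0.
  have qE : qint q (pm e * l.+1%:Z * symB i j) =
      (pm e)%:~R * (b - b^-1) / (q - q^-1).
    rewrite /qint /b invr_expz; case: (e); first by rewrite !mul1r.
    by rewrite /pm -mulrA !mulN1r opprK -opprB.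
  have aE : a ^+ l.+1 - a ^- l.+1 = (pm s)%:~R * (pm e)%:~R * (b - b^-1).
    have -> : a ^+ l.+1 = b ^ (pm s * pm e).
      by rewrite /a /b exprnP !exprz_exp; congr (_ ^ _); ring.
    case: (s); case: (e); rewrite /pm ?(mul1r, mulN1r, mulrN1, opprK) //.
    - by rewrite -[in LHS]invr_expz expr1z invrK opprB.
    - by rewrite -[in LHS]invr_expz expr1z invrK opprB.
  rewrite aE qE intrM -[l.+1%:Z%:~R]/(l.+1%:R).
  have l0' := @char0_complex R l.
  have e0 : (pm e)%:~R != 0 :> R[i] by case: (e); rewrite ?oppr_eq0 oner_eq0.
  have := q_subV_neq0 (@qpar_not_root _ D) q0 => d0.
  set c1 := q - q^-1; set le := l.+1%:R.
  by field; rewrite b0 d0 e0 nat1r l0'.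
have := exp_series_exch (@char0_complex R) a0 H0 HC Hy kc; set P := fun m => _.
have phiE m : phi k h e i m = P (pm e * m).
  by rewrite /P /phi; congr (if _ then k _ * exp_series _ _ else 0); case: (e);
    rewrite /pm ?mul1r ?mulN1r ?abszN.
rewrite /y /a mulrCA => Py m r.
by have := exch_pm q0 Py m r; rewrite /= !phiE.
Qed.

End PhiExchange.

(** * Commutators of the relators *)

Section RelatorCommutators.
Variables (K : fieldType) (A : algType K).

Definition exch_elt (a : K) (p x : int -> A) (m r : int) : A :=
  p (m + 1) * x r - a *: (x r * p (m + 1))
  - (a *: (p m * x (r + 1)) - x (r + 1) * p m).

Lemma exch_eltP (a : K) (p x : int -> A) : exch a p x <-> forall m r, exch_elt a p x m r = 0.
Proof.
split=> px m r; first by rewrite /exch_elt px subrr.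
by apply/eqP; rewrite -subr_eq0; apply/eqP/px.
Qed.

(** The element is symmetric in its two currents, so facts about the first slot transfer to the
    second. *)
Lemma exch_elt_sym (a : K) (p x : int -> A) m r : exch_elt a x p m r = exch_elt a p x r m.
Proof. by rewrite /exch_elt; lin_comb K A; ring. Qed.

Lemma exch_sym (a : K) (p x : int -> A) : exch a p x -> exch a x p.
Proof. by move=> /exch_eltP px; apply/exch_eltP => m r; rewrite exch_elt_sym. Qed.

Lemma exch_eltZl (a c : K) (p x : int -> A) m r :
  exch_elt a (fun i => c *: p i) x m r = c *: exch_elt a p x m r.
Proof. by rewrite /exch_elt; expand; lin_comb K A; ring. Qed.

Lemma exch_elt_shift (a : K) (p x : int -> A) l m r :
  exch_elt a (fun i => p (i + l)) x m r = exch_elt a p x (m + l) r.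
Proof. by rewrite /exch_elt [m + l + 1]addrAC. Qed.

Lemma exch_shiftl (a : K) (p x : int -> A) l : exch a p x -> exch a (fun m => p (l + m)) x.
Proof. by move=> px m r; rewrite addrA px. Qed.

Lemma exch_shiftr (a : K) (p x : int -> A) l : exch a p x -> exch a p (fun m => x (l + m)).
Proof. by move=> /exch_sym /(exch_shiftl l) /exch_sym. Qed.

Lemma exch_suml I (r : seq I) (P : pred I) (a : K) (p : I -> int -> A) (x : int -> A) :
  (forall i, P i -> exch a (p i) x) -> exch a (fun m => \sum_(i <- r | P i) p i m) x.
Proof.
move=> px; apply/exch_eltP => m l.
rewrite (_ : exch_elt _ _ _ _ _ = \sum_(i <- r | P i) exch_elt a (p i) x m l).
  by rewrite big1 // => i Pi; have /exch_eltP := px i Pi; apply.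
rewrite /exch_elt !mulr_suml !mulr_sumr !scaler_sumr -!sumrB.
by apply: eq_bigr.
Qed.

Lemma exch_sumr I (r : seq I) (P : pred I) (a : K) (p : int -> A) (x : I -> int -> A) :
  (forall i, P i -> exch a p (x i)) -> exch a p (fun m => \sum_(i <- r | P i) x i m).
Proof.
by move=> px; apply/exch_sym/exch_suml => i Pi; apply/exch_sym/px.
Qed.

Lemma exch_elt_comm (a : K) (u v p p' : int -> A) y m r : (forall i, u i * y = y * u i + p i) ->
  (forall i, v i * y = y * v i + p' i) ->
  exch_elt a u v m r * y =
  y * exch_elt a u v m r + exch_elt a p v m r + exch_elt a u p' m r.
Proof.
move=> uy vy; rewrite /exch_elt; expand.
rewrite -!(mulrA _ _ y) uy vy uy vy; expand; rewrite !mulrA uy vy uy vy; expand.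
lin_comb K A; ring.
Qed.

Lemma exch_elt_scale (a c d : K) (u v : int -> A) k m r : (forall i, u i * k = c *: (k * u i)) ->
  (forall i, v i * k = d *: (k * v i)) ->
  exch_elt a u v m r * k = (c * d) *: (k * exch_elt a u v m r).
Proof.
move=> uk vk; rewrite /exch_elt; expand.
rewrite -!(mulrA _ _ k) uk vk uk vk; expand; rewrite !mulrA uk vk uk vk; expand.
lin_comb K A; ring.
Qed.

Lemma exprM_comm (x y p : A) n : x * y = y * x + p ->
  x ^+ n * y = y * x ^+ n + ins x p n.
Proof.
move=> xy; elim: n => [|n IH]; first by rewrite /ins big_ord0 !expr0 mulr1 mul1r addr0.
rewrite exprS -mulrA IH mulrDr mulrA xy mulrDl -!mulrA -addrA; congr (_ + _).
rewrite /ins big_ord_recl expr0 mul1r subn0 mulr_sumr /=; congr (_ + _).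
apply: eq_bigr => i _; rewrite /bump /= add1n exprS !mulrA; congr (_ * _ ^+ _).
by case: n i {IH} => [[]|n i] //=; rewrite subSS.
Qed.

Section Pow.
Variables (q : K) (q_gen : forall m : nat, (0 < m)%N -> q ^+ m != 1) (q0 : q != 0).

Lemma serre_pow_comm s (x f p p' y : A) : x * y = y * x + p ->
  f * y = y * f + p' ->
  serre_pow q s x f * y =
  y * serre_pow q s x f + serre_ins_x q s x f p + serre_ins_f q s x p'.
Proof.
move=> xy fy; rewrite /serre_pow mulr_suml mulr_sumr -!big_split.
apply: eq_bigr => k _; rewrite qbinE //; last by rewrite -ltnS.
rewrite /= mul_scalel mul_scaler -!scalerDr; congr (_ *: _).
rewrite -[LHS]mulrA (exprM_comm _ xy) mulrDr !mulrA -(mulrA _ f y) fy.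
rewrite !mulrDr !mulrDl !mulrA (exprM_comm _ xy) !mulrDl.
by lin_comb K A; ring.
Qed.

(** The commutator with y is a derivation; after polarization it acts on powers of one element,
    which brings it to the sums studied above. *)
Lemma serre_sym_ins s (X P : 'I_s -> A) g p' y :
  (forall a, X a * y = y * X a + P a) -> g * y = y * g + p' ->
  serre_sym q X g * y = y * serre_sym q X g +
    \sum_(J : {set 'I_s}) (-1) ^+ #|~: J| *:
      (serre_ins_x q s (\sum_(a in J) X a) g (\sum_(a in J) P a)
       + serre_ins_f q s (\sum_(a in J) X a) p').
Proof.
move=> Xy gy; rewrite !serre_symE mulr_suml mulr_sumr -big_split.
apply: eq_bigr => J _; rewrite /= mul_scalel mul_scaler -scalerDr.
congr (_ *: _); rewrite addrA; apply: serre_pow_comm => //.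
by rewrite mulr_suml mulr_sumr -big_split; apply: eq_bigr.
Qed.

End Pow.

Definition upd (I : eqType) (X : I -> A) (a : I) (y : A) : I -> A :=
  fun t => if t == a then y else X t.

Lemma prod_comm (I : eqType) (r : seq I) (P : pred I) (X Y : I -> A) h : uniq r ->
  (forall a, X a * h = h * X a + Y a) ->
  (\prod_(t <- r | P t) X t) * h = h * (\prod_(t <- r | P t) X t) +
    \sum_(a <- r | P a) \prod_(t <- r | P t) upd X a (Y a) t.
Proof.
move=> + Xh; elim: r => [_|b r IH /= /andP[br ur]].
  by rewrite !big_nil mul1r mulr1 addr0.
rewrite !big_cons; case: ifP => Pb; last first.
  rewrite IH //; congr (_ + _); apply: eq_bigr => a Pa.
  by rewrite big_cons Pb.
rewrite -mulrA IH // mulrDr mulrA Xh mulrDl -!mulrA -addrA; congr (_ + _).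
congr (_ + _).
  rewrite {1}/upd eqxx; congr (_ * _).
  rewrite big_seq_cond [in RHS]big_seq_cond; apply: eq_bigr => t /andP[tr _].
  by rewrite /upd; case: eqP => // tb; rewrite tb (negbTE br) in tr.
rewrite mulr_sumr [LHS]big_seq_cond [RHS]big_seq_cond; apply: eq_bigr => a /andP[ar _].
rewrite big_cons Pb /upd; case: eqP => // ba.
by rewrite ba ar in br.
Qed.

Lemma serre_word_comm s l (X Y : 'I_s -> A) g g' h :
  (forall a, X a * h = h * X a + Y a) -> g * h = h * g + g' ->
  serre_word l X g * h = h * serre_word l X g +
    \sum_a serre_word l (upd X a (Y a)) g + serre_word l X g'.
Proof.
move=> Xh gh; rewrite /serre_word.
set PL := \prod_(t < s | (t < l)%N) X t; set PR := \prod_(t < s | (l <= t)%N) X t.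
have uE (Q : pred 'I_s) a : ~~ Q a ->
    \prod_(t | Q t) upd X a (Y a) t = \prod_(t | Q t) X t.
  move=> Qa; apply: eq_bigr => t Qt; rewrite /upd; case: eqP => // ta.
  by rewrite ta (negbTE Qa) in Qt.
rewrite (bigID (fun a : 'I_s => (a < l)%N)) /=.
have -> : \sum_(a < s | (a < l)%N)
      (\prod_(t < s | (t < l)%N) upd X a (Y a) t) * g *
      (\prod_(t < s | (l <= t)%N) upd X a (Y a) t) =
    (\sum_(a < s | (a < l)%N) \prod_(t < s | (t < l)%N) upd X a (Y a) t) * g * PR.
  rewrite !mulr_suml; apply: eq_bigr => a al; congr (_ * _).
  by apply: (uE (fun t : 'I_s => (l <= t)%N)); rewrite -ltnNge.
have -> : \sum_(a < s | ~~ (a < l)%N)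
      (\prod_(t < s | (t < l)%N) upd X a (Y a) t) * g *
      (\prod_(t < s | (l <= t)%N) upd X a (Y a) t) =
    PL * g * (\sum_(a < s | (l <= a)%N) \prod_(t < s | (l <= t)%N) upd X a (Y a) t).
  rewrite mulr_sumr; apply: eq_big => [a|a al]; first by rewrite -leqNgt.
  by congr (_ * _ * _); apply: (uE (fun t : 'I_s => (t < l)%N)).
have ur := index_enum_uniq ('I_s : finType).
have eL : PL * h = h * PL +
    \sum_(a < s | (a < l)%N) \prod_(t < s | (t < l)%N) upd X a (Y a) t.
  exact: prod_comm.
have eR : PR * h = h * PR +
    \sum_(a < s | (l <= a)%N) \prod_(t < s | (l <= t)%N) upd X a (Y a) t.
  exact: prod_comm.
move: eL eR; set SL := \sum_(a < s | _) _; set SR := \sum_(a < s | (l <= a)%N) _.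
move=> eL eR; rewrite -mulrA eR mulrDr mulrA -(mulrA PL) gh mulrDr mulrA eL.
expand; rewrite !mulrA; lin_comb K A; ring.
Qed.

Lemma serre_sym_comm q s (X Y : 'I_s -> A) g g' h :
  (forall a, X a * h = h * X a + Y a) -> g * h = h * g + g' ->
  serre_sym q X g * h = h * serre_sym q X g +
    \sum_a serre_sym q (upd X a (Y a)) g + serre_sym q X g'.
Proof.
move=> Xh gh; rewrite /serre_sym.
rewrite [X in _ + X + _]exchange_big mulr_suml mulr_sumr -!big_split.
apply: eq_bigr => w _ /=; rewrite exchange_big mulr_suml mulr_sumr -!big_split.
apply: eq_bigr => l _ /=; rewrite -scaler_sumr mul_scalel mul_scaler -!scalerDr.
congr (_ *: _).
have Xwh a : X (w a) * h = h * X (w a) + Y (w a) by [].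
(* The Leibniz sum runs over positions, the claim over labels; w matches the two. *)
rewrite (serre_word_comm l Xwh gh) [in RHS](reindex_inj (@perm_inj _ w)) /=.
congr (_ + _ + _); apply: eq_bigr => a _; rewrite /serre_word /upd.
by congr (_ * _ * _); apply: eq_bigr => t _; rewrite (inj_eq perm_inj).
Qed.

Lemma serre_symZ q s (X : 'I_s -> A) (c : K) g :
  serre_sym q X (c *: g) = c *: serre_sym q X g.
Proof.
rewrite /serre_sym scaler_sumr; apply: eq_bigr => w _.
rewrite scaler_sumr; apply: eq_bigr => l _.
by rewrite /serre_word mul_scaler mul_scalel !scalerA mulrC.
Qed.

Lemma serre_word_updZ s l (X : 'I_s -> A) (c : K) a y g :
  serre_word l (upd X a (c *: y)) g = c *: serre_word l (upd X a y) g.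
Proof.
have uE (Q : pred 'I_s) : \prod_(t | Q t) upd X a (c *: y) t =
    (if Q a then c else 1) *: \prod_(t | Q t) upd X a y t.
  rewrite (eq_bigr (fun t => (if t == a then c else 1) *: upd X a y t)).
    rewrite scaler_prod -big_mkcondr /=.
    congr (_ *: _); case: ifP => Qa.
      by rewrite (big_pred1 a) // => t /=; case: eqP => [->|]; rewrite ?Qa ?andbF.
    rewrite big_pred0 // => t; case: eqP => [->|]; rewrite ?Qa ?andbF //.
  by move=> t _; rewrite /upd; case: eqP => // _; rewrite scale1r.
rewrite /serre_word !uE mul_scalel mul_scaler mul_scalel scalerA.
by congr (_ *: _); have [] := ltnP a l; rewrite ?mulr1 ?mul1r.
Qed.

Lemma serre_sym_updZ q s (X : 'I_s -> A) (c : K) a y g :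
  serre_sym q (upd X a (c *: y)) g = c *: serre_sym q (upd X a y) g.
Proof.
rewrite /serre_sym scaler_sumr; apply: eq_bigr => w _.
rewrite scaler_sumr; apply: eq_bigr => l _.
have wE z : serre_word l (fun t => upd X a z (w t)) g =
    serre_word l (upd (fun t => X (w t)) ((w^-1)%g a) z) g.
  rewrite /serre_word /upd.
  by congr (_ * _ * _); apply: eq_bigr => t _; rewrite -(can_eq (permK w)) permKV.
by rewrite !wE serre_word_updZ !scalerA mulrC.
Qed.

Lemma serre_sym_scale q s (X : 'I_s -> A) g (c d : K) k :
  (forall a, X a * k = c *: (k * X a)) -> g * k = d *: (k * g) ->
  serre_sym q X g * k = (c ^+ s * d) *: (k * serre_sym q X g).
Proof.
move=> Xk gk; rewrite !serre_symE mulr_suml mulr_sumr scaler_sumr.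
apply: eq_bigr => J _; rewrite mul_scalel mul_scaler scalerA mulrC -scalerA.
congr (_ *: _); have := \sum_(a in J) X a.
have: (\sum_(a in J) X a) * k = c *: (k * \sum_(a in J) X a).
  by rewrite mulr_suml mulr_sumr scaler_sumr; apply: eq_bigr.
move: (\sum_(a in J) X a) => x xk _.
have xnk n : x ^+ n * k = c ^+ n *: (k * x ^+ n).
  elim: n => [|n IH]; first by rewrite !expr0 mul1r mulr1 scale1r.
  have -> : x ^+ n.+1 * k = x ^+ n * (x * k) by rewrite exprSr mulrA.
  by rewrite xk mul_scaler mulrA IH mul_scalel scalerA -mulrA -exprSr -exprS.
rewrite /serre_pow mulr_suml mulr_sumr scaler_sumr; apply: eq_bigr => l _.
rewrite mul_scalel mul_scaler.
have -> : x ^+ l * g * x ^+ (s - l) * k =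
    (c ^+ s * d) *: (k * (x ^+ l * g * x ^+ (s - l))).
  rewrite -[LHS]mulrA xnk mul_scaler (mulrA _ k) -(mulrA _ g k) gk.
  rewrite mul_scaler mul_scalel (mulrA _ k g) xnk !mul_scalel !scalerA !mulrA.
  by congr (_ *: _); rewrite mulrAC -exprD subnK // -ltnS.
by rewrite !scalerA; congr (_ *: _); ring.
Qed.

End RelatorCommutators.

(** * Vanishing of the sums with phi inserted, once the relations hold *)

Section HonestRelations.
Variables (R : realType) (D : quantum_datum R).
Local Notation n := (rk D).
Local Notation q := (qpar D).
Local Notation C := (cartan D).

Lemma symB_sym (i j : 'I_n) : symB i j = symB j i.
Proof. exact: symm_cartan. Qed.

Lemma q_neq0 (i : 'I_n) : q_ i != 0.
Proof. by rewrite expf_neq0 // qpar_neq0. Qed.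

Lemma q_gen (i : 'I_n) (m : nat) : (0 < m)%N -> q_ i ^+ m != 1.
Proof.
by move=> m0; rewrite -exprM qpar_not_root // muln_gt0 symmetrizer_gt0.
Qed.

(** The relations of sign - are those of sign + with q inverted, and the binomials are invariant
    under this. *)
Definition q_sign (s : bool) (i : 'I_n) : R[i] := if s then q_ i else (q_ i)^-1.

Lemma q_sign_neq0 s i : q_sign s i != 0.
Proof. by case: s; rewrite /= ?invr_eq0 q_neq0. Qed.

Lemma q_sign_gen s i (m : nat) : (0 < m)%N -> q_sign s i ^+ m != 1.
Proof.
by case: s => /(q_gen i) //=; rewrite exprVn invr_eq1.
Qed.

Lemma q_signE s i (z : int) : q ^ (pm s * ((symmetrizer D i)%:Z * z)) = q_sign s i ^ z.
Proof.
by rewrite mulrCA -exprz_exp -exprnP -/(q_ i) -exprz_exp; case: s.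
Qed.

Lemma q_sign_diag s i : q ^ (pm s * symB i i) = q_sign s i ^+ 2.
Proof. by rewrite /symB cartan_diag q_signE. Qed.

Lemma serre_degE (i j : 'I_n) : i != j -> serre_deg i j = `|C i j|%N.+1.
Proof.
by move=> /(@cartan_offdiag _ D); rewrite /serre_deg; lia.
Qed.

(** Fixes N = |C_ij|, so that the Serre degree is N+1 as in the quantum plane identities. *)
Lemma q_sign_off s i j : i != j ->
  q ^ (pm s * symB i j) = q_sign s i ^- `|C i j|%N.
Proof.
move=> ij; rewrite /symB q_signE.
have -> : C i j = - (`|C i j|%N%:Z) by move: (cartan_offdiag ij); lia.
by rewrite -invr_expz abszN absz_nat.
Qed.

Lemma serre_ins_x_sign s (A : algType R[i]) i m (x f p : A) :
  serre_ins_x (q_sign s i) m x f p = serre_ins_x (q_ i) m x f p.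
Proof. by case: s; [|exact: serre_ins_x_inv (@q_gen i) (q_neq0 i) _ _ _ _ _]. Qed.

Lemma serre_ins_f_sign s (A : algType R[i]) i m (x p : A) :
  serre_ins_f (q_sign s i) m x p = serre_ins_f (q_ i) m x p.
Proof. by case: s; [|exact: serre_ins_f_inv (@q_gen i) (q_neq0 i) _ _ _ _]. Qed.

Section Loop.
Variables (A : algType R[i]) (s : bool) (x : 'I_n -> int -> A).

Definition exch_ok : Prop := forall i j,
  exch (q ^ (pm s * symB i j)) (x i) (x j).

Definition serre_ok : Prop :=
  forall i j (m : 'I_(serre_deg i j) -> int) m', i != j ->
  serre_sym (q_ i) (fun a => x i (m a)) (x j m') = 0.

Definition loop_ok : Prop := forall a, loop_rel s x a -> a = 0.

Lemma loop_okP : loop_ok <-> exch_ok /\ serre_ok.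
Proof.
split=> [xs|[xx xs] a [[i j m m']|[i j m m' ij]]].
- split=> [i j|i j m m' ij].
    by apply/exch_eltP => m m'; apply: xs; left; constructor.
  by apply: xs; right; constructor.
- by have /exch_eltP := xx i j; apply.
- exact: xs.
Qed.

Hypothesis xx : exch_ok.
Variables (k : hh D -> A) (h : 'I_n -> int -> A).
Hypothesis kh : cartan_ok k h.
Hypothesis kx : weight_ok k s x.
Hypothesis hx : hx_ok h s x.

(** Exchange relations survive index shifts and sums, so z -> sum of the x_{i, m_a + z} is a current
    to which [serre_ins_x_vanish] applies at z = 0. *)
Lemma serre_phi_x i j e (m : 'I_(serre_deg i j) -> int) (J : {set 'I_(serre_deg i j)})
    m' l : i != j ->
  serre_ins_x (q_ i) (serre_deg i j) (\sum_(a in J) x i (m a)) (x j m')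
    (phi k h e i l) = 0.
Proof.
move=> ij; pose X z := \sum_(a in J) x i (m a + z); pose f z := x j (m' + z).
have -> : \sum_(a in J) x i (m a) = X 0.
  by apply: eq_bigr => a _; rewrite addr0.
have -> : x j m' = f 0 by rewrite /f addr0.
have xX p a : exch a p (x i) -> exch a p X.
  by move=> px; apply: exch_sumr => b _; exact: exch_shiftr.
have Xx p a : exch a (x i) p -> exch a X p.
  by move=> px; apply: exch_suml => b _; exact: exch_shiftl.
rewrite -(serre_ins_x_sign s) serre_degE //.
apply: serre_ins_x_vanish; rewrite -?q_sign_diag -?q_sign_off //.
- exact: q_sign_gen.
- exact: q_sign_neq0.
- exact: char0_complex.
- exact: phi_one_sided.
- exact/xX/Xx.
- exact/Xx/exch_shiftr.
- exact/xX/phi_exch.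
- exact/exch_shiftr/phi_exch.
Qed.

Lemma serre_phi_f i j e (m : 'I_(serre_deg i j) -> int) (J : {set 'I_(serre_deg i j)})
    l : i != j ->
  serre_ins_f (q_ i) (serre_deg i j) (\sum_(a in J) x i (m a))
    (phi k h e j l) = 0.
Proof.
move=> ij; pose X z := \sum_(a in J) x i (m a + z).
have -> : \sum_(a in J) x i (m a) = X 0.
  by apply: eq_bigr => a _; rewrite addr0.
have xX p a : exch a p (x i) -> exch a p X.
  by move=> px; apply: exch_sumr => b _; exact: exch_shiftr.
have Xx p a : exch a (x i) p -> exch a X p.
  by move=> px; apply: exch_suml => b _; exact: exch_shiftl.
rewrite -(serre_ins_f_sign s) serre_degE //.
apply: serre_ins_f_vanish; rewrite -?q_sign_diag -?q_sign_off //.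
- exact: q_sign_gen.
- exact: q_sign_neq0.
- exact: char0_complex.
- exact: phi_one_sided.
- exact/xX/Xx.
- by rewrite symB_sym; exact/xX/phi_exch.
Qed.

End Loop.

End HonestRelations.

(** * Relators under algebra morphisms and under the action of k and h *)

Section Naturality.
Variables (R : realType) (D : quantum_datum R) (A B : algType R[i]).
Variable f : {lrmorphism A -> B}.
Local Notation n := (rk D).
Variables (k : hh D -> A) (h : 'I_n -> int -> A).

Lemma lrmorph_exp_coef s i m : f (exp_coef h s i m) = exp_coef (fun i m => f (h i m)) s i m.
Proof.
rewrite /exp_coef linear_sum; apply: eq_bigr => p _; rewrite linearZ /=.
congr (_ *: _); rewrite -coef_map rmorphXn /=.
congr (nth 0 (polyseq (_ ^+ _)) _).
apply/polyP => l; rewrite coef_map !coef_poly; case: ifP => _; last exact: raddf0.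
exact: linearZ.
Qed.

Lemma lrmorph_phi s i m :
  f (phi k h s i m) = phi (fun c => f (k c)) (fun i m => f (h i m)) s i m.
Proof.
rewrite /phi; case: ifP => _; last exact: raddf0.
by rewrite rmorphM /= lrmorph_exp_coef.
Qed.

Lemma lrmorph_exch_elt a p x m r :
  f (exch_elt a p x m r) = exch_elt a (fun m => f (p m)) (fun m => f (x m)) m r.
Proof. by rewrite /exch_elt !raddfB /= !linearZ /= !rmorphM. Qed.

Lemma lrmorph_serre_sym q s (X : 'I_s -> A) g :
  f (serre_sym q X g) = serre_sym q (fun a => f (X a)) (f g).
Proof.
rewrite /serre_sym linear_sum; apply: eq_bigr => w _.
rewrite linear_sum; apply: eq_bigr => l _; rewrite linearZ /=; congr (_ *: _).
by rewrite /serre_word !rmorphM !rmorph_prod.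
Qed.

End Naturality.

Section RelationFamilies.
Variables (R : realType) (D : quantum_datum R).
Local Notation n := (rk D).
Local Notation q := (qpar D).
Local Notation K := R[i].

Lemma cartan_h0 (A : zmodType) (e : cartan_gen D -> A) i : cartan_h e i 0 = 0.
Proof. by rewrite /cartan_h insubF // eqxx. Qed.

Lemma cartan_hE (A : zmodType) (e : cartan_gen D -> A) i (u : {m : int | m != 0}) :
  cartan_h e i (val u) = e (inr (i, u)).
Proof. by rewrite /cartan_h valK. Qed.

Definition loop_x (A : Type) (e : loop_gen D -> A) (i : 'I_n) (m : int) : A := e (i, m).

Section Map.
Variables (A B : algType K) (f : {lrmorphism A -> B}).

Lemma lrmorph_cartan_h (e : cartan_gen D -> A) i m :
  f (cartan_h e i m) = cartan_h (fun a => f (e a)) i m.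
Proof. by rewrite /cartan_h; case: insub => // ; rewrite raddf0. Qed.

Variables (k : hh D -> A) (h : 'I_n -> int -> A).
Let k' c := f (k c).
Let h' i m := f (h i m).

Lemma cartan_rel_map :
  (forall a, cartan_rel k h a -> cartan_rel k' h' (f a)) /\
  (forall b, cartan_rel k' h' b -> exists2 a, cartan_rel k h a & b = f a).
Proof.
split=> [a|b] [c c'||c j m m0|i j m m' m0 m'0].
- by rewrite raddfB /= rmorphM; exact: (@cartan_kk _ _ _ k' h').
- by rewrite raddfB /= rmorph1; exact: (@cartan_k0 _ _ _ k' h').
- by rewrite raddfB /= !rmorphM; exact: (@cartan_kh _ _ _ k' h').
- by rewrite raddfB /= !rmorphM; exact: (@cartan_hh _ _ _ k' h').
- exists (k c * k c' - k (c + c')); first by constructor.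
  by rewrite raddfB /= rmorphM.
- exists (k 0 - 1); first by constructor.
  by rewrite raddfB /= rmorph1.
- exists (comm (k c) (h j m)); first by constructor.
  by rewrite raddfB /= !rmorphM.
- exists (comm (h i m) (h j m')); first by constructor.
  by rewrite raddfB /= !rmorphM.
Qed.

Variables (s : bool) (x : 'I_n -> int -> A).
Let x' i m := f (x i m).

Lemma loop_rel_map :
  (forall a, loop_rel s x a -> loop_rel s x' (f a)) /\
  (forall b, loop_rel s x' b -> exists2 a, loop_rel s x a & b = f a).
Proof.
split=> [a|b] [[i j m m']|[i j m m' ij]].
- left; rewrite -/(exch_elt _ (x i) (x j) m m') lrmorph_exch_elt.
  exact: (ExchangeRel s x').
- right.
  rewrite -/(serre_sym (q_ i) (fun a => x i (m a)) (x j m')) lrmorph_serre_sym.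
  exact: (SerreRel x').
- exists (exch_elt (q ^ (pm s * symB i j)) (x i) (x j) m m').
    by left; constructor.
  by rewrite lrmorph_exch_elt.
- exists (serre_sym (q_ i) (fun a => x i (m a)) (x j m')).
    by right; constructor.
  by rewrite lrmorph_serre_sym.
Qed.

End Map.

Section LoopTransport.
Variables (A : algType K) (s : bool) (x : 'I_n -> int -> A).

Lemma exchange_rel_scale k (c : 'I_n -> K) a :
  (forall j m, x j m * k = c j *: (k * x j m)) -> exchange_rel s x a ->
  exists d, a * k = d *: (k * a).
Proof.
move=> xk [i j m m']; exists (c i * c j).
rewrite -/(exch_elt _ (x i) (x j) m m'); exact: exch_elt_scale.
Qed.

Lemma serre_rel_scale k (c : 'I_n -> K) a :
  (forall j m, x j m * k = c j *: (k * x j m)) -> serre_rel x a ->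
  exists d, a * k = d *: (k * a).
Proof.
move=> xk [i j m m' ij]; exists (c i ^+ serre_deg i j * c j).
rewrite -/(serre_sym (q_ i) (fun a => x i (m a)) (x j m')).
exact: serre_sym_scale.
Qed.

(** A derivation that shifts indices sends a relator to relators with one index shifted. *)
Lemma exchange_rel_derive h (c : 'I_n -> K) l a :
  (forall j m, x j m * h = h * x j m + c j *: x j (m + l)) -> exchange_rel s x a ->
  exists2 b, in_span (exchange_rel s x) b & a * h = h * a + b.
Proof.
move=> xh [i j m m']; rewrite -/(exch_elt _ (x i) (x j) m m').
rewrite (exch_elt_comm _ _ _ (xh i) (xh j)) -addrA; eexists; last by [].
rewrite [X in _ + X]exch_elt_sym !exch_eltZl.
rewrite (exch_elt_shift _ (x i)) (exch_elt_shift _ (x j)) [X in _ + _ *: X]exch_elt_sym.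
by apply: in_span_lin; [|rewrite -[_ *: _]addr0; apply: in_span_lin; [|constructor]];
  apply: in_span_gen; constructor.
Qed.

Lemma serre_rel_derive h (c : 'I_n -> K) l a :
  (forall j m, x j m * h = h * x j m + c j *: x j (m + l)) -> serre_rel x a ->
  exists2 b, in_span (serre_rel x) b & a * h = h * a + b.
Proof.
move=> xh [i j m m' ij].
rewrite -/(serre_sym (q_ i) (fun a => x i (m a)) (x j m')).
rewrite (serre_sym_comm _ (fun a => xh i (m a)) (xh j m')) -addrA.
eexists; last by [].
rewrite serre_symZ addrC; apply: in_span_lin.
  by apply: in_span_gen; constructor.
elim/big_ind: _ => [|u v Su Sv|b _]; first by constructor.
  by rewrite -[u]scale1r; apply: in_span_lin.
rewrite serre_sym_updZ -[_ *: _]addr0; apply: in_span_lin; last by constructor.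
apply: in_span_gen.
rewrite (_ : upd _ _ _ = fun d => x i (if d == b then m b + l else m d)).
  exact: (SerreRel x (fun d => if d == b then m b + l else m d)).
by apply/funext => d; rewrite /upd; case: eqP.
Qed.

End LoopTransport.

Definition hx_coef (s : bool) (i : 'I_n) (l : int) (j : 'I_n) : K :=
  (pm s)%:~R * (l%:~R^-1 * qint q (l * symB i j)).

Lemma hx_coef0 s i j : hx_coef s i 0 j = 0.
Proof. by rewrite /hx_coef mulr0z invr0 mul0r mulr0. Qed.

Lemma hx_coefN i l j : hx_coef false i l j = - hx_coef true i l j.
Proof. by rewrite /hx_coef mul1r mulN1r. Qed.

Definition Pcartan := Presentation (@cartan_proper R D).
Definition Ploop s := Presentation (@loop_proper R D s).
Definition Paff := Presentation (@aff_proper R D).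

Lemma in_span_closed (A : lmodType K) (S J : A -> Prop) : lin_closed J ->
  (forall u, S u -> J u) -> forall u, in_span S u -> J u.
Proof.
move=> [J0 JD] SJ u; elim=> [//|c v w Sv _ Jw].
exact/JD/Jw/SJ.
Qed.

Lemma cartan_rels_lift (A : algType K) (e : cartan_gen D -> A) :
  (forall u, rels Pcartan u -> cartan_rel (cartan_k e) (cartan_h e) (free_lift e u)) /\
  (forall a, cartan_rel (cartan_k e) (cartan_h e) a ->
     exists2 u, rels Pcartan u & a = free_lift e u).
Proof.
have := cartan_rel_map (free_lift e) (cartan_k (@fgen K _)) (cartan_h (@fgen K _)).
rewrite (_ : (fun c => _) = cartan_k e); last first.
  by apply/funext => c; exact: free_lift_gen.
rewrite (_ : (fun i m => _) = cartan_h e) //.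
apply/funext => i; apply/funext => m; rewrite lrmorph_cartan_h.
by congr (cartan_h _ i m); apply/funext => a; exact: free_lift_gen.
Qed.

Lemma loop_rels_lift s (A : algType K) (e : loop_gen D -> A) :
  (forall u, rels (Ploop s) u -> loop_rel s (loop_x e) (free_lift e u)) /\
  (forall a, loop_rel s (loop_x e) a -> exists2 u, rels (Ploop s) u & a = free_lift e u).
Proof.
have := loop_rel_map (free_lift e) s (loop_x (@fgen K _)).
rewrite (_ : (fun i m => _) = loop_x e) //.
by apply/funext => i; apply/funext => m; exact: free_lift_gen.
Qed.

Lemma holds_cartan (A : algType K) (e : cartan_gen D -> A) :
  holds Pcartan e <-> cartan_ok (cartan_k e) (cartan_h e).
Proof.
have [fw bw] := cartan_rels_lift e.
split=> [eP|[eP _] u /fw]; last exact: eP.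
by split=> [a /bw[u /eP e0 ->]|i]; [|exact: cartan_h0].
Qed.

Lemma holds_loop s (A : algType K) (e : loop_gen D -> A) :
  holds (Ploop s) e <-> loop_ok s (loop_x e).
Proof.
have [fw bw] := loop_rels_lift s e.
by split=> [eP a /bw[u /eP e0 ->]|eP u /fw /eP].
Qed.

End RelationFamilies.

(** * The Borel algebra *)

Section CommutatorTransport.
Variables (K : comNzRingType) (A : algType K).

(** Both h and h' act on currents by multiples of index shifts, and shifts commute; hence the common
    [x12]. *)
Lemma comm_transport_r (x x1 x2 x12 h h' : A) (a b : K) :
  x * h = h * x - a *: x1 -> x * h' = h' * x - b *: x2 ->
  x1 * h' = h' * x1 - b *: x12 -> x2 * h = h * x2 - a *: x12 ->
  x * (h * h' - h' * h) = (h * h' - h' * h) * x.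
Proof.
move=> xh xh' x1h x2h; rewrite mulrBr mulrBl !mulrA xh xh' !mulrBl !mul_scalel.
rewrite -!(mulrA _ x) xh xh' !mulrBr x1h x2h !mul_scaler !mulrA.
lin_comb K A; ring.
Qed.

Lemma comm_transport_l (y y1 y2 y12 h h' : A) (a b : K) :
  h * y = y * h + a *: y1 -> h' * y = y * h' + b *: y2 ->
  h' * y1 = y1 * h' + b *: y12 -> h * y2 = y2 * h + a *: y12 ->
  (h * h' - h' * h) * y = y * (h * h' - h' * h).
Proof.
move=> hy hy' hy1 hy2; rewrite mulrBr mulrBl -!mulrA hy hy' !mulrDr !mul_scaler.
rewrite !mulrA hy hy' !mulrDl hy1 hy2 !mul_scalel.
lin_comb K A; ring.
Qed.

End CommutatorTransport.

Section Borel.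
Variables (R : realType) (D : quantum_datum R).
Local Notation n := (rk D).
Local Notation q := (qpar D).
Local Notation K := R[i].

Definition borel_gen : choiceType := (cartan_gen D + loop_gen D)%type.

Section Relations.
Variables (A : algType K) (k : hh D -> A) (h : 'I_n -> int -> A).
Variable x : 'I_n -> int -> A.

Definition weight_elt (s : bool) (c : hh D) (j : 'I_n) (m : int) : A :=
  k c * x j m * k (- c) - qpow D ((pm s)%:~R * simple_root D j c) *: x j m.

Definition hx_elt (s : bool) (i j : 'I_n) (m m' : int) : A :=
  comm (h i m) (x j m') - hx_coef s i m j *: x j (m + m').

Inductive borel_rel : A -> Prop :=
| BorelCartan a : cartan_rel k h a -> borel_rel a
| BorelWeight c j m : borel_rel (weight_elt true c j m)
| BorelHx i j m m' : m != 0 -> borel_rel (hx_elt true i j m m')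
| BorelLoop a : loop_rel true x a -> borel_rel a.

Lemma borel_rel_aff a : borel_rel a -> aff_rel k h (fun=> x) a.
Proof.
case=> [{}a ka|c j m|i j m m' m0|{}a xa]; first by left.
- by right; left; exact: (WeightRel k (fun=> x) true).
- by right; right; left; exact: (HxRel h (fun=> x) true).
- by do 4!right; exists true.
Qed.

Definition borel_ok : Prop := forall a, borel_rel a -> a = 0.

Lemma borel_okP : (forall i, h i 0 = 0) -> borel_ok <->
  [/\ cartan_ok k h, weight_ok k true x, hx_ok h true x & loop_ok true x].
Proof.
move=> h0; split=> [ok|[[kh _] kx hx xx] a].
  split; first by split=> // a ka; apply: ok; constructor.
  - by move=> c j m; apply/eqP; rewrite -subr_eq0; apply/eqP/ok/BorelWeight.
  - by move=> i j m m' m0; apply/eqP; rewrite -subr_eq0; apply/eqP/ok/BorelHx.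
  - by move=> a xa; apply: ok; constructor.
case=> [{}a|c j m|i j m m' m0|{}a]; first exact: kh.
- by rewrite /weight_elt kx subrr.
- by rewrite /hx_elt /comm hx // subrr.
- exact: xx.
Qed.

End Relations.

Definition borel_k (A : Type) (e : borel_gen -> A) : hh D -> A := cartan_k (e \o inl).
Definition borel_h (A : zmodType) (e : borel_gen -> A) : 'I_n -> int -> A :=
  cartan_h (e \o inl).
Definition borel_x (A : Type) (e : borel_gen -> A) : 'I_n -> int -> A :=
  loop_x (e \o inr).

Definition borel_rels : free_alg K borel_gen -> Prop :=
  let e := @free_gen K borel_gen in borel_rel (borel_k e) (borel_h e) (borel_x e).

Lemma borel_proper : 1 \notin Defs.span (two_sided borel_rels).
Proof.
pose e (a : borel_gen) := if a is inl b then cartan_counit b else 0.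
apply: (@eval_proper _ _ e) => u /borel_rel_aff.
apply: eval_aff => [c v|c|i m|s i m].
- exact: free_evalZ.
- exact: free_eval_gen.
- rewrite /borel_h /cartan_h; case: insubP => [v _ _|_]; last exact: rmorph0.
  exact: free_eval_gen.
- exact: free_eval_gen.
Qed.

Definition Pborel := Presentation borel_proper.

Section Map.
Variables (A B : algType K) (f : {lrmorphism A -> B}).
Variables (k : hh D -> A) (h : 'I_n -> int -> A) (x : 'I_n -> int -> A).
Let k' c := f (k c).
Let h' i m := f (h i m).
Let x' i m := f (x i m).

Lemma lrmorph_weight_elt s c j m :
  f (weight_elt k x s c j m) = weight_elt k' x' s c j m.
Proof. by rewrite /weight_elt raddfB /= linearZ /= !rmorphM. Qed.

Lemma lrmorph_hx_elt s i j m m' :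
  f (hx_elt h x s i j m m') = hx_elt h' x' s i j m m'.
Proof. by rewrite /hx_elt /comm !raddfB /= linearZ /= !rmorphM. Qed.

Lemma borel_rel_map :
  (forall a, borel_rel k h x a -> borel_rel k' h' x' (f a)) /\
  (forall b, borel_rel k' h' x' b -> exists2 a, borel_rel k h x a & b = f a).
Proof.
have [kf kb] := cartan_rel_map f k h; have [xf xb] := loop_rel_map f true x.
split=> [a|b] [u Hu|c j m|i j m m' m0|u Hu].
- exact/BorelCartan/kf.
- by rewrite lrmorph_weight_elt; exact: BorelWeight.
- by rewrite lrmorph_hx_elt; exact: BorelHx.
- exact/BorelLoop/xf.
- by have [a ka ->] := kb _ Hu; exists a => //; exact: BorelCartan.
- exists (weight_elt k x true c j m); first exact: BorelWeight.
  by rewrite lrmorph_weight_elt.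
- exists (hx_elt h x true i j m m'); first exact: BorelHx.
  by rewrite lrmorph_hx_elt.
- by have [a xa ->] := xb _ Hu; exists a => //; exact: BorelLoop.
Qed.

End Map.

Section Lift.
Variables (A : algType K) (e : borel_gen -> A).
Local Notation g := (@fgen K borel_gen).

Lemma borel_k_lift : (fun c => free_lift e (borel_k g c)) = borel_k e.
Proof. by apply/funext => c; exact: free_lift_gen. Qed.

Lemma borel_h_lift : (fun i m => free_lift e (borel_h g i m)) = borel_h e.
Proof.
apply/funext => i; apply/funext => m; rewrite lrmorph_cartan_h.
by congr (cartan_h _ i m); apply/funext => a; exact: free_lift_gen.
Qed.

Lemma borel_x_lift : (fun i m => free_lift e (borel_x g i m)) = borel_x e.
Proof. by apply/funext => i; apply/funext => m; exact: free_lift_gen. Qed.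

Lemma borel_rels_lift :
  (forall u, rels Pborel u ->
     borel_rel (borel_k e) (borel_h e) (borel_x e) (free_lift e u)) /\
  (forall a, borel_rel (borel_k e) (borel_h e) (borel_x e) a ->
     exists2 u, rels Pborel u & a = free_lift e u).
Proof.
have := borel_rel_map (free_lift e) (borel_k g) (borel_h g) (borel_x g).
by rewrite borel_k_lift borel_h_lift borel_x_lift.
Qed.

End Lift.

Lemma holds_borel (A : algType K) (e : borel_gen -> A) :
  holds Pborel e <-> [/\ cartan_ok (borel_k e) (borel_h e),
    weight_ok (borel_k e) true (borel_x e), hx_ok (borel_h e) true (borel_x e)
    & loop_ok true (borel_x e)].
Proof.
rewrite -borel_okP; last exact: cartan_h0.
have [fw bw] := borel_rels_lift e.
by split=> [eP a /bw[u /eP e0 ->]|eP u /fw /eP].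
Qed.

(* x_{j,m} k_c = q^(-alpha_j(c)) k_c x_{j,m} and
   x_{j,m} h_{i,l} = h_{i,l} x_{j,m} - [h_{i,l}, x_{j,m}]. *)
Definition borel_c (g : loop_gen D) (a : cartan_gen D) : K :=
  if a is inl c then qpow D (- simple_root D g.1 c) else 1.

Definition borel_ex (g : loop_gen D) (a : cartan_gen D) : falg K (loop_gen D) :=
  if a is inr iu then
    - hx_coef true iu.1 (val iu.2) g.1 *: fgen K ((g.1, g.2 + val iu.2) : loop_gen D)
  else 0.

Definition borel_straight (A : algType K) (ea : cartan_gen D -> A)
    (eb : loop_gen D -> A) : Prop :=
  straight borel_c (fun _ _ => 0) (fun _ a => a) borel_ex ea eb.

Section Straight.
Variables (A : algType K) (ea : cartan_gen D -> A) (eb : loop_gen D -> A).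
Let k := cartan_k ea.
Let h := cartan_h ea.
Let x := loop_x eb.

Lemma borel_straightP : borel_straight ea eb <->
  (forall c j m, x j m * k c = qpow D (- simple_root D j c) *: (k c * x j m)) /\
  (forall i l j m, x j m * h i l = h i l * x j m - hx_coef true i l j *: x j (m + l)).
Proof.
split=> [st|[xk xh] [j m] [c|[i u]]].
  split=> [c j m|i l j m].
    by have := st (j, m) (inl c); rewrite scale0r addr0 free_lift0 addr0.
  have [->|l0] := eqVneq l 0.
    by rewrite hx_coef0 /h cartan_h0 mulr0 mul0r scale0r subrr.
  have -> : l = val (exist _ l l0 : {m : int | m != 0}) by [].
  have := st (j, m) (inr (i, exist _ l l0)).
  rewrite scale0r addr0 scale1r /h cartan_hE => ->; congr (_ + _).
  by rewrite linearZ /= free_lift_gen scaleNr.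
- rewrite scale0r addr0 free_lift0 addr0; exact: xk.
- rewrite scale0r addr0 scale1r linearZ /= free_lift_gen scaleNr -cartan_hE.
  exact: xh.
Qed.

End Straight.

Lemma borel_left_stable (E : algType K) (ea : cartan_gen D -> E) (eb : loop_gen D -> E) :
  borel_straight ea eb -> forall J : E -> Prop, lin_closed J ->
  (forall u v, J v -> J (u * v)) ->
  (forall d, pres_pi (Ploop D true) d = 0 -> J (free_lift eb d)) ->
  forall u a, rels (Ploop D true) u -> J (free_lift eb u * ea a).
Proof.
move=> /borel_straightP[xk xh] J [J0 JD] JM Jd u a uP.
have [fw bw] := loop_rels_lift true eb.
have JR z : loop_rel true (loop_x eb) z -> J z.
  by move=> /bw[v vP ->]; apply: Jd; exact: pres_pi_rels.
have JZ c v : J v -> J (c *: v) by move=> Jv; rewrite -[_ *: _]addr0; exact: JD.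
have JA v w : J v -> J w -> J (v + w) by move=> Jv; rewrite -[v]scale1r; exact: JD.
have := fw u uP; set z := free_lift eb u => zR.
case: a => [c|[i v]].
  have [] : exists d, z * ea (inl c) = d *: (ea (inl c) * z).
    case: zR; [apply: exchange_rel_scale | apply: serre_rel_scale] => j m;
    exact: (xk c j m).
  by move=> d ->; apply/JZ/JM/JR.
have xv j m : loop_x eb j m * ea (inr (i, v)) = ea (inr (i, v)) * loop_x eb j m +
    (- hx_coef true i (val v) j) *: loop_x eb j (m + val v).
  by have := xh i (val v) j m; rewrite cartan_hE scaleNr.
case: zR => zR.
  have [b Sb ->] := exchange_rel_derive xv zR.
  apply: JA; first by apply/JM/JR; left.
  by apply: in_span_closed Sb => // w Sw; apply: JR; left.
have [b Sb ->] := serre_rel_derive xv zR.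
apply: JA; first by apply/JM/JR; right.
by apply: in_span_closed Sb => // w Sw; apply: JR; right.
Qed.

Lemma right_gen_scale (E : algType K) (Q : E -> Prop) c z v :
  Q z -> right_gen Q (c *: (z * v)).
Proof.
move=> Qz; rewrite -[_ *: _]addr0; apply: in_spanP; last by constructor.
by exists z, v.
Qed.

(** Each relator r of (R1) satisfies x^+ r = d r x^+ for a scalar d, so x^+ r stays in the right
    ideal of the relators. *)
Lemma borel_right_stable (E : algType K) (ea : cartan_gen D -> E) (eb : loop_gen D -> E) :
  borel_straight ea eb -> holds (Ploop D true) eb -> forall L : E -> Prop, lin_closed L ->
  (forall u v, L u -> L (u * v)) ->
  (forall u, rels (Pcartan D) u -> L (free_lift ea u)) -> word_induction eb L ->
  holds (Pcartan D) ea.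
Proof.
move=> /borel_straightP[xk xh] _ L _ _ LR WI.
have [fw bw] := cartan_rels_lift ea.
suff kh0 z : cartan_rel (cartan_k ea) (cartan_h ea) z -> z = 0.
  by move=> u /fw /kh0.
move: z; apply: WI => [z /bw[u /LR Lu ->//]|z [j m]].
rewrite -/(loop_x eb j m); set k := cartan_k ea in xk *; set h := cartan_h ea in xh *.
have kk c c' : loop_x eb j m * (k c * k c') =
    qpow D (- simple_root D j (c + c')) *: (k c * k c' * loop_x eb j m).
  rewrite mulrA xk mul_scalel -(mulrA (k c) (loop_x eb j m)) xk mul_scaler scalerA mulrA -qpowD.
  by rewrite raddfD opprD.
have kx c i l : loop_x eb j m * (k c * h i l) = qpow D (- simple_root D j c) *:
   (k c * h i l * loop_x eb j m - hx_coef true i l j *: (k c * loop_x eb j (m + l))).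
  by rewrite mulrA xk mul_scalel -(mulrA (k c) (loop_x eb j m)) xh mulrBr mul_scaler mulrA.
have hk c i l : loop_x eb j m * (h i l * k c) = qpow D (- simple_root D j c) *:
   (h i l * k c * loop_x eb j m - hx_coef true i l j *: (k c * loop_x eb j (m + l))).
  rewrite mulrA xh mulrBl mul_scalel -(mulrA _ (loop_x eb j m)) !xk mul_scaler scalerBr !mulrA.
  by congr (_ - _); rewrite !scalerA mulrC.
case=> [c c'||c i l l0|i i' l l' l0 l'0].
- have -> : loop_x eb j m * (k c * k c' - k (c + c')) =
      qpow D (- simple_root D j (c + c')) *: ((k c * k c' - k (c + c')) * loop_x eb j m).
    by rewrite mulrBr kk xk mulrBl scalerBr.
  exact/right_gen_scale/(@cartan_kk _ _ _ k h).
- have -> : loop_x eb j m * (k 0 - 1) = 1 *: ((k 0 - 1) * loop_x eb j m).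
    by rewrite mulrBr xk raddf0 oppr0 qpow0 mulrBl !scale1r mulr1 mul1r.
  exact/right_gen_scale/(@cartan_k0 _ _ _ k h).
- have -> : loop_x eb j m * comm (k c) (h i l) =
      qpow D (- simple_root D j c) *: (comm (k c) (h i l) * loop_x eb j m).
    by rewrite /comm mulrBr kx hk -scalerBr opprB addrA subrK mulrBl.
  exact/right_gen_scale/(@cartan_kh _ _ _ k h).
- have -> : loop_x eb j m * comm (h i l) (h i' l') =
      1 *: (comm (h i l) (h i' l') * loop_x eb j m).
    rewrite scale1r; apply: comm_transport_r; try exact: xh.
    by rewrite [m + l + l']addrAC; exact: xh.
  exact/right_gen_scale/(@cartan_hh _ _ _ k h).
Qed.

(** Straightening in this step is (R2) and (R3) of sign +, solved for x^+ on the left. *)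
Lemma borel_complete (E : algType K) (e : borel_gen -> E) :
  borel_straight (e \o inl) (e \o inr) -> holds (Pcartan D) (e \o inl) ->
  holds (Ploop D true) (e \o inr) -> holds Pborel e.
Proof.
move=> /borel_straightP[xk xh] /holds_cartan kh /holds_loop xx.
apply/holds_borel; split=> // [c j m|i j m m' m0].
  rewrite -/(borel_k e) -/(borel_x e) in xk *.
  rewrite -mulrA xk mul_scaler mulrA (cartan_okNr kh) mul1r.
  by rewrite raddfN opprK mul1r.
by rewrite -/(borel_h e) -/(borel_x e) in xh *; rewrite xh subKr [m + m']addrC.
Qed.

Lemma borel_ok_straight (E : algType K) (e : borel_gen -> E) :
  holds Pborel e -> borel_straight (e \o inl) (e \o inr).
Proof.
move=> /holds_borel[kh kx hx xx]; apply/borel_straightP; split=> [c j m|i l j m].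
  rewrite -/(borel_k e) -/(borel_x e) (weight_okE kh kx) mul1r scalerA.
  by rewrite -qpowD addNr qpow0 scale1r.
have [->|l0] := eqVneq l 0; first by rewrite hx_coef0 cartan_h0 mulr0 mul0r scale0r subrr.
apply/esym/eqP; rewrite subr_eq addrC -subr_eq [m + l]addrC; apply/eqP.
exact: hx.
Qed.

Lemma holds_gen (X : choiceType) (P : presentation K X) : holds P (pres_gen P).
Proof. by move=> u uP; rewrite -pres_piE pres_pi_rels. Qed.

Lemma borel_holds_cartan : holds (Pcartan D) (pres_gen Pborel \o inl).
Proof. by have /holds_borel[kh _ _ _] := @holds_gen _ Pborel; apply/holds_cartan. Qed.

Lemma borel_holds_loop : holds (Ploop D true) (pres_gen Pborel \o inr).
Proof. by have /holds_borel[_ _ _ xx] := @holds_gen _ Pborel; apply/holds_loop. Qed.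

End Borel.

(** * The full affinization *)

Lemma exch_eltBl (K : fieldType) (A : algType K) (a : K) (p p' x : int -> A) m r :
  exch_elt a (fun i => p i - p' i) x m r = exch_elt a p x m r - exch_elt a p' x m r.
Proof. by rewrite /exch_elt; expand; lin_comb K A; ring. Qed.

Section Psi.
Variables (R : realType) (D : quantum_datum R).
Local Notation n := (rk D).
Local Notation q := (qpar D).
Local Notation K := R[i].

(* The right-hand side of (R4). *)
Definition psi (A : algType K) (k : hh D -> A) (h : 'I_n -> int -> A) (i j : 'I_n)
    (m : int) : A :=
  ((i == j)%:R / (q_ i - (q_ i)^-1)) *: (phi k h true i m - phi k h false i m).

Definition xx_elt (A : algType K) (k : hh D -> A) h (x y : 'I_n -> int -> A) i j m m' : A :=
  comm (x i m) (y j m') - psi k h i j (m + m').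

(** The residue left when an opposite generator crosses a relator (R5); [serre_res] is its analogue
    for (R6). *)
Definition exch_res (A : algType K) s (k : hh D -> A) h (x : 'I_n -> int -> A)
    i j m m' i0 m0 : A :=
  exch_elt (q ^ (pm s * symB i j)) (fun l => psi k h i i0 (l + m0)) (x j) m m'
  + exch_elt (q ^ (pm s * symB i j)) (x i) (fun l => psi k h j i0 (l + m0)) m m'.

Definition serre_res (A : algType K) (k : hh D -> A) h (x : 'I_n -> int -> A)
    i j (m : 'I_(serre_deg i j) -> int) m' i0 m0 : A :=
  \sum_(J : {set 'I_(serre_deg i j)}) (-1) ^+ #|~: J| *:
    (serre_ins_x (q_ i) (serre_deg i j) (\sum_(a in J) x i (m a)) (x j m')
       (\sum_(a in J) psi k h i i0 (m a + m0))
     + serre_ins_f (q_ i) (serre_deg i j) (\sum_(a in J) x i (m a))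
       (psi k h j i0 (m' + m0))).

Lemma psi_sym (A : algType K) (k : hh D -> A) h i j m : psi k h i j m = psi k h j i m.
Proof.
rewrite /psi; have [->//|ij] := eqVneq i j.
by rewrite !mul0r !scale0r.
Qed.

Lemma psi_neq (A : algType K) (k : hh D -> A) h i j m : i != j -> psi k h i j m = 0.
Proof. by move=> ij; rewrite /psi (negbTE ij) mul0r scale0r. Qed.

Lemma exp_coef_comm (A : algType K) (h : 'I_n -> int -> A) s i m z :
  (forall l, z * h i l = h i l * z) -> z * exp_coef h s i m = exp_coef h s i m * z.
Proof.
move=> zh; rewrite /exp_coef mulr_sumr mulr_suml; apply: eq_bigr => p _.
rewrite -scalerAr -scalerAl; congr (_ *: _); rewrite -coefCM -coefMC.
set G := \poly_(_ < _) _.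
have zG : z%:P * G = G * z%:P.
  apply/polyP => l; rewrite coefCM coefMC coef_poly; case: ifP => _.
    by rewrite -scalerAr zh scalerAl.
  by rewrite mulr0 mul0r.
by rewrite (commrX p zG).
Qed.

Section Honest.
Variables (A : algType K) (k : hh D -> A) (h : 'I_n -> int -> A) (s : bool).
Variable x : 'I_n -> int -> A.
Hypothesis kh : cartan_ok k h.
Hypothesis kx : weight_ok k s x.
Hypothesis hx : hx_ok h s x.

Lemma psi_comm_k c i j m : k c * psi k h i j m = psi k h i j m * k c.
Proof.
have ph e : k c * phi k h e i m = phi k h e i m * k c.
  rewrite /phi; case: ifP => _; last by rewrite mulr0 mul0r.
  rewrite -mulrA -(exp_coef_comm _ _ (fun l => cartan_ok_kh kh c i l)) !mulrA.
  by rewrite !(cartan_okD kh) addrC.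
by rewrite /psi -scalerAr -scalerAl mulrBr mulrBl !ph.
Qed.

Lemma psi_comm_h i' l i j m : h i' l * psi k h i j m = psi k h i j m * h i' l.
Proof.
have ph e : h i' l * phi k h e i m = phi k h e i m * h i' l.
  rewrite /phi; case: ifP => _; last by rewrite mulr0 mul0r.
  rewrite mulrA -(cartan_ok_kh kh) -!mulrA; congr (_ * _).
  by apply: exp_coef_comm => l'; exact: (cartan_ok_hh kh).
by rewrite /psi -scalerAr -scalerAl mulrBr mulrBl !ph.
Qed.

Lemma psi_exch i j i0 m0 :
  exch (q ^ (pm s * symB i j)) (fun m => psi k h i i0 (m + m0)) (x j).
Proof.
apply/exch_eltP => m r; rewrite (exch_elt_shift _ (psi k h i i0)) exch_eltZl.
rewrite (_ : exch_elt _ _ _ _ _ =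
    exch_elt (q ^ (pm s * symB i j)) (phi k h true i) (x j) (m + m0) r
    - exch_elt (q ^ (pm s * symB i j)) (phi k h false i) (x j) (m + m0) r).
  have /exch_eltP -> := phi_exch kh kx hx true i j.
  have /exch_eltP -> := phi_exch kh kx hx false i j.
  by rewrite subrr scaler0.
exact: exch_eltBl.
Qed.

Lemma exch_res0 i j m m' i0 m0 : exch_res s k h x i j m m' i0 m0 = 0.
Proof.
rewrite /exch_res; have /exch_eltP -> := psi_exch i j i0 m0.
rewrite exch_elt_sym symB_sym; have /exch_eltP -> := psi_exch j i i0 m0.
by rewrite addr0.
Qed.

(** Linearity in the inserted element splits psi into phi^+ and phi^-, for which the sums vanish
    separately. *)
Lemma serre_res0 i j (m : 'I_(serre_deg i j) -> int) m' i0 m0 : exch_ok s x ->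
  i != j -> serre_res k h x m m' i0 m0 = 0.
Proof.
move=> xx ij; rewrite /serre_res big1 // => J _.
set X := \sum_(a in J) x i (m a).
have psiE i' l : psi k h i' i0 l =
    ((i' == i0)%:R / (q_ i' - (q_ i')^-1)) *: phi k h true i' l +
    ((- ((i' == i0)%:R / (q_ i' - (q_ i')^-1))) *: phi k h false i' l + 0).
  by rewrite addr0 scaleNr -scalerBr.
have z0 : serre_ins_x (q_ i) (serre_deg i j) X (x j m') 0 = 0.
  exact: linear_fun0 (serre_ins_xP _ _ _ _).
have -> : serre_ins_x (q_ i) (serre_deg i j) X (x j m')
    (\sum_(a in J) psi k h i i0 (m a + m0)) = 0.
  elim/big_rec: _ => [//|a p _ IH]; rewrite -[psi _ _ _ _ _]scale1r serre_ins_xP IH.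
  rewrite psiE !serre_ins_xP z0 !(serre_phi_x xx kh kx hx) //.
  by rewrite !scaler0 !addr0 scaler0.
have z0' : serre_ins_f (q_ i) (serre_deg i j) X 0 = 0.
  exact: linear_fun0 (serre_ins_fP _ _ _).
rewrite psiE !serre_ins_fP z0' !(serre_phi_f xx kh kx hx) //.
by rewrite !scaler0 !addr0 scaler0.
Qed.

Variables (y : A) (i0 : 'I_n) (m0 : int).
Hypothesis xy : forall i m, x i m * y = y * x i m + psi k h i i0 (m + m0).

Lemma exchange_commute a : exchange_rel s x a -> a * y = y * a.
Proof.
case=> i j m m'; rewrite -/(exch_elt _ (x i) (x j) m m').
rewrite (exch_elt_comm _ _ _ (xy i) (xy j)) -addrA.
by rewrite -[X in _ + X]/(exch_res s k h x i j m m' i0 m0) exch_res0 addr0.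
Qed.

Lemma serre_commute a : exch_ok s x -> serre_rel x a -> a * y = y * a.
Proof.
move=> xx [i j m m' ij]; rewrite -/(serre_sym (q_ i) (fun a => x i (m a)) (x j m')).
rewrite (serre_sym_ins (@q_gen _ _ i) (q_neq0 i) (fun a => xy i (m a)) (xy j m')).
by rewrite -[X in _ + X]/(serre_res k h x m m' i0 m0) serre_res0 // addr0.
Qed.

End Honest.

Section Map.
Variables (A B : algType K) (f : {lrmorphism A -> B}).
Variables (k : hh D -> A) (h : 'I_n -> int -> A) (x : 'I_n -> int -> A).
Let k' c := f (k c).
Let h' i m := f (h i m).
Let x' i m := f (x i m).

Lemma lrmorph_psi i j m : f (psi k h i j m) = psi k' h' i j m.
Proof. by rewrite /psi linearZ raddfB /= !lrmorph_phi. Qed.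

Lemma lrmorph_xx_elt (y : 'I_n -> int -> A) i j m m' :
  f (xx_elt k h x y i j m m') = xx_elt k' h' x' (fun i m => f (y i m)) i j m m'.
Proof. by rewrite /xx_elt /comm !raddfB /= !rmorphM /= lrmorph_psi. Qed.

Lemma lrmorph_ins (u p : A) m : f (ins u p m) = ins (f u) (f p) m.
Proof. by rewrite /ins linear_sum; apply: eq_bigr => l _; rewrite !rmorphM !rmorphXn. Qed.

Lemma lrmorph_serre_ins_x v d (u g p : A) :
  f (serre_ins_x v d u g p) = serre_ins_x v d (f u) (f g) (f p).
Proof.
rewrite /serre_ins_x linear_sum; apply: eq_bigr => l _; rewrite linearZ raddfD /=.
by rewrite !rmorphM !rmorphXn /= !lrmorph_ins.
Qed.

Lemma lrmorph_serre_ins_f v d (u p : A) :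
  f (serre_ins_f v d u p) = serre_ins_f v d (f u) (f p).
Proof.
rewrite /serre_ins_f linear_sum; apply: eq_bigr => l _; rewrite linearZ /=.
by rewrite !rmorphM !rmorphXn.
Qed.

Lemma lrmorph_exch_res s i j m m' i0 m0 :
  f (exch_res s k h x i j m m' i0 m0) = exch_res s k' h' x' i j m m' i0 m0.
Proof.
rewrite /exch_res raddfD /= !lrmorph_exch_elt.
by congr (exch_elt _ _ _ _ _ + exch_elt _ _ _ _ _); apply/funext => l;
  rewrite lrmorph_psi.
Qed.

Lemma lrmorph_serre_res i j (m : 'I_(serre_deg i j) -> int) m' i0 m0 :
  f (serre_res k h x m m' i0 m0) = serre_res k' h' x' m m' i0 m0.
Proof.
rewrite /serre_res linear_sum; apply: eq_bigr => J _; rewrite linearZ raddfD /=.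
rewrite lrmorph_serre_ins_x lrmorph_serre_ins_f !linear_sum /= lrmorph_psi.
congr (_ *: (serre_ins_x _ _ _ _ _ + _)).
by apply: eq_bigr => a _; exact: lrmorph_psi.
Qed.

End Map.

End Psi.

Section MixedTransport.
Variables (K : comNzRingType) (A : algType K).

Lemma weight_transport (k k' x y p : A) (b c d : K) :
  k * y = c *: (y * k) -> k' * y = d *: (y * k') -> d * c = 1 -> x * y = y * x + p ->
  (k * x * k' - b *: x) * y =
  y * (k * x * k' - b *: x) + (d *: (k * p * k') - b *: p).
Proof.
move=> ky ky' dc xy.
have -> : (k * x * k' - b *: x) * y = d *: (k * (x * y) * k') - b *: (x * y).
  by rewrite mulrBl mul_scalel -!mulrA ky' !mul_scaler !mulrA.
have -> : k * (x * y) * k' = c *: (y * (k * x * k')) + k * p * k'.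
  by rewrite xy mulrDr mulrDl !mulrA ky !mul_scalel.
have -> : d *: (c *: (y * (k * x * k')) + k * p * k') =
    y * (k * x * k') + d *: (k * p * k').
  by rewrite scalerDr scalerA dc scale1r.
by rewrite xy mulrBr mul_scaler; lin_comb K A; ring.
Qed.

Lemma hx_transport (h x x' y y' p p1 p2 : A) (a b : K) :
  h * y = y * h + b *: y' -> x * y = y * x + p -> x * y' = y' * x + p1 ->
  x' * y = y * x' + p2 ->
  (h * x - x * h - a *: x') * y =
  y * (h * x - x * h - a *: x') + (h * p - p * h - b *: p1 - a *: p2).
Proof.
move=> hy xy xy' x'y.
have -> : (h * x - x * h - a *: x') * y = h * (x * y) - x * (h * y) - a *: (x' * y).
  by rewrite !mulrBl mul_scalel !mulrA.
rewrite xy hy x'y; expand; rewrite xy' !mulrA hy xy; expand.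
by lin_comb K A; ring.
Qed.

Lemma kh_transport (k h y y' : A) (b c : K) :
  k * y = c *: (y * k) -> k * y' = c *: (y' * k) -> h * y = y * h + b *: y' ->
  (k * h - h * k) * y = c *: (y * (k * h - h * k)).
Proof.
move=> ky ky' hy; rewrite mulrBl mulrBr -!mulrA ky hy mulrDr !mul_scaler ky'.
rewrite !mulrA ky hy mul_scalel mulrDl mul_scalel.
by lin_comb K A; ring.
Qed.

End MixedTransport.

Section Affinization.
Variables (R : realType) (D : quantum_datum R).
Local Notation n := (rk D).
Local Notation q := (qpar D).
Local Notation K := R[i].

Definition aff_ia (a : loop_gen D) : aff_gen D := inr (false, a).
Definition aff_ib (b : borel_gen D) : aff_gen D :=
  match b with inl a => inl a | inr g => inr (true, g) end.
Definition aff_split (x : aff_gen D) : loop_gen D + borel_gen D :=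
  match x with
  | inl a => inr (inl a)
  | inr (true, g) => inr (inr g)
  | inr (false, g) => inl g
  end.

Definition aff_c (b : borel_gen D) (a : loop_gen D) : K :=
  if b is inl (inl c) then qpow D (- simple_root D a.1 c) else 1.

Definition aff_c' (b : borel_gen D) (a : loop_gen D) : K :=
  if b is inl (inr iu) then hx_coef false iu.1 (val iu.2) a.1 else 0.

Definition aff_sh (b : borel_gen D) (a : loop_gen D) : loop_gen D :=
  if b is inl (inr iu) then (a.1, a.2 + val iu.2) else a.

Definition aff_ex (b : borel_gen D) (a : loop_gen D) : falg K (borel_gen D) :=
  let e := @fgen K (borel_gen D) in
  if b is inr g then psi (borel_k e) (borel_h e) g.1 a.1 (g.2 + a.2) else 0.

Definition aff_straight (A : algType K) (ea : loop_gen D -> A)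
    (eb : borel_gen D -> A) : Prop := straight aff_c aff_c' aff_sh aff_ex ea eb.

Section BorelLift.
Variables (A : algType K) (eb : borel_gen D -> A).
Local Notation e := (@fgen K (borel_gen D)).

(* [T] is a natural expression in the generators of the Borel algebra. *)
Lemma borel_kernel
    (T : forall B : algType K, (hh D -> B) -> ('I_n -> int -> B) -> ('I_n -> int -> B) -> B)
    (J : A -> Prop) :
  (forall (B C : algType K) (f : {lrmorphism B -> C}) k h x,
    f (T B k h x) = T C (fun c => f (k c)) (fun i m => f (h i m)) (fun i m => f (x i m))) ->
  (forall (B : algType K) k h x, cartan_ok k h -> weight_ok k true x ->
    hx_ok h true x -> loop_ok true x -> T B k h x = 0) ->
  (forall d, pres_pi (Pborel D) d = 0 -> J (free_lift eb d)) ->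
  J (T A (borel_k eb) (borel_h eb) (borel_x eb)).
Proof.
move=> Tf T0 Jd.
have Tlift (B : algType K) (b : borel_gen D -> B) :
    free_lift b (T _ (borel_k e) (borel_h e) (borel_x e)) =
    T B (borel_k b) (borel_h b) (borel_x b).
  by rewrite Tf borel_k_lift borel_h_lift borel_x_lift.
(* Over the free algebra, T is an element whose image in the Borel algebra is zero, since all
   relations hold there. So it is a consequence of the relators, even though [eb] need not satisfy
   them. *)
rewrite -Tlift; apply: Jd; rewrite pres_piE Tlift.
by have /holds_borel[kh kx hx xx] := @holds_gen R (borel_gen D) (Pborel D); exact: T0.
Qed.

End BorelLift.

Section Straight.
Variables (A : algType K) (ea : loop_gen D -> A) (eb : borel_gen D -> A).
Let k := borel_k eb.
Let h := borel_h eb.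
Let x := borel_x eb.
Let y := loop_x ea.

Lemma aff_straightP : aff_straight ea eb <->
  [/\ forall c j m, k c * y j m = qpow D (- simple_root D j c) *: (y j m * k c),
      forall i l j m, h i l * y j m = y j m * h i l + hx_coef false i l j *: y j (m + l)
    & forall i m j m', x i m * y j m' = y j m' * x i m + psi k h i j (m + m')].
Proof.
have exE i m j m' : free_lift eb (aff_ex (inr (i, m)) (j, m')) = psi k h i j (m + m').
  by rewrite /aff_ex lrmorph_psi borel_k_lift borel_h_lift.
split=> [st|[ky hy xy] [[c|[i u]]|[i m]] [j m']].
  split=> [c j m|i l j m|i m j m'].
  - by have := st (inl (inl c)) (j, m); rewrite scale0r addr0 free_lift0 addr0.
  - have [->|l0] := eqVneq l 0.
      by rewrite hx_coef0 /h /borel_h cartan_h0 mulr0 mul0r scale0r addr0.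
    have -> : l = val (exist _ l l0 : {m : int | m != 0}) by [].
    have := st (inl (inr (i, exist _ l l0))) (j, m).
    by rewrite free_lift0 addr0 scale1r /h /borel_h cartan_hE.
  - have := st (inr (i, m)) (j, m').
    by rewrite scale0r addr0 scale1r exE.
- rewrite scale0r addr0 free_lift0 addr0; exact: ky.
- rewrite free_lift0 addr0 scale1r.
  by have := hy i (val u) j m'; rewrite /h /borel_h cartan_hE.
- rewrite scale0r addr0 scale1r exE; exact: xy.
Qed.

End Straight.

(** Moving x^- to the left of a relator leaves a multiple of x^- times the relator, plus a residue
    in k, h and x^+ alone; [borel_kernel] disposes of the residue. *)
Lemma aff_left_stable (E : algType K) (ea : loop_gen D -> E) (eb : borel_gen D -> E) :
  aff_straight ea eb -> forall J : E -> Prop, lin_closed J ->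
  (forall u v, J v -> J (u * v)) ->
  (forall d, pres_pi (Pborel D) d = 0 -> J (free_lift eb d)) ->
  forall u a, rels (Pborel D) u -> J (free_lift eb u * ea a).
Proof.
move=> /aff_straightP[ky hy xy] J [J0 JD] JM Jd u [i0 m0] uP.
have [fw bw] := borel_rels_lift eb.
have JR z : borel_rel (borel_k eb) (borel_h eb) (borel_x eb) z -> J z.
  by move=> /bw[v vP ->]; apply: Jd; exact: pres_pi_rels.
have JZ c v : J v -> J (c *: v) by move=> Jv; rewrite -[_ *: _]addr0; exact: JD.
have JA v w : J v -> J w -> J (v + w) by move=> Jv; rewrite -[v]scale1r; exact: JD.
move: (free_lift eb u) (fw u uP) => z zR; rewrite -/(loop_x ea i0 m0).
have Jz := JR z zR.
case: zR Jz => [{}z [c c'||c i l l0|i j l l' l0 l'0]|c j m|i j l m l0|{}z zR] Jz.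
- have -> : (borel_k eb c * borel_k eb c' - borel_k eb (c + c')) * loop_x ea i0 m0 =
      qpow D (- simple_root D i0 (c + c')) *: (loop_x ea i0 m0 *
        (borel_k eb c * borel_k eb c' - borel_k eb (c + c'))).
    rewrite mulrBl mulrBr ky scalerBr; congr (_ - _).
    rewrite -mulrA ky mul_scaler mulrA ky mul_scalel scalerA mulrC -qpowD mulrA.
    by rewrite raddfD opprD.
  exact/JZ/JM.
- have -> : (borel_k eb 0 - 1) * loop_x ea i0 m0 = loop_x ea i0 m0 * (borel_k eb 0 - 1).
    by rewrite mulrBl mulrBr ky raddf0 oppr0 qpow0 scale1r mulr1 mul1r.
  exact: JM.
- have -> : comm (borel_k eb c) (borel_h eb i l) * loop_x ea i0 m0 =
      qpow D (- simple_root D i0 c) *: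
        (loop_x ea i0 m0 * comm (borel_k eb c) (borel_h eb i l)).
    exact: kh_transport (ky _ _ _) (ky _ _ _) (hy _ _ _ _).
  exact/JZ/JM.
- have -> : comm (borel_h eb i l) (borel_h eb j l') * loop_x ea i0 m0 =
      loop_x ea i0 m0 * comm (borel_h eb i l) (borel_h eb j l').
    apply: comm_transport_l; try exact: hy.
    by rewrite [m0 + l + l']addrAC; exact: hy.
  exact: JM.
- have k1 : qpow D (- simple_root D i0 (- c)) * qpow D (- simple_root D i0 c) = 1.
    by rewrite -qpowD raddfN opprK subrr qpow0.
  rewrite (weight_transport _ (ky c i0 m0) (ky (- c) i0 m0) k1 (xy j m i0 m0)).
  apply: JA; first exact: JM.
  pose T (B : algType K) (k : hh D -> B) h (x : 'I_n -> int -> B) :=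
    qpow D (- simple_root D i0 (- c)) *: (k c * psi k h j i0 (m + m0) * k (- c))
    - qpow D ((pm true)%:~R * simple_root D j c) *: psi k h j i0 (m + m0).
  apply: (@borel_kernel _ eb T) Jd => [B C f k h x|B k h x kh kx hx xx].
    have fZ a b : f (a *: b) = a *: f b by exact: linearZ.
    by rewrite /T raddfB /= fZ [X in _ - X]fZ !rmorphM /= !lrmorph_psi.
  rewrite /T (psi_comm_k kh) -mulrA (cartan_okNr kh) mulr1 mul1r raddfN opprK.
  (* For j = i0 the weights of x^+ and x^- are opposite and cancel; otherwise psi is zero. *)
  have [->|ji] := eqVneq j i0; first by rewrite subrr.
  by rewrite psi_neq // !scaler0 subrr.
- rewrite (hx_transport _ (hy i l i0 m0) (xy j m i0 m0) (xy j m i0 (m0 + l))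
    (xy j (l + m) i0 m0)).
  apply: JA; first exact: JM.
  pose T (B : algType K) (k : hh D -> B) h (x : 'I_n -> int -> B) :=
    h i l * psi k h j i0 (m + m0) - psi k h j i0 (m + m0) * h i l
    - hx_coef false i l i0 *: psi k h j i0 (m + (m0 + l))
    - hx_coef true i l j *: psi k h j i0 (l + m + m0).
  apply: (@borel_kernel _ eb T) Jd => [B C f k h x|B k h x kh kx hx xx].
    have fZ a b : f (a *: b) = a *: f b by exact: linearZ.
    have fp l' := lrmorph_psi f k h j i0 l'.
    rewrite /T !raddfB /= (fZ (hx_coef false i l i0)) (fZ (hx_coef true i l j)).
    by rewrite !rmorphM /= !fp.
  rewrite /T (psi_comm_h kh) subrr sub0r.
  have -> : l + m + m0 = m + (m0 + l) by rewrite -[LHS]addrA [LHS]addrC -[LHS]addrA.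
  have [->|ji] := eqVneq j i0; first by rewrite hx_coefN scaleNr opprK subrr.
  by rewrite psi_neq // !scaler0 oppr0 addr0.
- case: zR => [[i j m m']|[i j m m' ij]] in Jz *.
    rewrite -/(exch_elt _ (borel_x eb i) (borel_x eb j) m m').
    rewrite (exch_elt_comm _ _ _ (fun m => xy i m i0 m0) (fun m => xy j m i0 m0)).
    rewrite -addrA; apply: JA; first exact: JM.
    apply: (@borel_kernel _ eb (fun B k h x => exch_res true k h x i j m m' i0 m0)) Jd.
      by move=> B C f k h x; exact: lrmorph_exch_res.
    by move=> B k h x kh kx hx xx; exact: exch_res0 kh kx hx _ _ _ _ _ _.
  rewrite -/(serre_sym (q_ i) (fun a => borel_x eb i (m a)) (borel_x eb j m')).
  rewrite (serre_sym_ins (@q_gen _ _ i) (q_neq0 i) (fun a => xy i (m a) i0 m0)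
    (xy j m' i0 m0)).
  apply: JA; first exact: JM.
  apply: (@borel_kernel _ eb (fun B k h x => serre_res k h x m m' i0 m0)) Jd.
    by move=> B C f k h x; exact: lrmorph_serre_res.
  move=> B k h x kh kx hx /loop_okP[xx _].
  by apply: (serre_res0 kh kx hx).
Qed.

Lemma aff_weight_minus (E : algType K) (k : hh D -> E) h (y : 'I_n -> int -> E) :
  cartan_ok k h ->
  (forall c j m, k c * y j m = qpow D (- simple_root D j c) *: (y j m * k c)) ->
  weight_ok k false y.
Proof.
by move=> kh ky c j m; rewrite ky mul_scalel -mulrA (cartan_okNr kh) mulr1 mulN1r.
Qed.

Lemma aff_hx_minus (E : algType K) (h : 'I_n -> int -> E) (y : 'I_n -> int -> E) :
  (forall i l j m, h i l * y j m = y j m * h i l + hx_coef false i l j *: y j (m + l)) ->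
  hx_ok h false y.
Proof. by move=> hy i j m m' _; rewrite hy addrAC subrr add0r [m' + m]addrC. Qed.

Lemma right_gen_lin (E : algType K) (Q : E -> Prop) (S : E -> Prop) (c : K) z v w :
  (forall u, S u -> Q u) -> Q z -> in_span S w -> right_gen Q (c *: (z * v) + w).
Proof.
move=> SQ Qz Sw; apply: in_spanP; first by exists z, v.
elim: Sw => [|d u u' Su _ IH]; first by constructor.
by apply: in_spanP IH; exists u, 1; rewrite mulr1; split=> //; exact: SQ.
Qed.

Lemma aff_right_stable (E : algType K) (ea : loop_gen D -> E) (eb : borel_gen D -> E) :
  aff_straight ea eb -> holds (Pborel D) eb -> forall L : E -> Prop, lin_closed L ->
  (forall u v, L u -> L (u * v)) ->
  (forall u, rels (Ploop D false) u -> L (free_lift ea u)) -> word_induction eb L ->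
  holds (Ploop D false) ea.
Proof.
move=> /aff_straightP[ky hy xy] /holds_borel[kh kx hx xx] L _ _ LR WI.
have [fw bw] := loop_rels_lift false ea.
have Lz z : loop_rel false (loop_x ea) z -> L z by move=> /bw[u /LR Lu ->].
have wm := aff_weight_minus kh ky; have hm := aff_hx_minus hy.
set k := borel_k eb in kh ky xy wm kx; set h := borel_h eb in kh hy xy hm hx.
set y := loop_x ea in ky hy xy fw bw wm hm Lz.
have yk c j m : y j m * k c = qpow D (simple_root D j c) *: (k c * y j m).
  by rewrite ky scalerA -qpowD subrr qpow0 scale1r.
have yh i l j m : y j m * h i l = h i l * y j m + (- hx_coef false i l j) *: y j (m + l).
  by rewrite hy scaleNr addrK.
(* The sign makes the relation fit the form x y = y x + psi, with x^- as the current and -x^+ as the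
   opposite element. *)
have yx i0 m0 j m : y j m * (- borel_x eb i0 m0) =
    - borel_x eb i0 m0 * y j m + psi k h j i0 (m + m0).
  by rewrite mulrN mulNr xy opprD -addrA psi_sym [m0 + m]addrC addNr addr0.
(* A relator commutes with k up to a nonzero scalar, with h up to relators, and with x^+ exactly; so
   a generator on its left moves to its right. *)
have step (Q : E -> Prop) z g : Q z ->
    (forall c, exists2 d, d != 0 & z * k c = d *: (k c * z)) ->
    (forall (c : 'I_n -> K) hh l, (forall j m, y j m * hh = hh * y j m + c j *: y j (m + l)) ->
      exists2 b, in_span Q b & z * hh = hh * z + b) ->
    (forall i0 m0, z * (- borel_x eb i0 m0) = - borel_x eb i0 m0 * z) ->
    right_gen Q (eb g * z).
  move=> Qz zk zh zx; case: g => [[c|[i u]]|[i m]].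
  - have [d d0 dE] := zk c.
    have -> : eb (inl (inl c)) * z = d^-1 *: (z * k c) + 0.
      by rewrite addr0 dE scalerA mulVf // scale1r.
    apply: (right_gen_lin _ _ (fun u Qu => Qu) Qz); constructor.
  - have := yh i (val u); rewrite {1 2}/h /borel_h cartan_hE => yu.
    have [b Sb bE] := zh _ _ _ yu.
    have -> : eb (inl (inr (i, u))) * z =
        1 *: (z * eb (inl (inr (i, u)))) + ((-1) *: b + 0).
      by rewrite scale1r scaleN1r bE addr0 addrK.
    apply: (right_gen_lin _ _ (fun u Qu => Qu) Qz).
    by apply: in_span_lin => //; constructor.
  - have -> : eb (inr (i, m)) * z = 1 *: (z * borel_x eb i m) + 0.
      rewrite addr0 scale1r; apply: oppr_inj; rewrite -[RHS]mulrN zx mulNr.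
      by [].
    apply: (right_gen_lin _ _ (fun u Qu => Qu) Qz); constructor.
(* (R5) comes first: that the Serre relators commute with x^+ depends on it. *)
have ex0 z : exchange_rel false y z -> z = 0.
  move: z; apply: WI => [z Qz|z g Qz]; first by apply: Lz; left.
  apply: step => //.
  - move=> c; case: Qz => i j m m'.
    exists (qpow D (simple_root D i c) * qpow D (simple_root D j c)).
      by rewrite mulf_neq0 // qpow_neq0.
    exact: exch_elt_scale.
  - by move=> c hh l yhh; exact: exchange_rel_derive yhh Qz.
  - by move=> i0 m0; exact: (exchange_commute kh wm hm (yx i0 m0) Qz).
have yy : exch_ok false y.
  by move=> i j; apply/exch_eltP => m m'; apply: ex0; exact: (ExchangeRel false y).
have se0 z : serre_rel y z -> z = 0.
  move: z; apply: WI => [z Qz|z g Qz]; first by apply: Lz; right.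
  apply: step => //.
  - move=> c; case: Qz => i j m m' ij.
    exists (qpow D (simple_root D i c) ^+ serre_deg i j * qpow D (simple_root D j c)).
      by rewrite mulf_neq0 // ?expf_neq0 // qpow_neq0.
    rewrite -/(serre_sym (q_ i) (fun a => y i (m a)) (y j m')).
    by apply: serre_sym_scale => [a|]; exact: yk.
  - by move=> c hh l yhh; exact: serre_rel_derive yhh Qz.
  - by move=> i0 m0; exact: (serre_commute kh wm hm (yx i0 m0) yy Qz).
by move=> u /fw[/ex0|/se0].
Qed.

Section AffRelations.
Variables (A : algType K) (e : aff_gen D -> A).
Let k := cartan_k (e \o inl).
Let h := cartan_h (e \o inl).
Let x s := loop_x (fun a => e (inr (s, a))).

Lemma aff_rels_lift :
  (forall u, rels (Paff D) u -> aff_rel k h x (free_lift e u)) /\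
  (forall a, aff_rel k h x a -> exists2 u, rels (Paff D) u & a = free_lift e u).
Proof.
pose kf := cartan_k (@fgen K (aff_gen D) \o inl).
pose hf := cartan_h (@fgen K (aff_gen D) \o inl).
pose xf s := loop_x (fun a => @fgen K (aff_gen D) (inr (s, a))).
have kE : (fun c => free_lift e (kf c)) = k by apply/funext => c; exact: free_lift_gen.
have hE : (fun i m => free_lift e (hf i m)) = h.
  apply/funext => i; apply/funext => m; rewrite lrmorph_cartan_h.
  by congr (cartan_h _ i m); apply/funext => a; exact: free_lift_gen.
have xE s : (fun i m => free_lift e (xf s i m)) = x s.
  by apply/funext => i; apply/funext => m; exact: free_lift_gen.
have [cf cb] := cartan_rel_map (free_lift e) kf hf.
have lf s := (loop_rel_map (free_lift e) s (xf s)).1.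
have lb s := (loop_rel_map (free_lift e) s (xf s)).2.
rewrite kE hE in cf cb; rewrite /= in lf lb.
have wE s c j m : free_lift e (weight_elt kf (xf s) s c j m) = weight_elt k (x s) s c j m.
  by rewrite lrmorph_weight_elt kE xE.
have hrE s i j m m' :
    free_lift e (hx_elt hf (xf s) s i j m m') = hx_elt h (x s) s i j m m'.
  by rewrite lrmorph_hx_elt hE xE.
have xrE i j m m' : free_lift e (xx_elt kf hf (xf true) (xf false) i j m m') =
    xx_elt k h (x true) (x false) i j m m'.
  by rewrite lrmorph_xx_elt kE hE !xE.
split=> [u|a].
  case=> [/cf|[[s c j m]|[[s i j m m' m0]|[[i j m m']|[s /lf]]]]]; first by left.
  - right; left; rewrite -/(weight_elt kf (xf s) s c j m) wE; exact: (WeightRel k x).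
  - right; right; left; rewrite -/(hx_elt hf (xf s) s i j m m') hrE.
    exact: (HxRel h x).
  - do 3!right; left; rewrite -/(xx_elt kf hf (xf true) (xf false) i j m m') xrE.
    exact: (XxRel k h x).
  - by rewrite xE; do 4!right; exists s.
case=> [/cb[u uP ->]|[[s c j m]|[[s i j m m' m0]|[[i j m m']|[s xa]]]]].
- by exists u => //; left.
- exists (weight_elt kf (xf s) s c j m); last by rewrite wE.
  by right; left; exact: (WeightRel kf xf).
- exists (hx_elt hf (xf s) s i j m m'); last by rewrite hrE.
  by right; right; left; exact: (HxRel hf xf).
- exists (xx_elt kf hf (xf true) (xf false) i j m m'); last by rewrite xrE.
  by do 3!right; left; exact: (XxRel kf hf xf).
- have := lb s a; rewrite xE => /(_ xa)[u uP ->]; exists u => //.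
  by do 4!right; exists s.
Qed.

(** Straightening accounts for (R4) and for (R2), (R3) of sign -; the other relations belong to B or
    to x^-. *)
Lemma holds_aff : holds (Paff D) e <->
  [/\ aff_straight (e \o aff_ia) (e \o aff_ib), holds (Pborel D) (e \o aff_ib)
    & holds (Ploop D false) (e \o aff_ia)].
Proof.
have [fw bw] := aff_rels_lift.
have affE : holds (Paff D) e <-> (forall a, aff_rel k h x a -> a = 0).
  by split=> [eP a /bw[u /eP e0 ->]|eP u /fw /eP].
apply: iff_trans affE _.
split=> [ok|[/aff_straightP[ky hy xy] /holds_borel[kh kx hx xx] /holds_loop yy] a].
  have kh : cartan_ok k h.
    by split=> [a ka|i]; [apply: ok; left | exact: cartan_h0].
  have kx s : weight_ok k s (x s).
    move=> c j m; apply/eqP; rewrite -subr_eq0; apply/eqP/ok; right; left.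
    exact: WeightRel.
  have hx s : hx_ok h s (x s).
    move=> i j m m' m0; apply/eqP; rewrite -subr_eq0; apply/eqP/ok.
    by right; right; left; exact: HxRel.
  have xx s : loop_ok s (x s) by move=> a xa; apply: ok; do 4!right; exists s.
  split; [apply/aff_straightP|apply/holds_borel|apply/holds_loop; exact: xx].
    rewrite -[borel_k (e \o aff_ib)]/k -[borel_h (e \o aff_ib)]/h.
    rewrite -[borel_x (e \o aff_ib)]/(x true) -[loop_x (e \o aff_ia)]/(x false).
    split=> [c j m|i l j m|i m j m'].
    - by rewrite (weight_okE kh (kx false)) mulN1r.
    - have [->|l0] := eqVneq l 0.
        by rewrite hx_coef0 (proj2 kh) mulr0 mul0r scale0r addr0.
      rewrite [m + l]addrC; apply/eqP; rewrite [X in _ == X]addrC -subr_eq; apply/eqP.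
      exact: (hx false).
    - apply/eqP; rewrite addrC -subr_eq -subr_eq0; apply/eqP/ok.
      by do 3!right; left; exact: XxRel.
  by split; [exact: kh|exact: kx|exact: hx|exact: xx].
rewrite -[borel_k (e \o aff_ib)]/k -[borel_h (e \o aff_ib)]/h in kh kx hx ky hy xy.
rewrite -[borel_x (e \o aff_ib)]/(x true) in kx hx xx xy.
rewrite -[loop_x (e \o aff_ia)]/(x false) in ky hy xy yy.
have ym := aff_weight_minus kh ky; have hm := aff_hx_minus hy.
case=> [|[[s c j m]|[[s i j m m' m0]|[[i j m m']|[s]]]]].
- exact: (proj1 kh).
- by apply/eqP; rewrite subr_eq0; apply/eqP; case: s; [exact: kx | exact: ym].
- by apply/eqP; rewrite subr_eq0; apply/eqP; case: s; [exact: hx | exact: hm].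
- by rewrite -/(psi k h i j (m + m')) /comm xy [_ + psi _ _ _ _ _]addrC addrK subrr.
- by case: s; [exact: xx | exact: yy].
Qed.

End AffRelations.

End Affinization.

(** * Triangular decompositions *)

Section TensorLift.
Variables (K : comNzRingType) (U V : lmodType K).

Lemma tens_Dl c (u u' : U) (v : V) : tens (c *: u + u') v = c *: tens u v + tens u' v.
Proof.
have -> : c *: tens u v + tens u' v =
    lpi (@tens_rel _ U V) (c *: free_tens u v + free_tens u' v).
  exact/esym/lpi_is_linear.
by apply/lpi_eq/in_span_gen; exact: tens_linl.
Qed.

Lemma tens_Dr c (u : U) (v v' : V) : tens u (c *: v + v') = c *: tens u v + tens u v'.
Proof.
have -> : c *: tens u v + tens u v' =
    lpi (@tens_rel _ U V) (c *: free_tens u v + free_tens u v').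
  exact/esym/lpi_is_linear.
by apply/lpi_eq/in_span_gen; exact: tens_linr.
Qed.

Lemma tens_ind (Q : tensor U V -> Prop) : Q 0 ->
  (forall c u v x, Q x -> Q (c *: tens u v + x)) -> forall x, Q x.
Proof.
move=> Q0 QD x; rewrite -[x]lpiK; move: (repr x) => w {x}.
rewrite [w](monalgE w).
elim/big_rec: _ => [|[u v] z _ Qz]; first by rewrite raddf0.
rewrite malgUZ lpi_is_linear; exact: QD.
Qed.

Lemma tens_ext (W : lmodType K) (f g : tensor U V -> W) : linear f -> linear g ->
  (forall u v, f (tens u v) = g (tens u v)) -> f =1 g.
Proof.
move=> fL gL fg; elim/tens_ind => [|c u v x IH]; first by rewrite !linear_fun0.
by rewrite fL gL fg IH.
Qed.

Variables (W : lmodType K) (b : U -> V -> W).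
Hypothesis bl : forall v, linear (b^~ v).
Hypothesis br : forall u, linear (b u).

Local Notation ext := (malg_ext (fun k : (U * V)%type => b k.1 k.2)).

Lemma tens_rel_span x : in_span (@tens_rel _ U V) x -> ext x = 0.
Proof.
have m0 : ext 0 = 0 := linear_fun0 (malg_ext_linear _).
have mD x' y' : ext (x' + y') = ext x' + ext y'.
  by rewrite -[x']scale1r malg_ext_linear !scale1r.
have mB x' y' : ext (x' - y') = ext x' - ext y'.
  by rewrite mD; congr (_ + _); apply/eqP; rewrite -addr_eq0 -mD addNr m0.
elim=> [//|c w z Sw _ IH]; rewrite malg_ext_linear IH addr0.
suff -> : ext w = 0 by rewrite scaler0.
by case: Sw => [k u u' v|k u v v']; rewrite mB malg_ext_linear !malg_extU;
  rewrite ?bl ?br subrr.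
Qed.

Definition tens_lift_fun (x : tensor U V) : W := ext (repr x).

Lemma tens_lift_pi w : tens_lift_fun (lpi (@tens_rel _ U V) w) = ext w.
Proof.
have := tens_rel_span (repr_lpi (@tens_rel _ U V) w).
rewrite addrC -scaleN1r malg_ext_linear scaleN1r addrC => /eqP.
by rewrite subr_eq0 => /eqP.
Qed.

Lemma tens_lift_linear : linear tens_lift_fun.
Proof.
move=> c x y; rewrite -[x]lpiK -[y]lpiK -linearP !tens_lift_pi.
exact: malg_ext_linear.
Qed.

HB.instance Definition _ :=
  GRing.isLinear.Build K (tensor U V) W *:%R tens_lift_fun tens_lift_linear.

Definition tens_lift : {linear tensor U V -> W} := tens_lift_fun.

Lemma tens_liftE u v : tens_lift (tens u v) = b u v.
Proof. exact: etrans (tens_lift_pi _) (malg_extU _ _). Qed.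

End TensorLift.

Section SubalgebraVal.
Variables (K : comNzRingType) (B : algType K) (S : subalgClosed B).

Lemma subalg_valP (c : K) (x y : subalg S) : val (c *: x + y) = c *: val x + val y.
Proof. by []. Qed.

Lemma subalg_valM (x y : subalg S) : val (x * y) = val x * val y.
Proof. by []. Qed.

Lemma subalg_val1 : val (1 : subalg S) = 1.
Proof. by []. Qed.

End SubalgebraVal.

Section SubalgebraLift.
Variables (K : comNzRingType) (A B : algType K) (S : subalgClosed B).
Variables (j : {lrmorphism A -> B}) (jS : forall x, j x \in S).

Definition subalg_lift_of (_ : forall x, j x \in S) (x : A) : subalg S :=
  Sub (j x) (jS x).

Local Notation f := (subalg_lift_of jS).

Lemma subalg_lift_linear : linear f.
Proof.
move=> c x y; apply: val_inj; rewrite subalg_valP; exact: linearP.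
Qed.

HB.instance Definition _ :=
  GRing.isLinear.Build K A (subalg S) *:%R f subalg_lift_linear.

Lemma subalg_lift_monoid : monoid_morphism f.
Proof.
split=> [|x y]; apply: val_inj; first by rewrite subalg_val1; exact: rmorph1.
by rewrite subalg_valM; exact: rmorphM.
Qed.

HB.instance Definition _ :=
  GRing.isMonoidMorphism.Build A (subalg S) f subalg_lift_monoid.

Definition subalg_lift : {lrmorphism A -> subalg S} := f.

Lemma subalg_liftE x : val (subalg_lift x) = j x. Proof. by []. Qed.

End SubalgebraLift.

Section TriangularDecomposition.
Variables (K : comNzRingType) (U Am A0 Ap : algType K).
Variables (Sm S0 Sp : subalgClosed U).
Variables (jm : {lrmorphism Am -> U}) (j0 : {lrmorphism A0 -> U})
  (jp : {lrmorphism Ap -> U}).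
Hypothesis jmS : forall x, jm x \in Sm.
Hypothesis j0S : forall x, j0 x \in S0.
Hypothesis jpS : forall x, jp x \in Sp.
Hypothesis Smj : forall u, u \in Sm -> exists x, u = jm x.
Hypothesis S0j : forall u, u \in S0 -> exists x, u = j0 x.
Hypothesis Spj : forall u, u \in Sp -> exists x, u = jp x.
Hypothesis trilinear : forall (W : lmodType K) (be : Am -> A0 -> Ap -> W),
  (forall h z, linear (fun y => be y h z)) ->
  (forall y z, linear (fun h => be y h z)) ->
  (forall y h, linear (be y h)) ->
  exists2 f : U -> W, linear f & forall y h z, f (jm y * j0 h * jp z) = be y h z.
Hypothesis spanning : forall u,
  in_span (fun v => exists y h z, v = jm y * j0 h * jp z) u.
Variables (em : {linear Am -> K^o}) (e0 : {linear A0 -> K^o}) (ep : {linear Ap -> K^o}).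
Hypotheses (em1 : em 1 = 1) (e01 : e0 1 = 1) (ep1 : ep 1 = 1).

Let scale_linl (V : lmodType K) (a : K) (v : V) (X : lmodType K) (e : {linear X -> K^o}) :
  linear (fun x => (a * (e x : K)) *: v).
Proof.
by move=> c x y; rewrite linearP mulrDr scalerDl scalerA mulrCA.
Qed.

(** Applying the augmentations to the other two factors gives a trilinear map whose extension to U
    is a left inverse of [jm]. *)
Lemma triangular_injm : injective jm.
Proof.
have [|||f fL fE] := trilinear (be := fun y h z => ((e0 h : K) * (ep z : K)) *: y).
- by move=> h z c x y; rewrite scalerDr !scalerA mulrC.
- by move=> y z c x x'; rewrite linearP mulrDl scalerDl scalerA mulrA.
- by move=> y h; exact: scale_linl.
apply: (can_inj (g := f)) => y; have := fE y 1 1.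
by rewrite !rmorph1 !mulr1 e01 ep1 mulr1 scale1r.
Qed.

Lemma triangular_inj0 : injective j0.
Proof.
have [|||f fL fE] := trilinear (be := fun y h z => ((em y : K) * (ep z : K)) *: h).
- by move=> h z c x x'; rewrite linearP mulrDl scalerDl scalerA mulrA.
- by move=> h z c x y; rewrite scalerDr !scalerA mulrC.
- by move=> y h; exact: scale_linl.
apply: (can_inj (g := f)) => h; have := fE 1 h 1.
by rewrite !rmorph1 mulr1 mul1r em1 ep1 mulr1 scale1r.
Qed.

Lemma triangular_injp : injective jp.
Proof.
have [|||f fL fE] := trilinear (be := fun y h z => ((em y : K) * (e0 h : K)) *: z).
- by move=> h z c x x'; rewrite linearP mulrDl scalerDl scalerA mulrA.
- by move=> y z; exact: scale_linl.
- by move=> h z c x y; rewrite scalerDr !scalerA mulrC.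
apply: (can_inj (g := f)) => z; have := fE 1 1 z.
by rewrite !rmorph1 !mul1r em1 e01 mulr1 scale1r.
Qed.

(** The inverse of multiplication is the extension to U of the trilinear map into the tensor
    product; spanning shows that it is two-sided. *)
Lemma triangularP : triangular_decomposition Sm S0 Sp.
Proof.
have b1l (h : subalg S0) : linear (fun a : subalg Sm => val a * val h).
  by move=> c x y; rewrite subalg_valP mulrDl scalerAl.
have b1r (a : subalg Sm) : linear (fun h : subalg S0 => val a * val h).
  by move=> c x y; rewrite subalg_valP mulrDr scalerAr.
pose mu1 := tens_lift b1l b1r.
have b2l (b : subalg Sp) : linear (fun t => mu1 t * val b).
  by move=> c x y; rewrite linearP mulrDl scalerAl.
have b2r t : linear (fun b : subalg Sp => mu1 t * val b).
  by move=> c x y; rewrite subalg_valP mulrDr scalerAr.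
pose mu := tens_lift b2l b2r.
have muE a h b : mu (tens (tens a h) b) = val a * val h * val b.
  by rewrite /mu tens_liftE /mu1 tens_liftE.
exists mu; split=> //.
pose fm := subalg_lift jmS; pose f0 := subalg_lift j0S; pose fp := subalg_lift jpS.
have [|||nu nuL nuE] :=
    trilinear (be := fun y h z => tens (tens (fm y) (f0 h)) (fp z)).
- by move=> h z c x y; rewrite linearP !tens_Dl.
- by move=> y z c x x'; rewrite linearP tens_Dr tens_Dl.
- by move=> y h c x x'; rewrite linearP tens_Dr.
have val_of (A : algType K) (S : subalgClosed U) (j : {lrmorphism A -> U})
    (jS : forall x, j x \in S) : (forall u, u \in S -> exists x, u = j x) ->
    forall a : subalg S, exists x, a = subalg_lift jS x.
  move=> Sj a; have [x ax] := Sj _ (valP a); exists x; exact: val_inj.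
exists nu => [t|u].
  pose id_t (t : tensor (tensor (subalg Sm) (subalg S0)) (subalg Sp)) := t.
  move: t; apply: (@tens_ext _ _ _ _ (nu \o mu) id_t) => [c x y|//|t b].
    by rewrite /= linearP nuL.
  move: t; apply: (@tens_ext _ _ _ _ (fun t => nu (mu (tens t b))) (fun t => tens t b)).
  - by move=> c x y; rewrite tens_Dl linearP nuL.
  - by move=> c x y; rewrite tens_Dl.
  move=> a h; have [y ->] := val_of _ _ _ jmS Smj a; have [x ->] := val_of _ _ _ j0S S0j h.
  have [z ->] := val_of _ _ _ jpS Spj b.
  by rewrite muE; exact: nuE.
elim: (spanning u) => [|c v w [y [h [z ->]]] _ IH]; first by rewrite linear_fun0 // raddf0.
by rewrite nuL linearP IH nuE muE.
Qed.

End TriangularDecomposition.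

Section PresentedImage.
Variables (K : comNzRingType) (X : choiceType) (P : presentation K X) (A : algType K).
Variables (j : {lrmorphism pres_alg P -> A}) (S : A -> Prop).

Lemma pres_image_mem : (forall x, S (j (pres_gen P x))) -> forall u, j u \in alg_gen S.
Proof.
move=> Sj u; elim/pres_ind: u => [||c u v Su Sv|x u Su].
- by rewrite raddf0 rpred0.
- by rewrite rmorph1 rpred1.
- by rewrite linearP rpredD // rpredZ.
- rewrite rmorphM rpredM //; apply/alg_genP/in_alg_gen_base; exact: Sj.
Qed.

Lemma pres_image_onto : (forall a, S a -> exists u, a = j u) ->
  forall a, a \in alg_gen S -> exists u, a = j u.
Proof.
move=> Sj a /alg_genP; elim=> [b /Sj//||c b d _ [u ->] _ [v ->]|b d _ [u ->] _ [v ->]].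
- by exists 1; rewrite rmorph1.
- by exists (c *: u + v); rewrite linearP.
- by exists (u * v); rewrite rmorphM.
Qed.

End PresentedImage.

Section TwoSteps.
Variables (K : comNzRingType) (U B Am A0 Ap : algType K).
Variables (jm : {lrmorphism Am -> U}) (jB : {lrmorphism B -> U}).
Variables (i0 : {lrmorphism A0 -> B}) (ip : {lrmorphism Ap -> B}).
Let j0 : {lrmorphism A0 -> U} := jB \o i0.
Let jp : {lrmorphism Ap -> U} := jB \o ip.

Hypothesis coindU : forall (W : lmodType K) (be : Am -> B -> W),
  (forall z, linear (be^~ z)) -> (forall y, linear (be y)) ->
  exists2 f : U -> W, linear f & forall y z, f (jm y * jB z) = be y z.
Hypothesis coindB : forall (W : lmodType K) (be : A0 -> Ap -> W),
  (forall z, linear (be^~ z)) -> (forall y, linear (be y)) ->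
  exists2 f : B -> W, linear f & forall y z, f (i0 y * ip z) = be y z.
Hypothesis spanU : forall u, in_span (fun v => exists y z, v = jm y * jB z) u.
Hypothesis spanB : forall u, in_span (fun v => exists y z, v = i0 y * ip z) u.

(** Currying: the form is first extended over B with values in the linear maps from [Am] to W, which
    makes it bilinear on [Am] and B. *)
Lemma two_step_trilinear (W : lmodType K) (be : Am -> A0 -> Ap -> W) :
  (forall h z, linear (fun y => be y h z)) ->
  (forall y z, linear (fun h => be y h z)) ->
  (forall y h, linear (be y h)) ->
  exists2 f : U -> W, linear f & forall y h z, f (jm y * j0 h * jp z) = be y h z.
Proof.
move=> bm b0 bp.
have [||g gL gE] := coindB (be := fun h z => mk_linmap (bm h z)).
- by move=> z c x y; apply/linmapP => w; rewrite lappD lappZ !mk_linmapE b0.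
- by move=> h c x y; apply/linmapP => w; rewrite lappD lappZ !mk_linmapE bp.
have [||f fL fE] := coindU (be := fun y b => lapp (g b) y).
- by move=> b c x y; rewrite lappP.
- by move=> y c x x'; rewrite gL lappD lappZ.
exists f => // y h z; rewrite -mulrA -[j0 h * jp z](rmorphM jB) fE gE.
by rewrite mk_linmapE.
Qed.

Lemma two_step_spanning u :
  in_span (fun v => exists y h z, v = jm y * j0 h * jp z) u.
Proof.
elim: (spanU u) => [|c v w [y [b ->]] _ IH]; first by constructor.
apply: in_span_lin IH; elim: (spanB b) => [|d x x' [h [z ->]] _ IH].
  by rewrite raddf0 mulr0; constructor.
rewrite linearP mulr_linr; apply: in_span_lin IH; apply: in_span_gen.
by exists y, h, z; rewrite rmorphM mulrA.
Qed.

End TwoSteps.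

Section Main.
Variables (R : realType) (D : quantum_datum R).
Local Notation K := R[i].

Lemma aff_gen_holds : [/\
  aff_straight (pres_gen (Paff D) \o @aff_ia _ D) (pres_gen (Paff D) \o @aff_ib _ D),
  holds (Pborel D) (pres_gen (Paff D) \o @aff_ib _ D)
  & holds (Ploop D false) (pres_gen (Paff D) \o @aff_ia _ D)].
Proof. exact/holds_aff/holds_gen. Qed.

Lemma aff_holds_borel : holds (Pborel D) (pres_gen (Paff D) \o @aff_ib _ D).
Proof. by have [] := aff_gen_holds. Qed.

Lemma aff_holds_minus : holds (Ploop D false) (pres_gen (Paff D) \o @aff_ia _ D).
Proof. by have [] := aff_gen_holds. Qed.

Definition borel_j0 : {lrmorphism cartan_alg D -> pres_alg (Pborel D)} :=
  pres_lift (@borel_holds_cartan R D).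
Definition borel_jp : {lrmorphism loop_alg D true -> pres_alg (Pborel D)} :=
  pres_lift (@borel_holds_loop R D).
Definition Uq_jB : {lrmorphism pres_alg (Pborel D) -> Uq D} := pres_lift aff_holds_borel.
Definition Uq_jm : {lrmorphism loop_alg D false -> Uq D} := pres_lift aff_holds_minus.
Definition Uq_j0 : {lrmorphism cartan_alg D -> Uq D} := Uq_jB \o borel_j0.
Definition Uq_jp : {lrmorphism loop_alg D true -> Uq D} := Uq_jB \o borel_jp.

Lemma borel_coinduction (W : lmodType K) (be : cartan_alg D -> loop_alg D true -> W) :
  (forall z, linear (be^~ z)) -> (forall y, linear (be y)) ->
  exists2 f : pres_alg (Pborel D) -> W, linear f &
    forall y z, f (borel_j0 y * borel_jp z) = be y z.
Proof.
apply: (@coinduction _ _ _ _ _ _ _ inl inr id _ _ (@borel_c _ D) (fun _ _ => 0)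
  (fun _ a => a) (@borel_ex _ D)) => //.
- exact: borel_left_stable.
- exact: borel_right_stable.
- exact: borel_complete.
Qed.

Lemma borel_spanning u :
  in_span (fun v => exists y z, v = borel_j0 y * borel_jp z) u.
Proof.
apply: (@coind_spanning _ _ _ _ _ _ _ inl inr _ (@borel_c _ D) (fun _ _ => 0)
  (fun _ a => a) (@borel_ex _ D)).
  by case=> [a|b]; [left; exists a | right; exists b].
exact/borel_ok_straight/holds_gen.
Qed.

Lemma Uq_coinduction (W : lmodType K) (be : loop_alg D false -> pres_alg (Pborel D) -> W) :
  (forall z, linear (be^~ z)) -> (forall y, linear (be y)) ->
  exists2 f : Uq D -> W, linear f & forall y z, f (Uq_jm y * Uq_jB z) = be y z.
Proof.
apply: (@coinduction _ _ _ _ _ _ _ (@aff_ia _ D) (@aff_ib _ D) (@aff_split _ D) _ _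
  (@aff_c _ D) (@aff_c' _ D) (@aff_sh _ D) (@aff_ex _ D)) => //.
- by case.
- exact: aff_left_stable.
- exact: aff_right_stable.
- by move=> E e st ha hb; apply/holds_aff.
Qed.

Lemma Uq_spanning u : in_span (fun v => exists y z, v = Uq_jm y * Uq_jB z) u.
Proof.
apply: (@coind_spanning _ _ _ _ _ _ _ (@aff_ia _ D) (@aff_ib _ D) _
  (@aff_c _ D) (@aff_c' _ D) (@aff_sh _ D) (@aff_ex _ D)).
  case=> [a|[[] a]]; [right; exists (inl a) | right; exists (inr a) | left; exists a];
  by [].
by have [] := aff_gen_holds.
Qed.

Lemma Uq_jm_gen a : Uq_jm (pres_gen (Ploop D false) a) = pres_gen (Paff D) (inr (false, a)).
Proof. exact: pres_lift_gen. Qed.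

Lemma Uq_j0_gen a : Uq_j0 (pres_gen (Pcartan D) a) = pres_gen (Paff D) (inl a).
Proof.
have -> : Uq_j0 (pres_gen (Pcartan D) a) = Uq_jB (borel_j0 (pres_gen (Pcartan D) a)) by [].
by rewrite /borel_j0 pres_lift_gen; exact: pres_lift_gen.
Qed.

Lemma Uq_jp_gen a : Uq_jp (pres_gen (Ploop D true) a) = pres_gen (Paff D) (inr (true, a)).
Proof.
have -> : Uq_jp (pres_gen (Ploop D true) a) = Uq_jB (borel_jp (pres_gen (Ploop D true) a)) by [].
by rewrite /borel_jp pres_lift_gen; exact: pres_lift_gen.
Qed.

Lemma Uq_jm_x i m : Uq_jm (loop_alg_x D false i m) = Uq_x D false i m.
Proof. exact: (Uq_jm_gen (i, m)). Qed.

Lemma Uq_jp_x i m : Uq_jp (loop_alg_x D true i m) = Uq_x D true i m.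
Proof. exact: (Uq_jp_gen (i, m)). Qed.

(** Supplies the augmentation with value 1 at 1 that the injectivity arguments need;
    [loop_character] does the same for the two halves. *)
Lemma cartan_character :
  holds (Pcartan D) (fun a => cartan_counit a : (K^o : algType K)).
Proof.
apply/holds_cartan; split=> [a|i]; last exact: cartan_h0.
have h0 i m : cartan_h (fun a => cartan_counit a : (K^o : algType K)) i m = 0.
  by rewrite /cartan_h; case: insub.
case=> [c c'||c j m m0|i j m m' m0 m'0].
- by rewrite /cartan_k /= mulr1 subrr.
- by rewrite /cartan_k /= subrr.
- by rewrite /comm h0 mulr0 mul0r subrr.
- by rewrite /comm !h0 mulr0 subrr.
Qed.

Lemma loop_character s : holds (Ploop D s) (fun=> 0 : (K^o : algType K)).
Proof.
apply/holds_loop/loop_okP; split=> [i j m r|i j m m' ij].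
  by rewrite /loop_x !mulr0 scaler0.
rewrite /serre_sym big1 // => w _; rewrite big1 // => l _.
by rewrite /serre_word mulr0 mul0r scaler0.
Qed.

Definition cartan_eps : {linear cartan_alg D -> K^o} := pres_lift cartan_character.
Definition loop_eps s : {linear loop_alg D s -> K^o} := pres_lift (@loop_character s).

Lemma Uq_jm_mem x : Uq_jm x \in Uq_loop D false.
Proof.
by apply: (@pres_image_mem _ _ (Ploop D false)) => -[i m]; exists i, m; exact: Uq_jm_gen.
Qed.

Lemma Uq_jp_mem x : Uq_jp x \in Uq_loop D true.
Proof.
by apply: (@pres_image_mem _ _ (Ploop D true)) => -[i m]; exists i, m; exact: Uq_jp_gen.
Qed.

Lemma Uq_j0_mem x : Uq_j0 x \in Uq_cartan D.
Proof.
apply: (@pres_image_mem _ _ (Pcartan D)) => -[c|[i u]].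
  by left; exists c; exact: Uq_j0_gen.
right; exists i, (val u); split; first exact: (valP u).
by rewrite Uq_j0_gen /Uq_h cartan_hE.
Qed.

Lemma Uq_jm_onto u : u \in Uq_loop D false -> exists x, u = Uq_jm x.
Proof.
apply: (@pres_image_onto _ _ (Ploop D false)) => _ [i [m ->]].
by exists (pres_gen (Ploop D false) (i, m)); rewrite Uq_jm_gen.
Qed.

Lemma Uq_jp_onto u : u \in Uq_loop D true -> exists x, u = Uq_jp x.
Proof.
apply: (@pres_image_onto _ _ (Ploop D true)) => _ [i [m ->]].
by exists (pres_gen (Ploop D true) (i, m)); rewrite Uq_jp_gen.
Qed.

Lemma Uq_j0_h i m : Uq_j0 (cartan_alg_h D i m) = Uq_h D i m.
Proof.
rewrite /cartan_alg_h lrmorph_cartan_h /Uq_h; congr (cartan_h _ i m).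
by apply/funext => a; exact: Uq_j0_gen.
Qed.

Lemma Uq_j0_onto u : u \in Uq_cartan D -> exists x, u = Uq_j0 x.
Proof.
apply: (@pres_image_onto _ _ (Pcartan D)) => _ [[c ->]|[i [m [_ ->]]]].
  by exists (pres_gen (Pcartan D) (inl c)); rewrite Uq_j0_gen.
by exists (cartan_alg_h D i m); rewrite Uq_j0_h.
Qed.

Definition Uq_trilinear := two_step_trilinear Uq_coinduction borel_coinduction.

End Main.

Lemma subalg_iso (K : comNzRingType) (A B : algType K) (S : subalgClosed B)
    (j : {lrmorphism A -> B}) : (forall x, j x \in S) ->
  (forall u, u \in S -> exists x, u = j x) -> injective j ->
  exists f : {lrmorphism A -> subalg S}, bijective f /\ forall x, val (f x) = j x.
Proof.
move=> jS Sj ji; exists (subalg_lift jS); split; last exact: subalg_liftE.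
have g_subproof (u : subalg S) : {x | subalg_lift jS x = u}.
  by apply: cid; have [x ux] := Sj _ (valP u); exists x; exact: val_inj.
exists (fun u => sval (g_subproof u)) => [x|u]; last exact: (svalP (g_subproof u)).
by apply: ji; have /(congr1 val) := svalP (g_subproof (subalg_lift jS x)).
Qed.

Theorem theorem3p2 (R : realType) (D : quantum_datum R) :
  [/\ triangular_decomposition (Uq_loop D false) (Uq_cartan D) (Uq_loop D true),
      exists f : {lrmorphism cartan_alg D -> subalg (Uq_cartan D)},
        [/\ bijective f,
            forall c, val (f (cartan_alg_k D c)) = Uq_k D c
          & forall i m, m != 0 -> val (f (cartan_alg_h D i m)) = Uq_h D i m],
      exists f : {lrmorphism loop_alg D true -> subalg (Uq_loop D true)},
        bijective f /\
        (forall i m, val (f (loop_alg_x D true i m)) = Uq_x D true i m)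
    & exists f : {lrmorphism loop_alg D false -> subalg (Uq_loop D false)},
        bijective f /\
        (forall i m, val (f (loop_alg_x D false i m)) = Uq_x D false i m)].
Proof.
have tri := @Uq_trilinear R D.
have em1 s : loop_eps D s 1 = 1 by exact: rmorph1.
have e01 : cartan_eps D 1 = 1 by exact: rmorph1.
split.
- exact: (triangularP (@Uq_jm_mem R D) (@Uq_j0_mem R D) (@Uq_jp_mem R D)
    (@Uq_jm_onto R D) (@Uq_j0_onto R D) (@Uq_jp_onto R D) tri
    (two_step_spanning (@Uq_spanning R D) (@borel_spanning R D))).
- have [f [fb fE]] := subalg_iso (@Uq_j0_mem R D) (@Uq_j0_onto R D)
    (triangular_inj0 tri (em1 false) (em1 true)).
  exists f; split=> [//|c|i m _].
    exact: etrans (fE _) (Uq_j0_gen _).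
  exact: etrans (fE _) (Uq_j0_h _ _).
- have [f [fb fE]] := subalg_iso (@Uq_jp_mem R D) (@Uq_jp_onto R D)
    (triangular_injp tri (em1 false) e01).
  exists f; split; first exact: fb.
  by move=> i m; rewrite fE Uq_jp_x.
- have [f [fb fE]] := subalg_iso (@Uq_jm_mem R D) (@Uq_jm_onto R D)
    (triangular_injm tri e01 (em1 true)).
  exists f; split; first exact: fb.
  by move=> i m; rewrite fE Uq_jm_x.
Qed.
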